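(* Let $A_0$ be a DGCA over $\mathbb{C}$ with a rational T-duality configuration, i.e. a DGCA morphism $f\colon(\mathbb{C}[x_{2L},x_{2R},y_3],\ dx_{2L}=dx_{2R}=0,\ dy_3=x_{2L}x_{2R})\to A_0$. Let $A=A_0[u^{-1},u]]$ with $u$ a degree $2$ variable, equipped with the T-duality configuration obtained by composing $f$ with the inclusion $A_0\hookrightarrow A$, and let $\widehat{\mathcal{G}_L}$, $\widehat{\mathcal{G}_R}$, $\mathcal{T}_{L\to R}$, $\mathcal{T}_{R\to L}$ be the associated extended gerbes and graded Hori maps. For a DGCA $B$ over $\mathbb{C}$ write $B(\tau)=B\otimes_{\mathbb{C}}\mathcal{H}ol(\mathbb{H})$. Let $\mathcal{J}_0^{(s)}(A_0)$ be the space of $A_0$-valued Jacobi forms of weight $s$ and index $0$. Then for all $s_1,s_2\in\mathbb{Z}$ there is a commutative diagram whose four rows are $$\begin{pmatrix}0&1\\-\frac{1}{2\pi i}\frac{\partial}{\partial z}&0\end{pmatrix}\colon\mathcal{J}_0^{(s_1)}(A_0)\oplus\mathcal{J}_0^{(s_2)}(A_0)[-1]\to\mathcal{J}_0^{(s_2)}(A_0)[-1]\oplus\mathcal{J}_0^{(s_1+1)}(A_0),$$ $$\begin{pmatrix}0&1\\-q\frac{\partial}{\partial q}&0\end{pmatrix}\colon\mathcal{M}_0(A_0(\tau))\oplus\mathcal{M}_0(A_0(\tau))[-1]\to\mathcal{M}_0(A_0(\tau))[-1]\oplus\mathcal{M}_0(A_0(\tau)),$$ $$\begin{pmatrix}0&1\\\frac{d}{d\xi}&0\end{pmatrix}\colon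 A(\tau)[[\xi^{-1},\xi]\oplus A(\tau)[[\xi^{-1},\xi][-1]\to A(\tau)[[\xi^{-1},\xi][-1]\oplus A(\tau)[[\xi^{-1},\xi][-2],$$ $$\mathcal{T}_{L\to R}\colon\widehat{\mathcal{G}_L}(\tau)\to\widehat{\mathcal{G}_R}(\tau)[-1].$$ The vertical maps are as follows: - from the first row to the second, $q$-expansion with $q=e^{2\pi iz}$; - from the second to the third, the isomorphisms $\mu_0\oplus\mu_0[-1]$ (left) and $\mu_0[-1]\oplus\mu_{-2}$ (right); - from the third to the fourth, the natural isomorphisms $(\alpha,\beta)\mapsto\alpha(\xi_{2L})+e_{1L}\beta(\xi_{2L})$ (left) and, shifted by $[-1]$, $(\alpha,\beta)\mapsto\alpha(\xi_{2R})+e_{1R}\beta(\xi_{2R})$ (right). That is, the graded Hori transform $\mathcal{T}_{L\to R}$ induces the morphism $$\begin{pmatrix}0&1\\-\frac{1}{2\pi i}\frac{\partial}{\partial z}&0\end{pmatrix}\colon\mathcal{J}_0^{(s_1)}(A_0)\oplus\mathcal{J}_0^{(s_2)}(A_0)[-1]\to\mathcal{J}_0^{(s_2)}(A_0)[-1]\oplus\mathcal{J}_0^{(s_1+1)}(A_0)$$ at the level of index $0$ $A_0$-valued Jacobi forms, for any weights $s_1,s_2\in\mathbb{Z}$. The same holds for the graded Hori transform $\mathcal{T}_{R\to L}$, so that the composition $\mathcal{T}_{R\to L}\circ\mathcal{T}_{L\to R}$ acts as $$\begin{pmatrix}-\frac{1}{2\pi i}\frac{\partial}{\partial z}&0\\0&-\frac{1}{2\pi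 i}\frac{\partial}{\partial z}\end{pmatrix}\colon\mathcal{J}_0^{(s_1)}(A_0)\oplus\mathcal{J}_0^{(s_2)}(A_0)[-1]\to\mathcal{J}_0^{(s_1+1)}(A_0)\oplus\mathcal{J}_0^{(s_2+1)}(A_0)[-1],$$ and similarly for $\mathcal{T}_{L\to R}\circ\mathcal{T}_{R\to L}$.
   Context: DGCA means differential graded commutative algebra (cohomological grading, differential of degree $+1$); the starting DGCA $A_0$ is non-negatively graded. Subscripts on generators denote their degrees. Shifts: $V[m]$ has degree $k$ part $V^{k+m}$. Jacobi forms. $\mathbb{H}$ is the complex upper half plane. A (meromorphic) Jacobi form of weight $s$ and index $0$ is a function $J\colon\mathbb{C}\times\mathbb{H}\to\mathbb{C}$, meromorphic in the variable $z\in\mathbb{C}$ and holomorphic in the variable $\tau\in\mathbb{H}$, such that: (i) $J\big(\frac{z}{c\tau+d},\frac{a\tau+b}{c\tau+d}\big)=(c\tau+d)^sJ(z,\tau)$ for all $\begin{pmatrix}a&b\\c&d\end{pmatrix}\in SL(2,\mathbb{Z})$; (ii) $J(z+\lambda\tau+\mu,\tau)=J(z,\tau)$ for all $(\lambda,\mu)\in\mathbb{Z}^2$; (iii) $J$ has a polar behaviour for $z\to+i\infty$. By (ii) $J$ is periodic of period $1$ in $z$, hence has a $q$-expansion $J(z,\tau)=\sum_{n\ge n_0}\alpha_n(\tau)q^n$ in $q=e^{2\pi iz}$ for some $n_0\in\mathbb{Z}$, bounded below because of (iii). $\mathcal{J}_0(s)$ is the space of Jacobi forms of weight $s$ and index $0$,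 and $\mathcal{J}_0^{(s)}(A_0)=\mathcal{J}_0(s)\otimes_{\mathbb{C}}A_0$. The operator $\frac{\partial}{\partial z}$ acts on the first tensor factor and raises the weight by $1$. $\mathcal{H}ol(\mathbb{H})$ is the ring of holomorphic functions of $\tau\in\mathbb{H}$, seen as a DGCA in degree $0$. $\mathcal{M}_0$ is the $\mathbb{C}$-algebra of meromorphic functions on $\mathbb{C}$ (coordinate $q$) holomorphic on $\mathbb{C}\setminus\{0\}$, in degree $0$, and $\mathcal{M}_0(B)=\mathcal{M}_0\otimes_{\mathbb{C}}B$ for a DGCA $B$. $A_0[u^{-1},u]]$ denotes graded Laurent series in $u$ bounded below in $u$, with $du=0$. For a graded algebra $B$ and a degree $2$ variable $\xi$, $B[[\xi^{-1},\xi]:=B[[\xi^{-1}]][\xi]$ is the graded ring of formal Laurent series bounded above in $\xi$: a degree $k$ element is a formal sum $\sum_{n\in\mathbb{Z}}b_{2n+k}\xi^{-n}$ with $b_j\in B$ of degree $j$ and $b_{2n+k}=0$ for $n\ll0$; $\frac{d}{d\xi}$ sends it to $\sum_n(-n)b_{2n+k}\xi^{-n-1}$. For $i\in\mathbb{Z}$, $\mu_{2i}\colon\mathcal{M}_0(A_0(\tau))\to A(\tau)[[\xi^{-1},\xi][2i]$ is $g(q)=\sum_ng_nq^n\mapsto\xi^ig(u\xi^{-1})=\sum_ng_nu^n\xi^{i-n}$. Gerbes and Hori maps. Still denote by $f$ the T-duality configuration on $A$. Set: - $A_L=(A[e_{1L}],\,de_{1L}=f(x_{2L}))$, $A_R=(A[e_{1R}],\,de_{1R}=f(x_{2R}))$,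 $A_{LR}=(A[e_{1L},e_{1R}],\ de_{1L}=f(x_{2L}),\ de_{1R}=f(x_{2R}))$ (free graded-commutative extensions). - $\widehat{\mathcal{G}_L}=A_L[[\xi_{2L}^{-1},\xi_{2L}]$ and $\widehat{\mathcal{G}_L'}=A_{LR}[[\xi_{2L}^{-1},\xi_{2L}]$, with $d\xi_{2L}=f(y_3)-e_{1L}f(x_{2R})$. - $\widehat{\mathcal{G}_R}=A_R[[\xi_{2R}^{-1},\xi_{2R}]$ and $\widehat{\mathcal{G}_R'}=A_{LR}[[\xi_{2R}^{-1},\xi_{2R}]$, with $d\xi_{2R}=f(y_3)-e_{1R}f(x_{2L})$. Maps: - $\hat\iota_R\colon\widehat{\mathcal{G}_L}\to\widehat{\mathcal{G}_L'}$ and $\hat\iota_L\colon\widehat{\mathcal{G}_R}\to\widehat{\mathcal{G}_R'}$ are the inclusions. - $\hat\nu\colon\widehat{\mathcal{G}_L'}\to\widehat{\mathcal{G}_R'}$ is the DGCA isomorphism that is the identity on $A_{LR}$ and sends $\xi_{2L}\mapsto\xi_{2R}+e_{1L}e_{1R}$, $\xi_{2L}^{-1}\mapsto\xi_{2R}^{-1}-e_{1L}e_{1R}\xi_{2R}^{-2}$ (applied termwise to Laurent series); its inverse sends $\xi_{2R}\mapsto\xi_{2L}-e_{1L}e_{1R}$. - $\hat\pi\colon\widehat{\mathcal{G}_R'}\to\widehat{\mathcal{G}_R}[-1]$ sends $a+e_{1L}b\mapsto b$ for $a,b\in\widehat{\mathcal{G}_R}$; $\hat\pi'\colon\widehat{\mathcal{G}_L'}\to\widehat{\mathcal{G}_L}[-1]$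 sends $a+e_{1R}b\mapsto b$ for $a,b\in\widehat{\mathcal{G}_L}$. The graded Hori maps are $\mathcal{T}_{L\to R}=\hat\pi\circ\hat\nu\circ\hat\iota_R$ and $\mathcal{T}_{R\to L}=\hat\pi'\circ\hat\nu^{-1}\circ\hat\iota_L$; the same symbols denote the maps they induce between $\widehat{\mathcal{G}_L}(\tau)=\widehat{\mathcal{G}_L}\otimes_{\mathbb{C}}\mathcal{H}ol(\mathbb{H})$ and $\widehat{\mathcal{G}_R}(\tau)=\widehat{\mathcal{G}_R}\otimes_{\mathbb{C}}\mathcal{H}ol(\mathbb{H})$ (up to shift). In compositions the second map is understood to be suitably shifted.
   Formalization: The maps built from μ_0 and μ_{-2} are proved injective, not isomorphisms (u is not in the image of μ_0); the fourth row uses the gerbes over A(τ), in which the literal tensor products with Hol(H) embed compatibly with the Hori maps and contain the images of the second row. *)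

(* Defs.v *)
From HB Require Import structures.
From mathcomp Require Import all_boot all_order all_algebra.
From mathcomp Require Import all_classical all_reals all_analysis.
From mathcomp Require Import Rstruct Rstruct_topology.
From mathcomp Require Import complex.

Set Implicit Arguments.
Unset Strict Implicit.
Unset Printing Implicit Defensive.

Import Order.TTheory GRing.Theory Num.Theory numFieldNormedType.Exports.
Local Open Scope classical_set_scope.
Local Open Scope ring_scope.

(* The complex numbers; [C^o] is C as a normed space over itself, so that      *)
(* [derivable (f : C^o -> C^o) z 1] is complex differentiability at z.         *)
Notation C := (complex Rdefinitions.R).

(* A graded vector space is given by its homogeneous components, which are     *)
(* subspaces of an ambient space M. The ambient space is only a container (it  *)
(* need not be the direct sum of the components), and maps between graded      *)
(* spaces matter only on the components.                                       *)
Definition gsp (M : Type) := int -> set M.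

Definition gshift (M : Type) (V : gsp M) (m : int) : gsp M := fun k => V (k + m).

Definition dsum (M N : Type) (V : gsp M) (W : gsp N) : gsp (M * N)%type :=
  fun k => [set x | V k x.1 /\ W k x.2].

Definition submod (M : lmodType C) (V : set M) : Prop :=
  V 0 /\ forall (c : C) x y, V x -> V y -> V (c *: x + y).

Definition gmap (M N : lmodType C) (V : gsp M) (W : gsp N) (f : M -> N) : Prop :=
  forall k, (forall x, V k x -> W k (f x)) /\
    (forall (c : C) x y, V k x -> V k y -> f (c *: x + y) = c *: f x + f y).

Definition ginj (M N : lmodType C) (V : gsp M) (f : M -> N) : Prop :=
  forall k, set_inj (V k) f.

Definition giso (M N : lmodType C) (V : gsp M) (W : gsp N) (f : M -> N) : Prop :=
  gmap V W f /\ forall k, set_bij (V k) (W k) f.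

Definition geq (M N : Type) (V : gsp M) (f g : M -> N) : Prop :=
  forall k x, V k x -> f x = g x.

(* The data of a differential graded algebra: [gr k] is the component of       *)
(* degree k, [dgpar] is the grading involution a |-> (-1)^|a| a.               *)
Record dgalg := DGAlg {
  car :> lmodType C;
  gr : gsp car;
  dg1 : car;
  dgmul : car -> car -> car;
  dgpar : car -> car;
  dgd : car -> car }.
Arguments gr : clear implicits.
Arguments dg1 : clear implicits.
Arguments dgmul {d}.
Arguments dgpar {d}.
Arguments dgd {d}.

Record is_dgca (A : dgalg) : Prop := IsDgca {
  dg_sub : forall k, submod (gr A k);
  dg_one : gr A 0 (dg1 A);
  dg_mul : forall i j a b, gr A i a -> gr A j b -> gr A (i + j) (dgmul a b);
  dg_mul1 : forall i a, gr A i a -> dgmul (dg1 A) a = a;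
  dg_mulA : forall i j k a b c, gr A i a -> gr A j b -> gr A k c ->
    dgmul a (dgmul b c) = dgmul (dgmul a b) c;
  dg_mulDl : forall i j (t : C) a b c, gr A i a -> gr A i b -> gr A j c ->
    dgmul (t *: a + b) c = t *: dgmul a c + dgmul b c;
  dg_mulC : forall i j a b, gr A i a -> gr A j b ->
    dgmul a b = ((-1 : C) ^ (i * j)) *: dgmul b a;
  dg_par : forall i a, gr A i a -> dgpar a = ((-1 : C) ^ i) *: a;
  dg_dif : forall i a, gr A i a -> gr A (i + 1) (dgd a);
  dg_difD : forall i (t : C) a b, gr A i a -> gr A i b ->
    dgd (t *: a + b) = t *: dgd a + dgd b;
  dg_difdif : forall i a, gr A i a -> dgd (dgd a) = 0;
  dg_difM : forall i j a b, gr A i a -> gr A j b ->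
    dgd (dgmul a b) = dgmul (dgd a) b + ((-1 : C) ^ i) *: dgmul a (dgd b) }.

Definition nonneg_graded (A : dgalg) : Prop :=
  forall k a, k < 0 -> gr A k a -> a = 0.

Record dgca_morphism (A B : dgalg) (f : A -> B) : Prop := DgcaMorphism {
  dgm_map : gmap (gr A) (gr B) f;
  dgm_one : f (dg1 A) = dg1 B;
  dgm_mul : forall i j a b, gr A i a -> gr A j b ->
    f (dgmul a b) = dgmul (f a) (f b);
  dgm_dif : forall i a, gr A i a -> f (dgd a) = dgd (f a) }.

Definition ground : dgalg :=
  @DGAlg C^o (fun k => [set c | k != 0 -> c = 0]) 1 *%R id (fun=> 0).

(* B[x] with x of degree 2 and dx = 0; [c n] is the coefficient of x^n. *)
Definition adjoin_even (B : dgalg) : dgalg :=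
  @DGAlg (nat -> B)
    (fun k => [set c | (forall n : nat, gr B (k - 2 * n%:Z) (c n)) /\
                       exists N : nat, forall n, (N <= n)%N -> c n = 0])
    (fun n => if n == 0%N then dg1 B else 0)
    (fun a b n => \sum_(i < n.+1) dgmul (a i) (b (n - i)%N))
    (fun c n => dgpar (c n))
    (fun c n => dgd (c n)).

Definition even_gen (B : dgalg) : adjoin_even B :=
  fun n => if n == 1%N then dg1 B else 0.

Definition even_cst (B : dgalg) (b : B) : adjoin_even B :=
  fun n => if n == 0%N then b else 0.

(* B[e] with e of odd degree m and de = w; the pair (a, b) is a + e b, whence  *)
(* (a + e b)(a' + e b') = a a' + e ((-1)^|a| a b' + b a') and                  *)
(* d(a + e b) = da + w b - e db.                                               *)
Definition adjoin_odd (B : dgalg) (m : int) (w : B) : dgalg :=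
  @DGAlg (B * B)%type
    (fun k => [set x | gr B k x.1 /\ gr B (k - m) x.2])
    (dg1 B, 0)
    (fun x y => (dgmul x.1 y.1, dgmul (dgpar x.1) y.2 + dgmul x.2 y.1))
    (fun x => (dgpar x.1, - dgpar x.2))
    (fun x => (dgd x.1 + dgmul w x.2, - dgd x.2)).

(* Product of Laurent series indexed by the exponent. The sum is over the      *)
(* support of the summand (and 0 if it is infinite); for series that are all   *)
(* bounded below, or all bounded above, the support is finite.                 *)
Definition conv (B : dgalg) (a b : int -> B) : int -> B :=
  fun n => \sum_(i \in [set: int]) dgmul (a i) (b (n - i)).

Definition mono (M : lmodType C) (n : int) (b : M) : int -> M :=
  fun m => if m == n then b else 0.

(* B[u^-1, u]] with u of degree 2 and du = 0. *)
Definition laurent_u (B : dgalg) : dgalg :=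
  @DGAlg (int -> B)
    (fun k => [set c | (forall n : int, gr B (k - 2 * n) (c n)) /\
                       exists N : int, forall n, n < N -> c n = 0])
    (mono 0 (dg1 B))
    (@conv B)
    (fun c n => dgpar (c n))
    (fun c n => dgd (c n)).

(* The graded space B[[xi^-1, xi]; [c m] is the coefficient of xi^m (this is   *)
(* b_{2n+k} with n = -m, in degree k).                                         *)
Definition laurent_xi (B : dgalg) : gsp (int -> B) :=
  fun k => [set c | (forall m : int, gr B (k - 2 * m) (c m)) /\
                    exists N : int, forall m, N < m -> c m = 0].
Arguments laurent_xi : clear implicits.

Definition d_dxi (B : dgalg) (c : int -> B) : int -> B :=
  fun m => ((m + 1)%:~R : C) *: c (m + 1).

(* The DGCA B[[xi^-1, xi] with d xi = w, w of degree 3:                        *)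
(* d(b xi^m) = (db) xi^m + (-1)^|b| m b w xi^(m-1).                            *)
Definition gerbe (B : dgalg) (w : B) : dgalg :=
  @DGAlg (int -> B)
    (laurent_xi B)
    (mono 0 (dg1 B))
    (@conv B)
    (fun c m => dgpar (c m))
    (fun c m => dgd (c m) + ((m + 1)%:~R : C) *: dgmul (dgpar (c (m + 1))) w).

(* (C[x_2L, x_2R], d = 0): x_2L is the inner variable. *)
Definition poly_xLxR : dgalg := adjoin_even (adjoin_even ground).
Definition pxL : poly_xLxR := even_cst (even_gen ground).
Definition pxR : poly_xLxR := even_gen (adjoin_even ground).

(* (C[x_2L, x_2R, y_3], dx_2L = dx_2R = 0, dy_3 = x_2L x_2R). *)
Definition tdual : dgalg := @adjoin_odd poly_xLxR 3 (dgmul pxL pxR).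
Definition x2L : tdual := (pxL, 0).
Definition x2R : tdual := (pxR, 0).
Definition y3 : tdual := (0, dg1 poly_xLxR).

Section Hori.
Variables (B : dgalg) (f : tdual -> B).

Definition B_L : dgalg := @adjoin_odd B 1 (f x2L).
Definition B_R : dgalg := @adjoin_odd B 1 (f x2R).
(* ((a, a'), (b, b')) is a + e_1L a' + e_1R (b + e_1L b'). *)
Definition B_LR : dgalg := @adjoin_odd B_L 1 ((f x2R, 0) : B_L).

Definition e1L : B_LR := ((0, dg1 B), (0, 0)).
Definition e1R : B_LR := ((0, 0), (dg1 B, 0)).

Definition inclL (x : B_L) : B_LR := (x, 0).
Definition inclR (x : B_R) : B_LR := ((x.1, 0), (x.2, 0)).

(* d xi_2L = f(y_3) - e_1L f(x_2R) and d xi_2R = f(y_3) - e_1R f(x_2L). *)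
Definition dxiL : B_L := (f y3, - f x2R).
Definition dxiR : B_R := (f y3, - f x2L).
Definition G_L : dgalg := gerbe dxiL.
Definition G_R : dgalg := gerbe dxiR.
Definition G_L' : dgalg := gerbe (inclL dxiL).
Definition G_R' : dgalg := gerbe (inclR dxiR).

Definition iota_R : G_L -> G_L' := fun c m => inclL (c m).
Definition iota_L : G_R -> G_R' := fun c m => inclR (c m).

(* The m-th power of xi + t, with (xi + t)^-1 = xi^-1 - t xi^-2 (here          *)
(* t = e_1L e_1R or its opposite, so that t^2 = 0), computed in                *)
(* B_LR[[xi^-1, xi].                                                           *)
Definition xi_plus_pow (t : B_LR) (m : int) : int -> B_LR :=
  match m with
  | Posz n => iter n (@conv B_LR (mono 1 (dg1 B_LR) + mono 0 t)) (mono 0 (dg1 B_LR))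
  | Negz n => iter n.+1 (@conv B_LR (mono (-1) (dg1 B_LR) - mono (-2) t))
                (mono 0 (dg1 B_LR))
  end.

(* sum_m c_m xi^m |-> sum_m c_m (xi + t)^m, coefficient by coefficient. *)
Definition subst_xi (t : B_LR) (c : int -> B_LR) : int -> B_LR :=
  fun j => \sum_(m \in [set: int]) dgmul (c m) (xi_plus_pow t m j).

Definition nu : G_L' -> G_R' := subst_xi (dgmul e1L e1R).
Definition nu_inv : G_R' -> G_L' := subst_xi (- dgmul e1L e1R).

(* The b of a + e b, for e = e_1L and a, b in B_R; the sign comes from         *)
(* e_1R e_1L = - e_1L e_1R. See [coefLE].                                      *)
Definition coefL (x : B_LR) : B_R := (x.1.2, - x.2.2).
Definition coefR (x : B_LR) : B_L := x.2.

Definition pi_R : G_R' -> G_R := fun c m => coefL (c m).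
Definition pi_L : G_L' -> G_L := fun c m => coefR (c m).

Definition T_LR : G_L -> G_R := fun x => pi_R (nu (iota_R x)).
Definition T_RL : G_R -> G_L := fun x => pi_L (nu_inv (iota_L x)).

End Hori.

Lemma coefLE (B : dgalg) (f : tdual -> B) (i j : int) (a b : B_R f) :
  is_dgca B -> gr (B_R f) i a -> gr (B_R f) j b ->
  coefL (inclR a + dgmul (e1L f) (inclR b)) = b.
Proof.
case: a b => [a1 a2] [b1 b2] BA /= [Ba1 Ba2] [Bb1 Bb2].
have sub0 k : gr B k 0 by case: (dg_sub BA k).
have mul0 k c : gr B k c -> dgmul 0 c = 0.
  move=> Bc; have := dg_mulDl BA 1 (sub0 0) (sub0 0) Bc.
  rewrite !scale1r addr0 => e; apply: (addrI (dgmul 0 c)); by rewrite -e addr0.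
have muls0 c k : gr B k c -> dgmul c 0 = 0.
  by move=> Bc; rewrite (dg_mulC BA Bc (sub0 0)) (mul0 _ _ Bc) scaler0.
have par0 : dgpar (0 : B) = 0 by rewrite (dg_par BA (sub0 0)) scaler0.
have par1 : dgpar (dg1 B) = dg1 B.
  by rewrite (dg_par BA (dg_one BA)) expr0z scale1r.
have one1 := dg_one BA.
have N1E : - dg1 B = (-1 : C) *: dg1 B + 0 by rewrite addr0 scaleN1r.
have mulN1 c k : gr B k c -> dgmul (- dg1 B) c = - c.
  move=> Bc; rewrite N1E (dg_mulDl BA _ one1 (sub0 0) Bc) (mul0 _ _ Bc).
  by rewrite addr0 scaleN1r (dg_mul1 BA Bc).
rewrite /coefL /inclR /= par0 par1 !(mul0 _ _ Bb1, mul0 _ _ Bb2, muls0 _ _ one1,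
  mul0 _ _ (sub0 0), dg_mul1 BA Bb1, mulN1 _ _ Bb2, mulN1 _ _ (sub0 0)).
congr pair; rewrite /= ?(mul0 _ _ Bb2, muls0 _ _ one1, par0, mul0 _ _ (sub0 0)) ?addr0//.
  by rewrite !add0r.
by rewrite !add0r opprK.
Qed.

(* (alpha, beta) |-> alpha(xi) + e beta(xi), for e = e_1L or e_1R. *)
Definition nat_iso (B : dgalg) (x : (int -> B) * (int -> B)) : int -> (B * B)%type :=
  fun m => (x.1 m, x.2 m).

(* For a space F of complex functions on X and a vector space M, F (x) M is    *)
(* realized as the space of functions sum_i f_i v_i : X -> M with f_i in F and *)
(* v_i in M. Since C is a field, this space has the universal property of the  *)
(* tensor product: see [tliftE].                                               *)
Record expansion (X : Type) (M : lmodType C) := Expansion {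
  rk : nat;
  fs : 'I_rk -> X -> C;
  vs : 'I_rk -> M }.
Arguments fs {X M} e i x.
Arguments vs {X M} e i.

Section Tensor.
Variables (X : Type) (M N : lmodType C) (F : set (X -> C)).

Definition expands (Phi : X -> M) (r : expansion X M) : Prop :=
  (forall i, F (fs r i)) /\ Phi = (fun x => \sum_(i < rk r) fs r i x *: vs r i).

Definition tens (V : set M) : set (X -> M) :=
  [set Phi | exists r, expands Phi r /\ forall i, V (vs r i)].

(* The linear map on F (x) M induced by the bilinear map b. *)
Definition tlift (b : (X -> C) -> M -> N) (Phi : X -> M) : N :=
  match pselect (exists r, expands Phi r) with
  | left e => let r := projT1 (cid e) in \sum_(i < rk r) b (fs r i) (vs r i)
  | right _ => 0
  end.

End Tensor.

Lemma tens_kernel (X : Type) (M N : lmodType C) (F : set (X -> C))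
    (b : (X -> C) -> M -> N) :
  submod (F : set (X -> C^o)) ->
  (forall v (c : C) (g h : X -> C), F g -> F h ->
    b (fun x => c * g x + h x) v = c *: b g v + b h v) ->
  (forall g (c : C) v w, F g -> b g (c *: v + w) = c *: b g v + b g w) ->
  forall n (f : 'I_n -> X -> C) (v : 'I_n -> M), (forall i, F (f i)) ->
  (forall x, \sum_(i < n) f i x *: v i = 0) -> \sum_(i < n) b (f i) (v i) = 0.
Proof.
move=> [F0 FZ] bl br; have FZ' (c : C) (g h : X -> C) : F g -> F h ->
  F (fun x => c * g x + h x) by exact: FZ.
have b0 v : b (fun=> 0) v = 0.
  have := bl v 1 _ _ F0 F0; rewrite scale1r => e; apply: (addrI (b (fun=> 0) v)).
  rewrite addr0 -[LHS]e; congr (b _ v); apply/funext => x; exact: etrans (addr0 _) (mulr0 _).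
have br0 g : F g -> b g 0 = 0.
  move=> Fg; have := br g 1 0 0 Fg; rewrite !scale1r addr0 => e.
  by apply: (addrI (b g 0)); rewrite -e addr0.
have brZ g (c : C) w : F g -> b g (c *: w) = c *: b g w.
  by move=> Fg; rewrite -[c *: w]addr0 br// br0// addr0.
elim=> [|n IH] f v Ff fv0; first by rewrite big_ord0.
have [f00|/existsNP[x0 /eqP fx0]] := pselect (forall x, f ord0 x = 0).
  rewrite big_ord_recl; have -> : f ord0 = (fun=> 0) by apply/funext.
  rewrite b0 add0r; apply: IH => // x.
  by have := fv0 x; rewrite big_ord_recl f00 scale0r add0r.
pose c i := f (lift ord0 i) x0 / f ord0 x0.
have v0E : v ord0 = - \sum_(i < n) c i *: v (lift ord0 i).
  have /(congr1 ( *:%R (f ord0 x0)^-1)) := fv0 x0.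
  rewrite big_ord_recl scalerDr scalerA mulVf// scale1r scaler0 => /eqP.
  rewrite addr_eq0 => /eqP ->; congr (- _); rewrite scaler_sumr.
  by apply: eq_bigr => i _; rewrite scalerA mulrC.
have bsum m (g : X -> C) (w : 'I_m -> M) : F g ->
    b g (\sum_(i < m) w i) = \sum_(i < m) b g (w i).
  move=> Fg; elim: m w => [|m IHm] w; first by rewrite !big_ord0 br0.
  by rewrite !big_ord_recl -[w ord0]scale1r br// IHm !scale1r.
have H := IH (fun i x => - c i * f ord0 x + f (lift ord0 i) x)
  (fun i => v (lift ord0 i)) (fun i => FZ' _ _ _ (Ff ord0) (Ff _)).
rewrite -[RHS]H; last first.
  move=> x; have := fv0 x; rewrite big_ord_recl v0E scalerN scaler_sumr -sumrN.
  rewrite -big_split /= => e; rewrite -[RHS]e; apply: eq_bigr => i _.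
  by rewrite scalerDl mulNr scaleNr scalerA [c i * _]mulrC.
rewrite big_ord_recl v0E -scaleN1r brZ// bsum// scaleN1r -sumrN -big_split /=.
by apply: eq_bigr => i _; rewrite bl// brZ// scaleNr.
Qed.

Lemma tliftE (X : Type) (M N : lmodType C) (F : set (X -> C))
    (b : (X -> C) -> M -> N) :
  submod (F : set (X -> C^o)) ->
  (forall v (c : C) (g h : X -> C), F g -> F h ->
    b (fun x => c * g x + h x) v = c *: b g v + b h v) ->
  (forall g (c : C) v w, F g -> b g (c *: v + w) = c *: b g v + b g w) ->
  forall n (f : 'I_n -> X -> C) (v : 'I_n -> M), (forall i, F (f i)) ->
  tlift F b (fun x => \sum_(i < n) f i x *: v i) = \sum_(i < n) b (f i) (v i).
Proof.
move=> FS bl br n f v Ff; rewrite /tlift; case: pselect => [e|[]]; last first.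
  by exists (Expansion f v).
case: (cid e) => r [Fr rE] /=.
pose g (i : 'I_(rk r + n)) : X -> C :=
  match fintype.split i with inl j => fs r j | inr j => f j end.
pose w (i : 'I_(rk r + n)) : M :=
  match fintype.split i with inl j => vs r j | inr j => - v j end.
have lS j : fintype.split (lshift n j) = inl j := unsplitK (inl j).
have rS j : fintype.split (rshift (rk r) j) = inr j := unsplitK (inr j).
have brN h u : F h -> b h (- u) = - b h u.
  move=> Fh; have b00 : b h 0 = 0.
    have := br h 1 0 0 Fh; rewrite !scale1r addr0 => e0.
    by apply: (addrI (b h 0)); rewrite -e0 addr0.
  by rewrite -[- u]addr0 -scaleN1r br// b00 addr0 scaleN1r.
have := @tens_kernel X M N F b FS bl br _ g w.
rewrite big_split_ord /=.
under eq_bigr do rewrite /g /w lS.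
under [X in _ -> _ -> _ + X = _]eq_bigr do rewrite /g /w rS brN//.
rewrite sumrN => H; apply/eqP; rewrite -subr_eq0; apply/eqP; apply: H.
  by move=> i; rewrite /g; case: fintype.split.
move=> x; rewrite big_split_ord /=.
under eq_bigr do rewrite /g /w lS.
under [X in _ + X = _]eq_bigr do rewrite /g /w rS scalerN.
by rewrite sumrN; have /(congr1 (@^~ x)) /= <- := rE; rewrite subrr.
Qed.

Notation upper := {t : C | 0 < complex.Im t}.
Notation punctured := {q : C | q != 0}.

Definition zero_ext (P : pred C) (g : {x : C | P x} -> C) : C^o -> C^o :=
  fun z => if insub z is Some x then g x else 0.

(* Holomorphy on {x | P x}, which is open in all cases below. *)
Definition holomorphic (P : pred C) (g : {x : C | P x} -> C) : Prop :=
  forall x : {x : C | P x}, derivable (zero_ext g) (val x : C^o) 1.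

(* At p, g has at worst a pole; the value of g at p is irrelevant. *)
Definition meromorphic_at (g : C -> C) (p : C) : Prop :=
  exists (k : nat) (h : C^o -> C^o),
    (\forall z \near (p : C^o), derivable h z 1) /\
    (\forall z \near (p : C^o)^', g z = h z / (z - p) ^+ k).

Definition Hol : set (upper -> C) := [set h | holomorphic h].

Definition M0 : set (punctured -> C) :=
  [set g | holomorphic g /\ meromorphic_at (zero_ext g) 0].

Definition cexp (z : C) : C :=
  Complex (expR (complex.Re z) * cos (complex.Im z))
          (expR (complex.Re z) * sin (complex.Im z)).

Definition two_pi_i : C := Complex 0 (2 * pi).

Definition nome (z : C) : C := cexp (two_pi_i * z).

(* The last condition is the polar behaviour for z -> +i oo: as a function of  *)
(* q, J(., tau) is meromorphic at q = 0.                                       *)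
Record jacobi_form (s : int) (J : C * upper -> C) : Prop := JacobiForm {
  jac_mero : forall (tau : upper) (z : C), meromorphic_at (fun w => J (w, tau)) z;
  jac_hol : forall z : C, Hol (fun tau => J (z, tau));
  jac_mod : forall (a b c d : int), a * d - b * c = 1 ->
    forall (z : C) (tau tau' : upper),
    val tau' = (a%:~R * val tau + b%:~R) / (c%:~R * val tau + d%:~R) ->
    J (z / (c%:~R * val tau + d%:~R), tau') =
      (c%:~R * val tau + d%:~R) ^ s * J (z, tau);
  jac_per : forall (l m : int) (z : C) (tau : upper),
    J (z + l%:~R * val tau + m%:~R, tau) = J (z, tau);
  jac_polar : forall tau : upper, exists phi : C -> C, meromorphic_at phi 0 /\
    exists Y : Rdefinitions.R, forall z : C, Y < complex.Im z ->
      J (z, tau) = phi (nome z) }.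

Definition J0 (s : int) : set (C * upper -> C) := [set J | jacobi_form s J].

(* sum_n c_n q^n is a Laurent series, bounded below, with sum l at q. *)
Definition laurent_sum (c : int -> C) (q l : C) : Prop :=
  exists n0 : int, (forall n, n < n0 -> c n = 0) /\
    series (fun k : nat => c (n0 + k%:Z) * q ^ (n0 + k%:Z) : C^o) @ \oo --> (l : C^o).

Definition laurent_val (c : int -> C) (q : C) : C :=
  xget 0 [set l : C | laurent_sum c q l].

Definition is_laurent (g : punctured -> C) (c : int -> C) : Prop :=
  forall q : punctured, laurent_sum c (val q) (g q).

Definition lcoef (g : punctured -> C) : int -> C :=
  get [set c : int -> C^o | is_laurent g c].

Definition is_qexp (J : C * upper -> C) (alpha : int -> upper -> C) : Prop :=
  (exists n0 : int, forall n tau, n < n0 -> alpha n tau = 0) /\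
  forall (z : C) (tau : upper), laurent_sum (alpha^~ tau) (nome z) (J (z, tau)).

Definition qcoef (J : C * upper -> C) : int -> upper -> C :=
  get [set alpha : int -> upper -> C^o | is_qexp J alpha].

(* B(tau) = B (x) Hol(H), as a DGCA of functions of tau. *)
Definition tau_ext (B : dgalg) : dgalg :=
  @DGAlg (upper -> B) (fun k => tens Hol (gr B k))
    (fun=> dg1 B)
    (fun a b t => dgmul (a t) (b t))
    (fun a t => dgpar (a t))
    (fun a t => dgd (a t)).

Definition M0_of (B : dgalg) : gsp (punctured -> B) := fun k => tens M0 (gr B k).
Arguments M0_of : clear implicits.

Definition J0_of (A0 : dgalg) (s : int) : gsp (C * upper -> A0) :=
  fun k => tens (J0 s) (gr A0 k).
Arguments J0_of : clear implicits.

Section Maps.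
Variable A0 : dgalg.

Local Notation A := (laurent_u A0).

Definition d_dz (s : int) : (C * upper -> A0) -> (C * upper -> A0) :=
  tlift (J0 s) (fun (J : C * upper -> C) (a : A0) (p : C * upper) =>
    ('D_1 (fun w : C^o => J (w, p.2) : C^o) (p.1 : C^o) : C) *: a).

Definition jac_D (s : int) (Phi : C * upper -> A0) : C * upper -> A0 :=
  - two_pi_i^-1 *: d_dz s Phi.

Definition q_d_dq (B : dgalg) : (punctured -> B) -> (punctured -> B) :=
  tlift M0 (fun (g : punctured -> C) (b : B) (q : punctured) =>
    (val q * ('D_1 (zero_ext g) (val q : C^o) : C)) *: b).

Definition qexp (s : int) : (C * upper -> A0) -> (punctured -> tau_ext A0) :=
  tlift (J0 s) (fun (J : C * upper -> C) (a : A0) (q : punctured) (t : upper) =>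
    laurent_val ((qcoef J)^~ t) (val q) *: a).

(* [mu i] is mu_{2i}: g(q) = sum_n g_n q^n |-> sum_n g_n u^n xi^(i-n); the     *)
(* coefficient of xi^m is g_(i-m) u^(i-m).                                     *)
Definition mu (i : int) : (punctured -> tau_ext A0) -> (int -> tau_ext A) :=
  tlift M0 (fun (g : punctured -> C) (b : tau_ext A0) (m : int) (t : upper) =>
    mono (i - m) (lcoef g (i - m) *: b t)).

(* The matrices (0 1; -(1/(2 pi i)) d/dz 0), (0 1; -q d/dq 0), (0 1; d/dxi 0). *)
Definition row_J (s1 : int) (x : (C * upper -> A0) * (C * upper -> A0)) :=
  (x.2, jac_D s1 x.1).
Definition row_M (x : (punctured -> tau_ext A0) * (punctured -> tau_ext A0)) :=
  (x.2, - q_d_dq x.1).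
Definition row_xi (x : (int -> tau_ext A) * (int -> tau_ext A)) :=
  (x.2, d_dxi x.1).

End Maps.

Definition conf_A (A0 : dgalg) (f : tdual -> A0) : tdual -> laurent_u A0 :=
  fun x => mono 0 (f x).
Definition conf_At (A0 : dgalg) (f : tdual -> A0) :
    tdual -> tau_ext (laurent_u A0) :=
  fun x _ => conf_A f x.

(* A function of tau with values in B[e][[xi^-1, xi], seen as a series in xi   *)
(* with coefficients in B(tau)[e].                                             *)
Definition tau_coefs (B : dgalg) (Phi : upper -> int -> (B * B)%type) :
    int -> (tau_ext B * tau_ext B)%type :=
  fun m => (fun t => (Phi t m).1, fun t => (Phi t m).2).

Definition dmap (M M' N N' : Type) (f : M -> M') (g : N -> N') (x : M * N) :=
  (f x.1, g x.2).

Section Diagram.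
Variable A0 : dgalg.

Local Notation A := (laurent_u A0).
Local Notation At := (tau_ext (laurent_u A0)).

Definition src_J (s1 s2 : int) := dsum (J0_of A0 s1) (gshift (J0_of A0 s2) (-1)).
Definition tgt_J (s1 s2 : int) :=
  dsum (gshift (J0_of A0 s2) (-1)) (J0_of A0 (s1 + 1)).

Definition src_M := dsum (M0_of (tau_ext A0)) (gshift (M0_of (tau_ext A0)) (-1)).
Definition tgt_M := dsum (gshift (M0_of (tau_ext A0)) (-1)) (M0_of (tau_ext A0)).

Definition src_xi := dsum (laurent_xi At) (gshift (laurent_xi At) (-1)).
Definition tgt_xi :=
  dsum (gshift (laurent_xi At) (-1)) (gshift (laurent_xi At) (-2)).

(* The four rows, with T : G -> G'[-1] as the last one, the vertical maps and  *)
(* the commutativity of the three squares.                                     *)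
Definition hori_diagram (s1 s2 : int) (G G' : gsp (int -> At * At)%type)
    (T : (int -> At * At)%type -> (int -> At * At)%type) : Prop :=
  [/\ [/\ gmap (src_J s1 s2) (tgt_J s1 s2) (@row_J A0 s1),
          gmap src_M tgt_M (@row_M A0),
          gmap src_xi tgt_xi (@row_xi A0)
        & gmap G (gshift G' (-1)) T],
      [/\ gmap (src_J s1 s2) src_M (dmap (@qexp A0 s1) (@qexp A0 s2)),
          gmap src_M src_xi (dmap (@mu A0 0) (@mu A0 0)),
          ginj src_M (dmap (@mu A0 0) (@mu A0 0))
        & giso src_xi G (@nat_iso At)],
      [/\ gmap (tgt_J s1 s2) tgt_M (dmap (@qexp A0 s2) (@qexp A0 (s1 + 1))),
          gmap tgt_M tgt_xi (dmap (@mu A0 0) (@mu A0 (-1))),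
          ginj tgt_M (dmap (@mu A0 0) (@mu A0 (-1)))
        & giso tgt_xi (gshift G' (-1)) (@nat_iso At)]
    & [/\ geq (src_J s1 s2)
            (fun x => row_M (dmap (@qexp A0 s1) (@qexp A0 s2) x))
            (fun x => dmap (@qexp A0 s2) (@qexp A0 (s1 + 1)) (row_J s1 x)),
          geq src_M
            (fun x => row_xi (dmap (@mu A0 0) (@mu A0 0) x))
            (fun x => dmap (@mu A0 0) (@mu A0 (-1)) (row_M x))
        & geq src_xi
            (fun x => T (nat_iso x))
            (fun x => nat_iso (row_xi x))]].

(* T' o T, as a map G -> G[-2], acts as diag(D, D), D = -(1/(2 pi i)) d/dz.    *)
Definition hori_composite (s1 s2 : int) (G : gsp (int -> At * At)%type)
    (T T' : (int -> At * At)%type -> (int -> At * At)%type) : Prop :=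
  [/\ gmap (src_J s1 s2) (src_J (s1 + 1) (s2 + 1))
        (dmap (@jac_D A0 s1) (@jac_D A0 s2)),
      gmap G (gshift G (-2)) (fun x => T' (T x)),
      gmap src_M (gshift src_xi (-2)) (dmap (@mu A0 (-1)) (@mu A0 (-1))),
      giso (gshift src_xi (-2)) (gshift G (-2)) (@nat_iso At)
    & geq (src_J s1 s2)
        (fun x => T' (T (nat_iso (dmap (@mu A0 0) (@mu A0 0)
                    (dmap (@qexp A0 s1) (@qexp A0 s2) x)))))
        (fun x => nat_iso (dmap (@mu A0 (-1)) (@mu A0 (-1))
                    (dmap (@qexp A0 (s1 + 1)) (@qexp A0 (s2 + 1))
                       (dmap (@jac_D A0 s1) (@jac_D A0 s2) x))))].

(* The algebraic tensor products H(tau) = H (x) Hol(H), for the gerbes H and   *)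
(* H' over A, sit inside the gerbes G and G' over A(tau) (in which the tensor  *)
(* product is taken coefficientwise in xi), compatibly with the Hori maps S    *)
(* and T, and contain the images of the second row.                            *)
Definition hori_restrict (H H' : gsp (upper -> int -> A * A)%type)
    (S : (int -> A * A)%type -> (int -> A * A)%type)
    (G : gsp (int -> At * At)%type)
    (T : (int -> At * At)%type -> (int -> At * At)%type) : Prop :=
  [/\ gmap H (gshift H' (-1)) (fun Phi t => S (Phi t)),
      gmap H G (@tau_coefs A),
      ginj H (@tau_coefs A),
      geq H (fun Phi => tau_coefs (fun t => S (Phi t))) (fun Phi => T (tau_coefs Phi))
    & forall k,
      (forall x, src_M k x -> exists2 Phi, H k Phi &
         tau_coefs Phi = nat_iso (dmap (@mu A0 0) (@mu A0 0) x)) /\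
      (forall x, tgt_M k x -> exists2 Phi, H' (k - 1) Phi &
         tau_coefs Phi = nat_iso (dmap (@mu A0 0) (@mu A0 (-1)) x))].

End Diagram.

(* Main.v *)
Require Import Defs.
From HB Require Import structures.
From mathcomp Require Import all_boot all_order all_algebra.
From mathcomp Require Import all_classical all_reals all_analysis.
From mathcomp Require Import Rstruct Rstruct_topology.
From mathcomp Require Import complex.
From mathcomp Require Import zify ring lra.
From Coquelicot Require Hierarchy RInt Continuity.

Set Implicit Arguments.
Unset Strict Implicit.
Unset Printing Implicit Defensive.

Import Order.TTheory GRing.Theory Num.Theory numFieldNormedType.Exports.
Local Open Scope classical_set_scope.
Local Open Scope ring_scope.

(* A Jacobi form of index 0 is constant in z: near q = 0 it is h(q)/q^k with h *)
(* holomorphic, and invariance under z |-> z + tau, i.e. q |-> p q with        *)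
(* 0 < |p| < 1, leaves only the term q^k of h. Hence d/dz kills Jacobi forms   *)
(* and their q-expansions have a single term. The other analytic input is that *)
(* a function holomorphic on C \ {0} with at most a pole at 0 is the sum of a  *)
(* Laurent series: multiplied by a power of q it is entire, and entire         *)
(* functions are power series by Goursat's theorem and the Cauchy formula,     *)
(* here over squares. On the algebraic side, (xi + e_1L e_1R)^m equals         *)
(* xi^m + m e_1L e_1R xi^(m-1), since the square of e_1L e_1R vanishes, so     *)
(* both Hori maps send alpha + e beta to beta + e' d alpha/d xi.               *)

(** Both Hori maps have the same form in coordinates. Write an element of a gerbe as alpha + e beta
    with alpha and beta Laurent series in xi. The map [nu] replaces xi by xi + t with t = e_1L e_1R
    of square zero, so xi^m becomes xi^m + m t xi^(m-1), and projecting along the odd generator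
    leaves beta + e' d alpha / d xi. This is [T_LRE] and [T_RLE], with [Tshift] as common value. It
    gives the square between rows three and four, and makes the composite of the two maps act as d/d
    xi on each component.

    The square between rows two and three holds on monomials: [mu 0] sends q^n to u^n xi^(-n), whose
    derivative -n u^n xi^(-1-n) is [mu (-1)] of -q d/dq q^n ([d_dxi_mu]). To pass to functions,
    elements of M_0 must be sums of Laurent series that can be differentiated termwise ([lcoefP],
    [lcoef_qD]). Such an element is an entire function divided by a power of q ([M0_repr]), and an
    entire function is the sum of a power series: bisection gives [goursat], a recursion on contour
    integrals gives [taylor_square], comparison of squares of growing size gives [entire_series],
    and [psum_derive] handles the derivative.

    The square between rows one and two rests on [jacobi_const]: forms of index 0 do not depend on
    z, so d/dz kills them, their q-expansion is a constant term, and the lower entries of both paths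
    around the square vanish ([row_M_qexp]).

    Maps on tensor products are defined by choosing an expansion; [tlift_sum] evaluates them on any
    expansion. Injectivity of [mu] is again a statement about expansions, settled by
    [tens_kernel]. *)

Local Notation R := Rdefinitions.R.
Local Notation normc := Normc.normc.

(** * Integrals of real functions *)

Lemma normcD (x y : C) : normc (x + y) <= normc x + normc y.
Proof. exact: le_normcD. Qed.

Lemma normcM (x y : C) : normc (x * y) = normc x * normc y.
Proof. exact: Normc.normcM. Qed.

Lemma normcN (x : C) : normc (- x) = normc x.
Proof. by rewrite -mulN1r normcM; case: x => a b /=; rewrite oppr0 sqrrN expr1n expr0n addr0 sqrtr1 mul1r. Qed.

Lemma normcB (x y : C) : normc (x - y) <= normc x + normc y.
Proof. by rewrite -[normc y]normcN; exact: normcD. Qed.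

Lemma normc_ge0 (x : C) : 0 <= normc x.
Proof. by case: x => a b; exact: sqrtr_ge0. Qed.

Lemma normc0 : normc (0 : C) = 0.
Proof. exact: Normc.normc0. Qed.

Lemma normc1 : normc (1 : C) = 1.
Proof. exact: Normc.normc1. Qed.

Lemma normc_gt0 (x : C) : (0 < normc x) = (x != 0).
Proof.
rewrite lt_neqAle normc_ge0 andbT; congr negb; apply/eqP/eqP => [e|->].
  by apply: Normc.eq0_normc.
by rewrite normc0.
Qed.

Lemma normcX (x : C) n : normc (x ^+ n) = normc x ^+ n.
Proof. by elim: n => [|n IH]; rewrite ?expr0 ?normc1// !exprS normcM IH. Qed.

Lemma normcV (x : C) : normc x^-1 = (normc x)^-1.
Proof. exact: Normc.normcV. Qed.

Lemma normc_real (r : R) : normc (real_complex _ r : C) = `|r|.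
Proof. by rewrite /= expr0n addr0 sqrtr_sqr. Qed.

Lemma Re_le_normc (z : C) : `|complex.Re z| <= normc z.
Proof. by case: z => a b /=; rewrite -sqrtr_sqr ler_wsqrtr// lerDl sqr_ge0. Qed.

Lemma Im_le_normc (z : C) : `|complex.Im z| <= normc z.
Proof. by case: z => a b /=; rewrite -sqrtr_sqr ler_wsqrtr// lerDr sqr_ge0. Qed.

Lemma normc_le_ReIm (z : C) : normc z <= `|complex.Re z| + `|complex.Im z|.
Proof.
case: z => a b /=; rewrite -[leRHS]ger0_norm ?addr_ge0// -sqrtr_sqr.
rewrite ler_wsqrtr// sqrrD !real_normK ?num_real// lerD2r.
by rewrite lerDl mulrn_wge0// mulr_ge0.
Qed.

Lemma cReD (x y : C) : complex.Re (x + y) = complex.Re x + complex.Re y.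
Proof. by case: x; case: y. Qed.

Lemma cImD (x y : C) : complex.Im (x + y) = complex.Im x + complex.Im y.
Proof. by case: x; case: y. Qed.

(** Riemann integration suffices, since the contours below consist of segments and the integrands
    are continuous on them. *)
Definition rint (f : R -> R) (a b : R) : R :=
  @RInt.RInt Hierarchy.R_CompleteNormedModule f a b.
Definition rex (f : R -> R) (a b : R) : Prop :=
  @RInt.ex_RInt Hierarchy.R_NormedModule f a b.

Lemma rex_continuous f (a b : R) : a <= b ->
  (forall t, a <= t <= b -> forall e, 0 < e -> exists2 d, 0 < d &
     forall u, `|u - t| < d -> `|f u - f t| < e) -> rex f a b.
Proof.
move=> ab cf; apply: (@RInt.ex_RInt_continuous Hierarchy.R_CompleteNormedModule) => z.
rewrite RminE RmaxE (min_idPl ab) (max_idPr ab) => -[/RleP az /RleP zb].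
apply/Hierarchy.continuity_pt_filterlim => e /RltP e0.
have [|d d0 H] := cf z _ e e0; first by rewrite az.
exists d; split; first exact/RltP.
move=> x [_]; rewrite /= => /RltP; rewrite RdistE => xz.
by apply/RltP; rewrite RdistE; exact: H.
Qed.

Lemma rint_lin f g (a b k : R) : rex f a b -> rex g a b ->
  rint (fun t => k * f t + g t) a b = k * rint f a b + rint g a b.
Proof.
move=> rf rg; rewrite /rint.
rewrite (@RInt.RInt_plus Hierarchy.R_CompleteNormedModule (fun t => k * f t) g)//.
  by rewrite (@RInt.RInt_scal Hierarchy.R_CompleteNormedModule f).
exact: (@RInt.ex_RInt_scal Hierarchy.R_NormedModule f).
Qed.

Lemma rex_lin f g (a b k : R) : rex f a b -> rex g a b ->
  rex (fun t => k * f t + g t) a b.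
Proof.
move=> rf rg.
apply: (@RInt.ex_RInt_plus Hierarchy.R_NormedModule (fun t => k * f t) g) => //.
exact: (@RInt.ex_RInt_scal Hierarchy.R_NormedModule f).
Qed.

Lemma rint_Chasles f (a b c : R) : rex f a b -> rex f b c ->
  rint f a c = rint f a b + rint f b c.
Proof.
by move=> ab bc; rewrite /rint -(@RInt.RInt_Chasles Hierarchy.R_CompleteNormedModule f a b c).
Qed.

Lemma rex_sub f (a b c d : R) : a <= b <= c -> c <= d -> rex f a d -> rex f b c.
Proof.
move=> /andP[ab bc] cd ad.
have : rex f a c.
  apply: (@RInt.ex_RInt_Chasles_1 Hierarchy.R_CompleteNormedModule) ad.
  by split; apply/RleP => //; exact: le_trans bc.
apply: (@RInt.ex_RInt_Chasles_2 Hierarchy.R_CompleteNormedModule).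
by split; apply/RleP.
Qed.

Lemma rint_bound f (a b M : R) : a <= b -> rex f a b ->
  (forall t, a <= t <= b -> `|f t| <= M) -> `|rint f a b| <= (b - a) * M.
Proof.
move=> ab rf fM; apply/RleP; rewrite -RabsE; apply: RInt.abs_RInt_le_const => //.
  exact/RleP.
by move=> t [/RleP at_ /RleP tb]; apply/RleP/fM; rewrite at_.
Qed.

Lemma rint_ext f g (a b : R) : a <= b -> (forall t, a <= t <= b -> f t = g t) ->
  rint f a b = rint g a b.
Proof.
move=> ab fg; apply: (@RInt.RInt_ext Hierarchy.R_CompleteNormedModule) => x.
rewrite RminE RmaxE (min_idPl ab) (max_idPr ab) => -[/RltP ax /RltP xb].
by apply: fg; rewrite !ltW.
Qed.

Lemma rex_ext f g (a b : R) : a <= b -> (forall t, a <= t <= b -> f t = g t) ->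
  rex f a b -> rex g a b.
Proof.
move=> ab fg; apply: (@RInt.ex_RInt_ext Hierarchy.R_NormedModule) => x.
rewrite RminE RmaxE (min_idPl ab) (max_idPr ab) => -[/RltP ax /RltP xb].
by apply: fg; rewrite !ltW.
Qed.

Lemma rint_cst (k a b : R) : rint (fun=> k) a b = (b - a) * k.
Proof. by rewrite /rint (@RInt.RInt_const Hierarchy.R_CompleteNormedModule). Qed.

Lemma rex_cst (k a b : R) : rex (fun=> k) a b.
Proof. exact: (@RInt.ex_RInt_const Hierarchy.R_NormedModule). Qed.

Lemma rint_comp_lin f (u v a b : R) : rex f (u * a + v) (u * b + v) ->
  rint (fun t => u * f (u * t + v)) a b = rint f (u * a + v) (u * b + v).
Proof.
by move=> rf; rewrite /rint -(@RInt.RInt_comp_lin Hierarchy.R_CompleteNormedModule f u v a b).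
Qed.

Lemma rint_swap f (a b : R) : rex f a b -> rint f b a = - rint f a b.
Proof.
by move=> rf; rewrite /rint -(@RInt.opp_RInt_swap Hierarchy.R_CompleteNormedModule f).
Qed.

Lemma rex_id (a b : R) : a <= b -> rex id a b.
Proof. by move=> ab; apply: rex_continuous => // t _ e e0; exists e. Qed.

(* The reflection [t |-> a + b - t] gives [2 I = (a + b) (b - a)]. *)
Lemma rint_id (a b : R) : a <= b -> rint id a b = (b ^+ 2 - a ^+ 2) / 2.
Proof.
move=> ab; have ri := rex_id ab.
have ex1 : rex id (-1 * a + (a + b)) (-1 * b + (a + b)).
  rewrite (_ : -1 * a + _ = b); last by ring.
  rewrite (_ : -1 * b + _ = a); last by ring.
  exact: RInt.ex_RInt_swap.
have := rint_comp_lin ex1.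
rewrite (_ : -1 * a + _ = b); last by ring.
rewrite (_ : -1 * b + _ = a); last by ring.
rewrite (rint_swap ri) => e.
have e2 : rint (fun t => -1 * (-1 * t + (a + b))) a b = rint (fun t => 1 * t + - (a + b)) a b.
  by apply: rint_ext => // t _; ring.
move: e; rewrite e2 rint_lin ?rint_cst//; last exact: rex_cst.
by move=> e; lra.
Qed.

(** * Integrals along the boundary of a rectangle *)

Definition cint (g : R -> C) (a b : R) : C :=
  Complex (rint (fun t => complex.Re (g t)) a b) (rint (fun t => complex.Im (g t)) a b).

Definition cex (g : R -> C) (a b : R) : Prop :=
  rex (fun t => complex.Re (g t)) a b /\ rex (fun t => complex.Im (g t)) a b.

Lemma cint_ext f g (a b : R) : a <= b -> (forall t, a <= t <= b -> f t = g t) ->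
  cint f a b = cint g a b.
Proof. by move=> ab fg; congr Complex; apply: rint_ext => // t /fg ->. Qed.

Lemma cReM (x y : C) : complex.Re (x * y) =
  complex.Re x * complex.Re y - complex.Im x * complex.Im y.
Proof. by case: x; case: y. Qed.

Lemma cImM (x y : C) : complex.Im (x * y) =
  complex.Re x * complex.Im y + complex.Im x * complex.Re y.
Proof. by case: x; case: y. Qed.

Lemma cex_lin f g (k : C) (a b : R) : cex f a b -> cex g a b ->
  cex (fun t => k * f t + g t) a b.
Proof.
move=> [rf jf] [rg jg]; split.
  rewrite [X in rex X](_ : _ = fun t => complex.Re k * complex.Re (f t) +
      (- complex.Im k * complex.Im (f t) + complex.Re (g t))); last first.
    by apply/funext => t; rewrite cReD cReM; ring.
  by do !apply: rex_lin.
rewrite [X in rex X](_ : _ = fun t => complex.Re k * complex.Im (f t) +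
    (complex.Im k * complex.Re (f t) + complex.Im (g t))); last first.
  by apply/funext => t; rewrite cImD cImM; ring.
by do !apply: rex_lin.
Qed.

Lemma cint_lin f g (k : C) (a b : R) : cex f a b -> cex g a b ->
  cint (fun t => k * f t + g t) a b = k * cint f a b + cint g a b.
Proof.
move=> [rf jf] [rg jg]; rewrite /cint.
rewrite [X in Complex (rint X _ _)](_ : _ = fun t => complex.Re k * complex.Re (f t) +
    (- complex.Im k * complex.Im (f t) + complex.Re (g t))); last first.
  by apply/funext => t; rewrite cReD cReM; ring.
rewrite [X in Complex _ (rint X _ _)](_ : _ = fun t => complex.Re k * complex.Im (f t) +
    (complex.Im k * complex.Re (f t) + complex.Im (g t))); last first.
  by apply/funext => t; rewrite cImD cImM; ring.
rewrite !rint_lin//; try exact: rex_lin.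
by case: k => k1 k2 /=; congr Complex; rewrite /=; ring.
Qed.

Lemma cint_Chasles f (a b c : R) : a <= b <= c -> cex f a c ->
  cint f a c = cint f a b + cint f b c.
Proof.
move=> abc [rf jf]; have /andP[ab bc] := abc.
have sub1 g : rex g a c -> rex g a b by apply: rex_sub; rewrite ?lexx.
have sub2 g : rex g a c -> rex g b c by apply: rex_sub; rewrite ?lexx ?ab.
by rewrite /cint (@rint_Chasles _ a b c) 1?[X in Complex _ X](@rint_Chasles _ a b c)//; auto.
Qed.

Lemma cex_sub f (a b c d : R) : a <= b <= c -> c <= d -> cex f a d -> cex f b c.
Proof. by move=> abc cd [rf jf]; split; [exact: rex_sub rf|exact: rex_sub jf]. Qed.

(** The factor 2 comes from bounding the real and imaginary parts separately; any constant serves in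
    the estimates below. *)
Lemma cint_bound f (a b M : R) : a <= b -> cex f a b ->
  (forall t, a <= t <= b -> normc (f t) <= M) -> normc (cint f a b) <= 2 * ((b - a) * M).
Proof.
move=> ab [rf jf] fM; apply: le_trans (normc_le_ReIm _) _.
rewrite mulr2n mulrDl mul1r lerD//; apply: rint_bound => // t /fM.
  exact: le_trans (Re_le_normc _).
exact: le_trans (Im_le_normc _).
Qed.

Lemma cint_cst (k : C) (a b : R) : cint (fun=> k) a b = real_complex _ (b - a) * k.
Proof. by rewrite /cint !rint_cst; case: k => k1 k2; congr Complex; rewrite /= mul0r ?subr0 ?addr0. Qed.

Lemma cex_cst (k : C) (a b : R) : cex (fun=> k) a b.
Proof. by split; exact: rex_cst. Qed.

(** * Complex continuity and differentiability with real tolerances *)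

Definition ccont (F : C -> C) (z : C) : Prop := forall e : R, 0 < e ->
  exists2 d : R, 0 < d & forall w, normc (w - z) < d -> normc (F w - F z) < e.

(** Stated without division, so that w = z need not be excluded; [is_derive_cdiff] identifies [l]
    with the derivative. *)
Definition cdiff (F : C -> C) (z l : C) : Prop := forall e : R, 0 < e ->
  exists2 d : R, 0 < d & forall w, normc (w - z) < d ->
    normc (F w - F z - l * (w - z)) <= e * normc (w - z).

Lemma cdiff_lip F z l : cdiff F z l -> exists2 d : R, 0 < d &
  forall w, normc (w - z) < d -> normc (F w - F z) <= (normc l + 1) * normc (w - z).
Proof.
move=> /(_ 1 ltr01)[d d0 H]; exists d => // w /H; rewrite mul1r => h.
rewrite (_ : F w - F z = (F w - F z - l * (w - z)) + l * (w - z)); last by rewrite subrK.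
by apply: le_trans (normcD _ _) _; rewrite normcM addrC mulrDl mul1r lerD2l.
Qed.

Lemma cdiff_ccont F z l : cdiff F z l -> ccont F z.
Proof.
move=> /cdiff_lip[d d0 H] e e0; have l0 : 0 < normc l + 1 by rewrite ltr_wpDl ?normc_ge0.
exists (Num.min d (e / (normc l + 1))); first by rewrite lt_min d0 divr_gt0.
move=> w; rewrite lt_min => /andP[/H h1 h2]; apply: le_lt_trans h1 _.
by rewrite mulrC -ltr_pdivlMr.
Qed.

Lemma cex_cont (g : R -> C) (a b : R) : a <= b ->
  (forall t, a <= t <= b -> forall e, 0 < e -> exists2 d, 0 < d &
     forall u, `|u - t| < d -> normc (g u - g t) < e) -> cex g a b.
Proof.
move=> ab cg; split; apply: rex_continuous => // t /cg H e /H[d d0 {}H]; exists d => // u /H.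
  by apply: le_lt_trans; rewrite -raddfB; apply: le_trans (Re_le_normc _).
by apply: le_lt_trans; rewrite -raddfB; apply: le_trans (Im_le_normc _).
Qed.

Definition hz (F : C -> C) (y t : R) := F (Complex t y).
Definition vt (F : C -> C) (x t : R) := F (Complex x t).

Lemma cex_hz F y (a b : R) : a <= b ->
  (forall t, a <= t <= b -> ccont F (Complex t y)) -> cex (hz F y) a b.
Proof.
move=> ab cF; apply: cex_cont => // t /cF H e /H[d d0 {}H]; exists d => // u ut.
apply: H; rewrite (_ : Complex u y - _ = real_complex _ (u - t)) ?normc_real//.
by apply/eqP; rewrite eq_complex /=; apply/andP; split; apply/eqP; ring.
Qed.

Lemma cex_vt F x (a b : R) : a <= b ->
  (forall t, a <= t <= b -> ccont F (Complex x t)) -> cex (vt F x) a b.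
Proof.
move=> ab cF; apply: cex_cont => // t /cF H e /H[d d0 {}H]; exists d => // u ut.
apply: H; rewrite (_ : Complex x u - _ = Complex 0 1 * real_complex _ (u - t)).
  by rewrite normcM normc_real /= expr0n /= add0r expr1n sqrtr1 mul1r.
by apply/eqP; rewrite eq_complex /=; apply/andP; split; apply/eqP; ring.
Qed.

(** The contour integral of F dz, counterclockwise; on the vertical sides dz is i dt. *)
Definition bint F (x0 x1 y0 y1 : R) : C :=
  cint (hz F y0) x0 x1 + Complex 0 1 * cint (vt F x1) y0 y1
  - cint (hz F y1) x0 x1 - Complex 0 1 * cint (vt F x0) y0 y1.

Definition bex F (x0 x1 y0 y1 : R) : Prop :=
  [/\ cex (hz F y0) x0 x1, cex (vt F x1) y0 y1, cex (hz F y1) x0 x1 & cex (vt F x0) y0 y1].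

Lemma bint_lin F G (k : C) x0 x1 y0 y1 : bex F x0 x1 y0 y1 -> bex G x0 x1 y0 y1 ->
  bint (fun z => k * F z + G z) x0 x1 y0 y1 = k * bint F x0 x1 y0 y1 + bint G x0 x1 y0 y1.
Proof.
move=> [F1 F2 F3 F4] [G1 G2 G3 G4]; rewrite /bint /=.
rewrite (cint_lin k F1 G1) (cint_lin k F2 G2) (cint_lin k F3 G3) (cint_lin k F4 G4).
ring.
Qed.

Lemma bex_lin F G (k : C) x0 x1 y0 y1 : bex F x0 x1 y0 y1 -> bex G x0 x1 y0 y1 ->
  bex (fun z => k * F z + G z) x0 x1 y0 y1.
Proof.
by move=> [F1 F2 F3 F4] [G1 G2 G3 G4]; split;
  [exact: cex_lin F1 G1|exact: cex_lin F2 G2|exact: cex_lin F3 G3|exact: cex_lin F4 G4].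
Qed.

Lemma bint_vsplit F x0 x1 x2 y0 y1 : x0 <= x1 <= x2 ->
  cex (hz F y0) x0 x2 -> cex (hz F y1) x0 x2 ->
  bint F x0 x2 y0 y1 = bint F x0 x1 y0 y1 + bint F x1 x2 y0 y1.
Proof.
move=> xx h0 h1; rewrite /bint (cint_Chasles xx h0) (cint_Chasles xx h1); ring.
Qed.

Lemma bint_hsplit F x0 x1 y0 y1 y2 : y0 <= y1 <= y2 ->
  cex (vt F x0) y0 y2 -> cex (vt F x1) y0 y2 ->
  bint F x0 x1 y0 y2 = bint F x0 x1 y0 y1 + bint F x0 x1 y1 y2.
Proof.
move=> yy h0 h1; rewrite /bint (cint_Chasles yy h0) (cint_Chasles yy h1); ring.
Qed.

Definition boundary (x0 x1 y0 y1 : R) (z : C) : Prop :=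
  [/\ x0 <= complex.Re z <= x1, y0 <= complex.Im z <= y1 &
    [\/ complex.Re z = x0, complex.Re z = x1, complex.Im z = y0 | complex.Im z = y1]].

Lemma bint_ext F G x0 x1 y0 y1 : x0 <= x1 -> y0 <= y1 ->
  (forall z, boundary x0 x1 y0 y1 z -> F z = G z) ->
  bint F x0 x1 y0 y1 = bint G x0 x1 y0 y1.
Proof.
move=> x01 y01 FG; rewrite /bint; congr (_ + _ * _ - _ - _ * _); apply: cint_ext => // t tt';
  apply: FG; split; rewrite //= ?lexx ?x01 ?y01//.
- by constructor 3.
- by constructor 2.
- by constructor 4.
- by constructor 1.
Qed.

Lemma bex_ccont F x0 x1 y0 y1 : x0 <= x1 -> y0 <= y1 ->
  (forall z, boundary x0 x1 y0 y1 z -> ccont F z) -> bex F x0 x1 y0 y1.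
Proof.
move=> x01 y01 cF; split.
- by apply: cex_hz => // t tt; apply: cF; split; rewrite //= ?lexx ?y01//; constructor 3.
- by apply: cex_vt => // t tt; apply: cF; split; rewrite //= ?lexx ?x01//; constructor 2.
- by apply: cex_hz => // t tt; apply: cF; split; rewrite //= ?lexx ?y01//; constructor 4.
- by apply: cex_vt => // t tt; apply: cF; split; rewrite //= ?lexx ?x01//; constructor 1.
Qed.

Lemma normc_i : normc (Complex 0 1 : C) = 1.
Proof. by rewrite /= expr0n /= add0r expr1n sqrtr1. Qed.

(** The perimeter is twice the sum of the two side lengths, and [cint_bound] contributes another
    factor 2. *)
Lemma bint_bound F x0 x1 y0 y1 M : x0 <= x1 -> y0 <= y1 -> bex F x0 x1 y0 y1 ->
  (forall z, boundary x0 x1 y0 y1 z -> normc (F z) <= M) ->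
  normc (bint F x0 x1 y0 y1) <= 4 * ((x1 - x0) + (y1 - y0)) * M.
Proof.
move=> x01 y01 [F1 F2 F3 F4] FM; rewrite /bint.
have B1 : normc (cint (hz F y0) x0 x1) <= 2 * ((x1 - x0) * M).
  apply: cint_bound => // t tt; apply: FM; split; rewrite //= ?lexx ?y01//; by constructor 3.
have B2 : normc (cint (vt F x1) y0 y1) <= 2 * ((y1 - y0) * M).
  apply: cint_bound => // t tt; apply: FM; split; rewrite //= ?lexx ?x01//; by constructor 2.
have B3 : normc (cint (hz F y1) x0 x1) <= 2 * ((x1 - x0) * M).
  apply: cint_bound => // t tt; apply: FM; split; rewrite //= ?lexx ?y01//; by constructor 4.
have B4 : normc (cint (vt F x0) y0 y1) <= 2 * ((y1 - y0) * M).
  apply: cint_bound => // t tt; apply: FM; split; rewrite //= ?lexx ?x01//; by constructor 1.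
set A1 := cint (hz F y0) x0 x1 in B1 *; set A2 := cint (vt F x1) y0 y1 in B2 *.
set A3 := cint (hz F y1) x0 x1 in B3 *; set A4 := cint (vt F x0) y0 y1 in B4 *.
have : normc (A1 + Complex 0 1 * A2 - A3 - Complex 0 1 * A4) <=
    normc A1 + normc A2 + normc A3 + normc A4.
  apply: le_trans (normcB _ _) _; rewrite normcM normc_i mul1r lerD2r.
  apply: le_trans (normcB _ _) _; rewrite lerD2r.
  by apply: le_trans (normcD _ _) _; rewrite normcM normc_i mul1r.
move=> /le_trans; apply; lra.
Qed.

(** Affine functions are what [goursat] subtracts from F near the limit point; their integrals come
    by direct computation from those of 1 and t. *)
Lemma bint_affine (k c : C) x0 x1 y0 y1 : x0 <= x1 -> y0 <= y1 ->
  bint (fun z => k * z + c) x0 x1 y0 y1 = 0.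
Proof.
move=> x01 y01.
have eid a b : a <= b -> cex (fun t => real_complex _ t : C) a b.
  by move=> ab; split; [exact: rex_id|exact: rex_cst].
have cid a b : a <= b -> cint (fun t => real_complex _ t : C) a b =
    real_complex _ ((b ^+ 2 - a ^+ 2) / 2).
  by move=> ab; rewrite /cint rint_id// rint_cst mulr0.
have bid : bex id x0 x1 y0 y1.
  apply: bex_ccont => // z _; apply: (@cdiff_ccont _ _ 1) => e e0; exists 1 => // w _.
  by rewrite mul1r subrr normc0 mulr_ge0// ?normc_ge0// ltW.
have bc : bex (fun=> c) x0 x1 y0 y1 by split; exact: cex_cst.
rewrite (@bint_lin id (fun=> c))//.
have -> : bint (fun=> c) x0 x1 y0 y1 = 0.
  by rewrite /bint /hz /vt !cint_cst; ring.
have hE y a b : a <= b -> cint (hz id y) a b = real_complex _ ((b ^+ 2 - a ^+ 2) / 2) +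
    real_complex _ (b - a) * Complex 0 y.
  move=> ab; rewrite -[X in X + _]mul1r -cid// -cint_cst -cint_lin; last 2 first.
  - exact: eid.
  - exact: cex_cst.
  by apply: cint_ext => // t _; apply/eqP; rewrite /hz eq_complex /=; apply/andP; split; apply/eqP; ring.
have vE x a b : a <= b -> cint (vt id x) a b =
    Complex 0 1 * real_complex _ ((b ^+ 2 - a ^+ 2) / 2) +
    real_complex _ (b - a) * Complex x 0.
  move=> ab; rewrite -cid// -cint_cst -cint_lin; last 2 first.
  - exact: eid.
  - exact: cex_cst.
  by apply: cint_ext => // t _; apply/eqP; rewrite /vt eq_complex /=; apply/andP; split; apply/eqP; ring.
rewrite /bint !hE// !vE// addr0; apply/eqP; rewrite mulf_eq0; apply/orP; right.
by rewrite eq_complex /=; apply/andP; split; apply/eqP; ring.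
Qed.

(** * Goursat's theorem *)

Lemma nested_intervals (a b : nat -> R) : (forall n, a n <= b n) ->
  (forall n, a n <= a n.+1) -> (forall n, b n.+1 <= b n) ->
  exists c, forall n, a n <= c <= b n.
Proof.
move=> ab aS bS.
have amono m n : (m <= n)%N -> a m <= a n.
  by move=> /subnK <-; elim: (n - m)%N => // k IH; rewrite addSn (le_trans IH).
have bmono m n : (m <= n)%N -> b n <= b m.
  by move=> /subnK <-; elim: (n - m)%N => // k IH; rewrite addSn (le_trans (bS _)).
have amb m n : a m <= b n.
  have [mn|/ltnW nm] := leqP m n; first exact: le_trans (amono _ _ mn) (ab n).
  exact: le_trans (ab m) (bmono _ _ nm).
exists (sup (range a)) => n; apply/andP; split.
  by apply: ub_le_sup; [exists (b 0%N) => _ [m _ <-]|exists n].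
by apply: ge_sup; [exists (a 0%N), 0%N|move=> _ [m _ <-]].
Qed.

Definition inrect (x0 x1 y0 y1 : R) (z : C) : Prop :=
  x0 <= complex.Re z <= x1 /\ y0 <= complex.Im z <= y1.

Definition holo_on (F : C -> C) (P : C -> Prop) : Prop :=
  forall z, P z -> exists l, cdiff F z l.

Lemma holo_on_cont F P : holo_on F P -> forall z, P z -> ccont F z.
Proof. by move=> hF z /hF[l]; exact: cdiff_ccont. Qed.

Lemma boundary_inrect x0 x1 y0 y1 z : boundary x0 x1 y0 y1 z -> inrect x0 x1 y0 y1 z.
Proof. by case. Qed.

(** Integrals along shared sides cancel, so the four quarters add up to the whole, and one of them
    carries at least a fourth of its modulus. *)
Lemma bint_quarter F x0 x y0 y : x0 <= x -> y0 <= y ->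
  holo_on F (inrect x0 x y0 y) ->
  exists x0' y0', let w := (x - x0) / 2 in let h := (y - y0) / 2 in
  [/\ x0 <= x0', x0' + w <= x, y0 <= y0', y0' + h <= y &
     normc (bint F x0 x y0 y) <= 4 * normc (bint F x0' (x0' + w) y0' (y0' + h))].
Proof.
move=> xx yy /holo_on_cont cF.
set w := (x - x0) / 2; set h := (y - y0) / 2.
have w0 : 0 <= w by rewrite /w; lra.
have h0 : 0 <= h by rewrite /h; lra.
have xE : x = x0 + w + w by rewrite /w; lra.
have yE : y = y0 + h + h by rewrite /h; lra.
have cH t : y0 <= t <= y -> cex (hz F t) x0 x.
  by move=> tt; apply: cex_hz => // s ss; apply: cF; split.
have cV t : x0 <= t <= x -> cex (vt F t) y0 y.
  by move=> tt; apply: cex_vt => // s ss; apply: cF; split.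
have cVs t a b : x0 <= t <= x -> y0 <= a <= b -> b <= y -> cex (vt F t) a b.
  by move=> tt ab b_; apply: cex_sub (cV t tt).
have sp : bint F x0 x y0 y =
    (bint F x0 (x0 + w) y0 (y0 + h) + bint F x0 (x0 + w) (y0 + h) (y0 + h + h)) +
    (bint F (x0 + w) (x0 + w + w) y0 (y0 + h) +
     bint F (x0 + w) (x0 + w + w) (y0 + h) (y0 + h + h)).
  rewrite -!bint_hsplit -?yE; try by (apply/andP; split; lra).
  - by rewrite -xE -bint_vsplit//; [apply/andP; split; lra|apply: cH|apply: cH];
      apply/andP; split; lra.
  - by apply: cV; apply/andP; split; lra.
  - by apply: cV; apply/andP; split; lra.
  - by apply: cV; apply/andP; split; lra.
  - by apply: cV; apply/andP; split; lra.
set A1 := bint F x0 (x0 + w) y0 _ in sp; set A2 := bint F x0 (x0 + w) (y0 + h) _ in sp.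
set A3 := bint F (x0 + w) _ y0 _ in sp; set A4 := bint F (x0 + w) _ (y0 + h) _ in sp.
set N := normc (bint F x0 x y0 y).
have Ns : N <= normc A1 + normc A2 + (normc A3 + normc A4).
  rewrite /N sp; apply: le_trans (normcD _ _) _; apply: lerD; exact: normcD.
(* If all four quarters failed, [Ns] would give N < N. *)
have [h1|h1] := leP N (4 * normc A1); first by exists x0, y0; split => //; lra.
have [h2|h2] := leP N (4 * normc A2); first by exists x0, (y0 + h); split => //; lra.
have [h3|h3] := leP N (4 * normc A3); first by exists (x0 + w), y0; split => //; lra.
have [h4|h4] := leP N (4 * normc A4); first by exists (x0 + w), (y0 + h); split => //; lra.
lra.
Qed.

Lemma half_pow_small (c d : R) : 0 < d -> exists n, c / 2 ^+ n < d.
Proof.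
move=> d0; have [c0|c0] := leP c 0.
  by exists 0%N; rewrite expr0 divr1 (le_lt_trans c0).
exists (Num.bound (c / d)); rewrite ltr_pdivrMr ?exprn_gt0// -ltr_pdivrMl// mulrC.
apply: lt_le_trans (archi_boundP _) _; first by rewrite divr_ge0// ltW.
by rewrite -natrX ler_nat ltnW// ltn_expl.
Qed.

(** Repeated quartering loses a factor 4 at each stage and shrinks to a point p. Near p, F differs
    from an affine function by at most e |z - p|, so the integral over the n-th rectangle is O(e
    4^(-n)), with e as small as desired. Hence the original integral is 0. *)
Theorem goursat F x0 x1 y0 y1 : x0 <= x1 -> y0 <= y1 ->
  holo_on F (inrect x0 x1 y0 y1) -> bint F x0 x1 y0 y1 = 0.
Proof.
move=> x01 y01 hF.
pose w := x1 - x0; pose h := y1 - y0.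
have w0 : 0 <= w by rewrite /w; lra.
have h0 : 0 <= h by rewrite /h; lra.
pose W (n : nat) := w / 2 ^+ n; pose H (n : nat) := h / 2 ^+ n.
have WS n : W n.+1 = W n / 2 by rewrite /W exprSr invfM mulrA.
have HS n : H n.+1 = H n / 2 by rewrite /H exprSr invfM mulrA.
have W0 n : 0 <= W n by rewrite divr_ge0// exprn_ge0.
have H0 n : 0 <= H n by rewrite divr_ge0// exprn_ge0.
pose In n (p : R * R) := [/\ x0 <= p.1, p.1 + W n <= x1, y0 <= p.2 & p.2 + H n <= y1].
pose B n (p : R * R) := normc (bint F p.1 (p.1 + W n) p.2 (p.2 + H n)).
(* Guarding the conclusion by [In] makes the relation total, as [choice] requires; outside [In] any
   point will do. *)
have step (q : nat * (R * R)) : exists p', In q.1 q.2 ->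
   [/\ In q.1.+1 p', q.2.1 <= p'.1 /\ p'.1 + W q.1.+1 <= q.2.1 + W q.1,
       q.2.2 <= p'.2 /\ p'.2 + H q.1.+1 <= q.2.2 + H q.1 & B q.1 q.2 <= 4 * B q.1.+1 p'].
  case: q => n [x y] /=.
  have [iN|] := pselect (In n (x, y)); last by move=> ni; exists (x, y) => /ni.
  have [ix1 ix2 iy1 iy2] := iN; rewrite /= in ix1 ix2 iy1 iy2.
  have := W0 n; have := H0 n => Hn Wn.
  have [| | |x' [y']] := @bint_quarter F x (x + W n) y (y + H n).
  - lra.
  - lra.
  - move=> z [/andP[a b] /andP[c d]]; apply: hF; split; apply/andP; split; lra.
  rewrite /= (addrAC x) subrr add0r (addrAC y) subrr add0r -WS -HS => -[a1 a2 b1 b2 NB].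
  exists (x', y') => _; split => //; split => //=; lra.
have [g gP] := choice step.
pose S := fix S n := if n is m.+1 then g (m, S m) else (x0, y0).
have SI n : In n (S n).
  elim: n => [|n IH]; first by split; rewrite /= /W /H ?expr0 ?divr1 /w /h ?lexx//; lra.
  by have [] := gP (n, S n) IH.
have SP n := gP (n, S n) (SI n).
have SB n : B 0%N (S 0%N) <= (2 ^+ n) ^+ 2 * B n (S n).
  elim: n => [|n IH]; first by rewrite expr0 expr1n mul1r.
  apply: le_trans IH _; rewrite [2 ^+ n.+1]exprSr exprMn -[leRHS]mulrA ler_wpM2l ?sqr_ge0//.
  by have [_ _ _ /= +] := SP n; rewrite (_ : 2 ^+ 2 = 4 :> R)//; ring.
have [a aP] : exists a, forall n, (S n).1 <= a <= (S n).1 + W n.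
  apply: nested_intervals => n; first by rewrite lerDl.
    by have [_ []] := SP n.
  by have [_ []] := SP n.
have [b bP] : exists b, forall n, (S n).2 <= b <= (S n).2 + H n.
  apply: nested_intervals => n; first by rewrite lerDl.
    by have [_ _ []] := SP n.
  by have [_ _ []] := SP n.
pose p : C := Complex a b.
have [l lP] : exists l, cdiff F p l.
  apply: hF; have [/= i1 i2 i3 i4] := SI 0%N.
  have := aP 0%N; have := bP 0%N => /= /andP[b1 b2] /andP[a1 a2].
  by split; apply/andP; split; rewrite /=; lra.
have BE : B 0%N (S 0%N) = normc (bint F x0 x1 y0 y1).
  by rewrite /B /= /W /H !expr0 !divr1 /w /h !(addrC _ (_ - _)) !subrK.
apply: Normc.eq0_normc; rewrite -BE; apply/eqP; rewrite eq_le normc_ge0 andbT leNgt.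
apply/negP => Npos; set N := B 0%N (S 0%N) in Npos *.
(* Chosen to make 4 e (w + h)^2 at most N / 2 at the end; the added 1 keeps the denominator positive
   when the rectangle is a point. *)
pose e := N / (8 * ((w + h) ^+ 2 + 1)).
have D0 : 0 < (w + h) ^+ 2 + 1 by rewrite ltr_wpDl ?sqr_ge0.
have e0 : 0 < e by rewrite divr_gt0// mulr_gt0.
have [d d0 {}lP] := lP e e0.
have [n nd] := half_pow_small (w + h) d0.
pose T := (w + h) / 2 ^+ n.
have TE : W n + H n = T by rewrite /W /H /T -mulrDl.
have [i1 i2 i3 i4] := SI n.
have near_ z : inrect (S n).1 ((S n).1 + W n) (S n).2 ((S n).2 + H n) z -> normc (z - p) <= T.
  move=> [/andP[c1 c2] /andP[c3 c4]]; apply: le_trans (normc_le_ReIm _) _; rewrite -TE.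
  have /andP[a1 a2] := aP n; have /andP[b1 b2] := bP n.
  rewrite !raddfB /=; apply: lerD; rewrite ler_norml; apply/andP; split; lra.
have xx : (S n).1 <= (S n).1 + W n by rewrite lerDl.
have yy : (S n).2 <= (S n).2 + H n by rewrite lerDl.
pose A (z : C) := l * z + (F p - l * p).
have bF : bex F (S n).1 ((S n).1 + W n) (S n).2 ((S n).2 + H n).
  apply: bex_ccont => // z /boundary_inrect[/andP[c1 c2] /andP[c3 c4]].
  by apply: (holo_on_cont hF); split; apply/andP; split; lra.
have bA : bex A (S n).1 ((S n).1 + W n) (S n).2 ((S n).2 + H n).
  apply: bex_ccont => // z _; apply: (@cdiff_ccont _ _ l) => r r0; exists 1 => // u _.
  rewrite (_ : A u - A z - l * (u - z) = 0) ?normc0 ?mulr_ge0 ?normc_ge0 ?ltW// /A; ring.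
(* The affine part [A] integrates to 0, and |F - A| is at most e T on the n-th rectangle. *)
have key : B n (S n) <= 4 * (W n + H n) * (e * T).
  have -> : B n (S n) = normc (bint (fun z => -1 * A z + F z) (S n).1 ((S n).1 + W n) (S n).2 ((S n).2 + H n)).
    by rewrite bint_lin// bint_affine// mulr0 add0r.
  have -> : W n + H n = ((S n).1 + W n - (S n).1) + ((S n).2 + H n - (S n).2) by ring.
  apply: bint_bound => //; first exact: bex_lin.
  move=> z /boundary_inrect /near_ zT.
  have := lP z (le_lt_trans zT nd).
  rewrite (_ : F z - F p - l * (z - p) = -1 * A z + F z); last by rewrite /A; ring.
  by move=> /le_trans; apply; rewrite ler_wpM2l// ltW.
have := SB n; rewrite -/N => NB.
have : N <= (2 ^+ n) ^+ 2 * (4 * T * (e * T)).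
  by apply: le_trans NB _; rewrite ler_wpM2l ?sqr_ge0// -TE; rewrite TE in key *.
(* The factor 4^n lost by n bisections cancels against the square of T. *)
have TT (m s r : R) : m != 0 -> m ^+ 2 * (4 * (s / m) * (r * (s / m))) = 4 * r * s ^+ 2.
  by move=> m0; field.
rewrite TT ?expf_neq0 ?pnatr_eq0//.
have : 4 * e * (w + h) ^+ 2 <= N / 2.
  rewrite (_ : N / 2 = 4 * e * ((w + h) ^+ 2 + 1)).
    by rewrite ler_wpM2l ?lerDl// mulr_ge0// ltW.
  rewrite /e; field; exact: lt0r_neq0.
lra.
Qed.

(* Cut the frame between the two rectangles into four rectangles. *)
Lemma bint_hole F x0 x1 y0 y1 a b c d :
  x0 <= a -> a <= b -> b <= x1 -> y0 <= c -> c <= d -> d <= y1 ->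
  holo_on F (fun z => inrect x0 x1 y0 y1 z /\
    ~ (a < complex.Re z < b /\ c < complex.Im z < d)) ->
  bint F x0 x1 y0 y1 = bint F a b c d.
Proof.
move=> xa ab bx yc cd dy hF; have cF := holo_on_cont hF.
have xx : x0 <= x1 by lra.
have yy : y0 <= y1 by lra.
have h0 : cex (hz F y0) x0 x1.
  by apply: cex_hz => // t tt; apply: cF; split => [|[/= _ /andP[? ?]]]; [split; rewrite //= lexx|lra].
have h1 : cex (hz F y1) x0 x1.
  by apply: cex_hz => // t tt; apply: cF; split => [|[/= _ /andP[? ?]]]; [split; rewrite //= lexx ?yy|lra].
have va : cex (vt F a) y0 y1.
  apply: cex_vt => // t tt; apply: cF; split => [|[/= /andP[? ?]]]; last lra.
  by split => //=; apply/andP; split; lra.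
have vb : cex (vt F b) y0 y1.
  apply: cex_vt => // t tt; apply: cF; split => [|[/= /andP[? ?]]]; last lra.
  by split => //=; apply/andP; split; lra.
have sub f s t s' t' : s <= s' -> s' <= t' -> t' <= t -> cex f s t -> cex f s' t'.
  by move=> ? ? ?; apply: cex_sub => //; apply/andP; split.
rewrite (@bint_vsplit F x0 a x1)//; last by apply/andP; split; lra.
rewrite goursat ?add0r//; last first.
  move=> z [/andP[? ?] /andP[? ?]]; apply: hF; split => [|[/andP[? ?]]]; last lra.
  by split; apply/andP; split; lra.
rewrite (@bint_vsplit F a b x1); last 3 first.
- by apply/andP; split; lra.
- by apply: sub h0; lra.
- by apply: sub h1; lra.
rewrite (@goursat F b x1)//; last first.
  move=> z [/andP[? ?] /andP[? ?]]; apply: hF; split => [|[/andP[? ?]]]; last lra.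
  by split; apply/andP; split; lra.
rewrite addr0 (@bint_hsplit F a b y0 c y1)//; last by apply/andP; split; lra.
rewrite goursat ?add0r//; last first.
  move=> z [/andP[? ?] /andP[? ?]]; apply: hF; split => [|[_ /andP[? ?]]]; last lra.
  by split; apply/andP; split; lra.
rewrite (@bint_hsplit F a b c d y1); last 3 first.
- by apply/andP; split; lra.
- by apply: sub va; lra.
- by apply: sub vb; lra.
rewrite (@goursat F a b d y1) ?addr0//.
move=> z [/andP[? ?] /andP[? ?]]; apply: hF; split => [|[_ /andP[? ?]]]; last lra.
by split; apply/andP; split; lra.
Qed.

(** By [bint_hole] the contour can be shrunk to a small square around p, where the integral is
    bounded by a constant times M times the side. *)
Lemma bint_removable F x0 x1 y0 y1 (p : C) (M d0 : R) :
  x0 < complex.Re p < x1 -> y0 < complex.Im p < y1 -> 0 < d0 ->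
  holo_on F (fun z => inrect x0 x1 y0 y1 z /\ z <> p) ->
  (forall z, z <> p -> normc (z - p) < d0 -> normc (F z) <= M) ->
  bint F x0 x1 y0 y1 = 0.
Proof.
case: p => px py /= /andP[px0 px1] /andP[py0 py1] d00 hF FM.
have M0 : 0 <= M.
  apply: le_trans (normc_ge0 _) (FM (Complex (px + d0 / 2) py) _ _).
    by move=> [] /eqP; rewrite -subr_eq0 addrC addKr; lra.
  rewrite (_ : _ - _ = real_complex _ (d0 / 2)); first by rewrite normc_real ger0_norm; lra.
  by apply/eqP; rewrite eq_complex /=; apply/andP; split; apply/eqP; ring.
apply: Normc.eq0_normc; apply/eqP; rewrite eq_le normc_ge0 andbT leNgt; apply/negP.
set N := normc _ => N0.
(* The first four terms keep the small square inside the rectangle, d0 / 4 keeps it in the disc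
   where F is bounded, and the last makes the bound 16 e M smaller than N. *)
pose e := Num.min (Num.min (Num.min (px - x0) (x1 - px)) (Num.min (py - y0) (y1 - py)))
   (Num.min (d0 / 4) (N / (32 * (M + 1)))).
have e0 : 0 < e.
  by rewrite !lt_min !subr_gt0 px0 px1 py0 py1 !divr_gt0// mulr_gt0// ltr_wpDl.
have : e <= e by []; rewrite {2}/e !le_min => /andP[/andP[/andP[e1 e2] /andP[e3 e4]] /andP[e5 e6]].
have hole : bint F x0 x1 y0 y1 = bint F (px - e) (px + e) (py - e) (py + e).
  apply: bint_hole; try lra.
  move=> z [zin zout]; apply: hF; split => // zp; apply: zout; rewrite zp /=.
  by split; apply/andP; split; lra.
have bz z : boundary (px - e) (px + e) (py - e) (py + e) z -> z <> Complex px py.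
  by move=> [_ _ +] zp; rewrite zp /=; case; lra.
have : N <= 4 * (((px + e) - (px - e)) + ((py + e) - (py - e))) * M.
  rewrite /N hole; apply: bint_bound; [lra|lra| |].
    apply: bex_ccont; [lra|lra|] => z bd; apply: (holo_on_cont hF); split; last exact: bz.
    by case: bd => /andP[? ?] /andP[? ?] _; split; apply/andP; split; lra.
  move=> z bd; apply: FM; first exact: bz.
  apply: le_lt_trans (normc_le_ReIm _) _; rewrite !raddfB /=.
  case: bd => /andP[? ?] /andP[? ?] _.
  have : `|complex.Re z - px| <= e by rewrite ler_norml; apply/andP; split; lra.
  have : `|complex.Im z - py| <= e by rewrite ler_norml; apply/andP; split; lra.
  lra.
rewrite (_ : _ * M = 16 * (e * M)); last by ring.
have : e * M <= N / 32.
  have : e * (32 * (M + 1)) <= N by rewrite -ler_pdivlMr// mulr_gt0// ltr_wpDl.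
  have : e * (32 * (M + 1)) = 32 * (e * M) + 32 * e by ring.
  lra.
lra.
Qed.

(** * Complex derivatives as limits in C *)

(** The norm of C takes its values in C itself. This rewrites it with the real [normc];
    [near_complex] does the same for neighbourhoods. *)
Lemma normCE (z : C) : `|z| = (normc z)%:C%C.
Proof. by case: z => a b; rewrite normc_def. Qed.

Lemma gt0_complex (e : C) : 0 < e -> exists2 r : R, 0 < r & e = r%:C%C.
Proof.
case: e => a b; rewrite ltcE /= => /andP[/eqP-> a0]; by exists a.
Qed.

Lemma near_complex (P : C -> Prop) (z : C) :
  (\forall w \near (z : C^o), P w) <-> exists2 d : R, 0 < d & forall w, normc (w - z) < d -> P w.
Proof.
split.
  move=> /nbhs_ballP[e /gt0_complex[r r0 ->] H]; exists r => // w wz.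
  by apply: H; rewrite /ball /= -normrN opprB normCE ltcR.
move=> [d d0 H]; apply/nbhs_ballP; exists d%:C%C; first by rewrite /= ltcR.
by move=> w; rewrite /ball /= -normrN opprB normCE ltcR; exact: H.
Qed.

Lemma near_complex_punctured (P : C -> Prop) (z : C) :
  (\forall w \near (z : C^o)^', P w) <-> exists2 d : R, 0 < d &
    forall w, w <> z -> normc (w - z) < d -> P w.
Proof.
split.
  by rewrite near_withinE => /near_complex[d d0 H]; exists d => // w /eqP wz /H; apply.
move=> [d d0 H]; rewrite near_withinE; apply/near_complex; exists d => // w wd /eqP wz.
exact: H.
Qed.

Lemma is_derive_cdiff (f : C -> C) (z l : C) :
  is_derive (z : C^o) (1 : C^o) (f : C^o -> C^o) (l : C^o) <-> cdiff f z l.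
Proof.
split.
  case=> df dfE e e0.
  have : (fun h : C^o => h^-1 *: ((f \o shift (z : C^o)) (h *: (1 : C^o)) - f z) : C^o) @ (0 : C^o)^' --> (l : C^o).
    by move: df; rewrite /derivable -dfE.
  move=> /cvgrPdist_le /(_ e%:C%C); rewrite ltcR => /(_ e0) /near_complex_punctured[d d0 H].
  exists d => // w wz; have [->|wz0] := eqVneq w z.
    by rewrite !subrr mulr0 subr0 normc0 mulr0.
  have wz1 : w - z != 0 by rewrite subr_eq0.
  have := H (w - z); rewrite subr0 => /(_ (elimN eqP wz1) wz).
  rewrite normCE lecR /= [_ *: 1]mulr1 subrK => h.
  have -> : f w - f z - l * (w - z) = - ((w - z) * (l - (w - z)^-1 * (f w - f z))).
    by field.
  by rewrite normcN normcM mulrC ler_wpM2r ?normc_ge0.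
move=> H.
have cv : (fun h : C^o => h^-1 *: ((f \o shift (z : C^o)) (h *: (1 : C^o)) - f z) : C^o) @ (0 : C^o)^' --> (l : C^o).
  apply/cvgrPdist_le => e /gt0_complex[r r0 ->].
  have [d d0 {}H] := H r r0; apply/near_complex_punctured; exists d => // h /eqP h0.
  rewrite subr0 => hd; rewrite normCE lecR /= [_ *: 1]mulr1.
  have := H (h + z); rewrite addrK => /(_ hd) H1.
  have -> : l - h^-1 *: (f (h + z) - f z) = - (h^-1 * (f (h + z) - f z - l * h)).
    by rewrite [_ *: _]/(_ * _) mulrBr mulrCA mulVf// mulr1 opprB.
  rewrite normcN normcM normcV -ler_pdivlMl ?invr_gt0 ?normc_gt0// invrK.
  by rewrite [_ * r]mulrC.
split; first by apply/cvg_ex; exists l.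
exact: cvg_lim cv.
Qed.

Lemma derivable_cdiff (f : C -> C) (z : C) :
  derivable (f : C^o -> C^o) z 1 <-> exists l, cdiff f z l.
Proof.
split => [/derivableP /is_derive_cdiff H|[l /is_derive_cdiff[]//]].
by exists ('D_1 (f : C^o -> C^o) z).
Qed.

Lemma cvg_complex (u : nat -> C) (l : C) :
  (u : nat -> C^o) @ \oo --> (l : C^o) <->
  forall e : R, 0 < e -> exists N, forall n, (N <= n)%N -> normc (u n - l) < e.
Proof.
split.
  move=> /cvgrPdist_lt H e e0; have := H e%:C%C; rewrite ltcR => /(_ e0)[N _ {}H].
  by exists N => n /H; rewrite /= normCE ltcR -normcN opprB.
move=> H; apply/cvgrPdist_lt => e /gt0_complex[r r0 ->].
have [N {}H] := H r r0; exists N => // n /H.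
by rewrite /= normCE ltcR -[in X in _ -> X]normcN opprB.
Qed.

(** * Cauchy integrals over squares *)

Definition holo (f : C -> C) (z : C) : Prop := exists l, cdiff f z l.

Lemma holo_cont f z : holo f z -> ccont f z.
Proof. by case=> l; exact: cdiff_ccont. Qed.

Lemma holo_cst (c z : C) : holo (fun=> c) z.
Proof. by apply/derivable_cdiff; exact: (@derivable_cst C C^o C^o). Qed.

Lemma holo_id (z : C) : holo id z.
Proof. by apply/derivable_cdiff; exact: (@derivable_id C C^o). Qed.

Lemma holoD f g z : holo f z -> holo g z -> holo (fun w => f w + g w) z.
Proof. by move=> /derivable_cdiff hf /derivable_cdiff hg; apply/derivable_cdiff; exact: derivableD hf hg. Qed.

Lemma holoB f g z : holo f z -> holo g z -> holo (fun w => f w - g w) z.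
Proof. by move=> /derivable_cdiff hf /derivable_cdiff hg; apply/derivable_cdiff; exact: derivableB hf hg. Qed.

Lemma holoM f g z : holo f z -> holo g z -> holo (fun w => f w * g w) z.
Proof. by move=> /derivable_cdiff hf /derivable_cdiff hg; apply/derivable_cdiff; exact: derivableM hf hg. Qed.

Lemma holoV f z : f z != 0 -> holo f z -> holo (fun w => (f w)^-1) z.
Proof. by move=> fz /derivable_cdiff hf; apply/derivable_cdiff; exact: derivableV fz hf. Qed.

Lemma holo_ratX n z : z != 0 -> holo (fun w => (w ^+ n)^-1) z.
Proof.
move=> z0; apply: holoV; first by rewrite expf_neq0.
by elim: n => [|n IH]; [exact: holo_cst|under eq_fun do rewrite exprS; apply: holoM IH; exact: holo_id].
Qed.

(** The maximum theorem on a segment, applied to the modulus of [g]. *)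
Lemma cont_bounded (g : R -> C) (a b : R) : a <= b ->
  (forall t, a <= t <= b -> forall e, 0 < e -> exists2 d, 0 < d &
     forall u, `|u - t| < d -> normc (g u - g t) < e) ->
  exists M, forall t, a <= t <= b -> normc (g t) <= M.
Proof.
move=> ab cg.
have cn t : Rdefinitions.Rle a t /\ Rdefinitions.Rle t b ->
    Ranalysis1.continuity_pt (fun t => normc (g t)) t.
  move=> [/RleP at_ /RleP tb] e /RltP e0.
  have [|d d0 H] := cg t _ e e0; first by rewrite at_.
  exists d; split; first exact/RltP.
  move=> x [_]; rewrite /= => /RltP; rewrite RdistE => /H xt.
  apply/RltP; rewrite RdistE; apply: le_lt_trans xt.
  rewrite ler_norml lerBlDr lerBrDr; apply/andP; split.
    by rewrite addrC lerBlDr addrC -lerBlDr -[normc (_ - _)]normcN opprB lerBlDr (le_trans _ (normcD _ _))// subrK.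
  by rewrite (le_trans _ (normcD _ _))// subrK.
have [M [MP _]] := Rtopology.continuity_ab_maj _ _ _ (elimT RleP ab) cn.
exists (normc (g M)) => t /andP[at_ tb]; apply/RleP/MP; split; exact/RleP.
Qed.

Lemma boundary_bounded F x0 x1 y0 y1 : x0 <= x1 -> y0 <= y1 ->
  (forall z, boundary x0 x1 y0 y1 z -> ccont F z) ->
  exists2 M, 0 <= M & forall z, boundary x0 x1 y0 y1 z -> normc (F z) <= M.
Proof.
move=> xx yy cF.
have hc t a b y : (forall s, a <= s <= b -> ccont F (Complex s y)) -> a <= t <= b ->
    forall e, 0 < e -> exists2 d, 0 < d & forall u, `|u - t| < d -> normc (hz F y u - hz F y t) < e.
  move=> c tt e e0; have [d d0 H] := c t tt e e0; exists d => // u ut; apply: H.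
  rewrite (_ : Complex u y - _ = real_complex _ (u - t)) ?normc_real//.
  by apply/eqP; rewrite eq_complex /=; apply/andP; split; apply/eqP; ring.
have vc t a b x : (forall s, a <= s <= b -> ccont F (Complex x s)) -> a <= t <= b ->
    forall e, 0 < e -> exists2 d, 0 < d & forall u, `|u - t| < d -> normc (vt F x u - vt F x t) < e.
  move=> c tt e e0; have [d d0 H] := c t tt e e0; exists d => // u ut; apply: H.
  rewrite (_ : Complex x u - _ = Complex 0 1 * real_complex _ (u - t)).
    by rewrite normcM normc_real normc_i mul1r.
  by apply/eqP; rewrite eq_complex /=; apply/andP; split; apply/eqP; ring.
have [M1 H1] : exists M, forall t, x0 <= t <= x1 -> normc (hz F y0 t) <= M.
  apply: cont_bounded => // t tt; apply: hc tt => s ss; apply: cF.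
  by split; rewrite //= ?lexx ?yy//; constructor 3.
have [M2 H2] : exists M, forall t, x0 <= t <= x1 -> normc (hz F y1 t) <= M.
  apply: cont_bounded => // t tt; apply: hc tt => s ss; apply: cF.
  by split; rewrite //= ?lexx ?yy//; constructor 4.
have [M3 H3] : exists M, forall t, y0 <= t <= y1 -> normc (vt F x0 t) <= M.
  apply: cont_bounded => // t tt; apply: vc tt => s ss; apply: cF.
  by split; rewrite //= ?lexx ?xx//; constructor 1.
have [M4 H4] : exists M, forall t, y0 <= t <= y1 -> normc (vt F x1 t) <= M.
  apply: cont_bounded => // t tt; apply: vc tt => s ss; apply: cF.
  by split; rewrite //= ?lexx ?xx//; constructor 2.
exists (`|M1| + `|M2| + (`|M3| + `|M4|)); first by rewrite !addr_ge0.
have := ler_norm M1; have := ler_norm M2; have := ler_norm M3; have := ler_norm M4.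
have := normr_ge0 M1; have := normr_ge0 M2; have := normr_ge0 M3; have := normr_ge0 M4.
move=> ? ? ? ? ? ? ? ? [zx zy] [/= xt yt [e|e|e|e]].
- by have := H3 _ yt; rewrite /vt -e; lra.
- by have := H4 _ yt; rewrite /vt -e; lra.
- by have := H1 _ xt; rewrite /hz -e; lra.
- by have := H2 _ xt; rewrite /hz -e; lra.
Qed.

Lemma bint_scale F (u x0 x1 y0 y1 : R) : 0 < u -> x0 <= x1 -> y0 <= y1 ->
  bex F (u * x0) (u * x1) (u * y0) (u * y1) ->
  bint F (u * x0) (u * x1) (u * y0) (u * y1) =
  u%:C%C * bint (fun z => F (u%:C%C * z)) x0 x1 y0 y1.
Proof.
move=> u0 xx yy [F1 F2 F3 F4].
have cs (g h : R -> C) (a b : R) : a <= b -> cex g (u * a) (u * b) ->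
    (forall t, h t = g (u * t)) -> cint g (u * a) (u * b) = u%:C%C * cint h a b.
  move=> ab [rg ig] hg; rewrite -[u * a]addr0 -[u * b]addr0 in rg ig *.
  rewrite /cint -!rint_comp_lin//.
  have un0 : u != 0 by rewrite gt_eqF.
  have rs f : rex f (u * a + 0) (u * b + 0) ->
     rint (fun t => u * f (u * t + 0)) a b = u * rint (fun t => f (u * t)) a b.
    move=> rf; have rf' : rex (fun t => f (u * t)) a b.
      have := @RInt.ex_RInt_comp_lin Hierarchy.R_NormedModule f u 0 a b rf.
      move=> /(@RInt.ex_RInt_scal Hierarchy.R_NormedModule _ _ _ u^-1).
      apply: rex_ext => // t _.
      by rewrite /Hierarchy.scal /= /Hierarchy.mult /= RmultE RplusE addr0 mulKf.
    have := rint_lin u rf' (rex_cst 0 a b); rewrite rint_cst mulr0 addr0 => <-.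
    by apply: rint_ext => // t _; rewrite !addr0.
  rewrite (rs (fun t => complex.Re (g t)) rg) (rs (fun t => complex.Im (g t)) ig).
  rewrite (rint_ext (g := fun t => complex.Re (h t)) ab); last by move=> t _; rewrite hg.
  rewrite (rint_ext (f := fun t => complex.Im (g _)) (g := fun t => complex.Im (h t)) ab); last by move=> t _; rewrite hg.
  by apply/eqP; rewrite eq_complex /=; apply/andP; split; apply/eqP; ring.
have sE (s y : R) : Complex (u * s) (u * y) = u%:C%C * Complex s y.
  by apply/eqP; rewrite eq_complex /=; apply/andP; split; apply/eqP; ring.
rewrite /bint.
rewrite (cs (hz F (u * y0)) (hz (fun z => F (u%:C%C * z)) y0))//; last by move=> t; rewrite /hz sE.
rewrite (cs (hz F (u * y1)) (hz (fun z => F (u%:C%C * z)) y1))//; last by move=> t; rewrite /hz sE.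
rewrite (cs (vt F (u * x0)) (vt (fun z => F (u%:C%C * z)) x0))//; last by move=> t; rewrite /vt sE.
rewrite (cs (vt F (u * x1)) (vt (fun z => F (u%:C%C * z)) x1))//; last by move=> t; rewrite /vt sE.
ring.
Qed.

(** * Integrals of negative powers of z over squares centred at 0 *)

Definition sq (F : C -> C) (r : R) := bint F (- r) r (- r) r.

Lemma sq_boundary_neq0 (r : R) z : 0 < r -> boundary (- r) r (- r) r z -> r <= normc z.
Proof.
move=> r0 [_ _ [] e].
- by apply: le_trans (Re_le_normc z); rewrite e normrN ger0_norm// ltW.
- by apply: le_trans (Re_le_normc z); rewrite e ger0_norm// ltW.
- by apply: le_trans (Im_le_normc z); rewrite e normrN ger0_norm// ltW.
- by apply: le_trans (Im_le_normc z); rewrite e ger0_norm// ltW.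
Qed.

(** The integral is the same over the squares of half-sides r and 2 r, since the integrand is
    holomorphic between them; but scaling by 2 multiplies it by 2^(-n). As n > 0, it vanishes. *)
Lemma sq_pow (n : nat) (r : R) : 0 < r -> (0 < n)%N -> sq (fun z => (z ^+ n.+1)^-1) r = 0.
Proof.
move=> r0 n0; set F := fun z : C => _.
have hF z : z != 0 -> holo F z by exact: holo_ratX.
have e1 : sq F (2 * r) = sq F r.
  apply: bint_hole; try lra.
  move=> z [_ zout]; apply: hF; apply/eqP => z0; apply: zout; rewrite z0 /=.
  by split; apply/andP; split; lra.
have : sq F (2 * r) = 2%:C%C * ((2%:C%C ^+ n.+1)^-1 * sq F r).
  rewrite /sq -!mulrN bint_scale; [|lra|lra|lra|]; last first.
    apply: bex_ccont; [lra|lra|] => z; rewrite !mulrN => /sq_boundary_neq0 zr.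
    by apply/holo_cont/hF; rewrite -normc_gt0; apply: lt_le_trans (zr _); lra.
  congr (_ * _).
  have bF : bex F (- r) r (- r) r.
    apply: bex_ccont; [lra|lra|] => z /sq_boundary_neq0 zr.
    by apply/holo_cont/hF; rewrite -normc_gt0; apply: lt_le_trans (zr _).
  have b0 : bex (fun=> 0) (- r) r (- r) r by split; exact: cex_cst.
  have b00 : bint (fun=> 0) (- r) r (- r) r = 0 by rewrite /bint /hz /vt !cint_cst; ring.
  have := bint_lin ((2%:C%C ^+ n.+1)^-1) bF b0; rewrite b00 addr0 => <-.
  by apply: bint_ext; [lra|lra|] => z _; rewrite /F addr0 exprMn invfM.
rewrite e1 => /eqP; rewrite mulrA -subr_eq0 -[X in X - _]mul1r -mulrBl mulf_eq0 => /orP[|/eqP//].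
rewrite subr_eq0 => /eqP /(congr1 (@Normc.normc _)); rewrite normc1 normcM normcV normcX normc_real.
rewrite ger0_norm// exprS invfM mulrA divff// mul1r => /esym/eqP.
rewrite invr_eq1 => /eqP n1; have : 1 < 2 ^+ n :> R by rewrite exprn_egt1 ?ltr1n// -lt0n.
by rewrite n1 ltxx.
Qed.

(** The exact value 2 pi i is not computed: [taylor_square] only divides by this integral. Each side
    adds at least 1 to the imaginary part, because r / (t^2 + r^2) is at least 1 / (2 r) along a
    side of length 2 r. *)
Lemma sq_inv_neq0 (r : R) : 0 < r -> sq (fun z => z^-1) r != 0.
Proof.
move=> r0; apply/eqP => /(congr1 (@complex.Im _)).
have bF : bex (fun z : C => z^-1) (- r) r (- r) r.
  apply: bex_ccont; [lra|lra|] => z /sq_boundary_neq0 zr.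
  apply/holo_cont/holoV; last exact: holo_id.
  by rewrite -normc_gt0; apply: lt_le_trans (zr _).
case: bF => [[_ b1] [b2 _] [_ b3] [b4 _]].
have rge (g : R -> R) : rex g (- r) r -> (forall t, - r <= t <= r -> (2 * r)^-1 <= g t) ->
    1 <= rint g (- r) r.
  move=> rg gm; have -> : 1 = rint (fun=> (2 * r)^-1) (- r) r.
    by rewrite rint_cst; field; exact: lt0r_neq0.
  apply/RleP; apply: RInt.RInt_le => //.
  - by apply/RleP; lra.
  - exact: rex_cst.
  - by move=> x [/RltP x1 /RltP x2]; apply/RleP/gm; rewrite !ltW.
have tb (t : R) : - r <= t <= r -> (2 * r)^-1 <= r / (t ^+ 2 + r ^+ 2).
  move=> /andP[t1 t2]; have r20 : 0 < r ^+ 2 by rewrite exprn_gt0.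
  have t20 : 0 < t ^+ 2 + r ^+ 2 by rewrite ltr_wpDl ?sqr_ge0.
  rewrite ler_pdivlMr// ler_pdivrMl ?mulr_gt0//.
  have : 0 <= (r - t) * (r + t) by apply: mulr_ge0; lra.
  rewrite !expr2; lra.
have I1 : 1 <= rint (fun t => complex.Im (hz (fun z : C => z^-1) (- r) t)) (- r) r.
  by apply: rge => // t /tb; rewrite /hz /= sqrrN mulNr opprK.
have I2 : 1 <= rint (fun t => complex.Re (vt (fun z : C => z^-1) r t)) (- r) r.
  by apply: rge => // t /tb; rewrite /vt /= [t ^+ 2 + _]addrC.
have neg (g : R -> R) : rex g (- r) r -> rint (fun t => -1 * g t + 0) (- r) r = - rint g (- r) r.
  by move=> rg; rewrite rint_lin//; [rewrite rint_cst; ring|exact: rex_cst].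
have rneg (g : R -> R) : rex g (- r) r -> rex (fun t => -1 * g t + 0) (- r) r.
  by move=> rg; apply: rex_lin => //; exact: rex_cst.
have I3 : 1 <= - rint (fun t => complex.Im (hz (fun z : C => z^-1) r t)) (- r) r.
  rewrite -neg//; apply: rge; first exact: rneg.
  by move=> t /tb; rewrite /hz /= addr0 mulN1r opprK.
have I4 : 1 <= - rint (fun t => complex.Re (vt (fun z : C => z^-1) (- r) t)) (- r) r.
  rewrite -neg//; apply: rge; first exact: rneg.
  by move=> t /tb; rewrite /vt /= addr0 sqrrN mulN1r mulNr opprK [t ^+ 2 + _]addrC.
rewrite /sq /bint /cint /=; rewrite !(mul0r, mul1r, add0r, addr0).
lra.
Qed.

(** * Power series *)

Lemma holo_quotient f p z : z != p -> holo f z -> holo (fun w => (f w - f p) / (w - p)) z.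
Proof.
move=> zp hf; apply: holoM; first by apply: holoB => //; exact: holo_cst.
apply: holoV; first by rewrite subr_eq0.
by apply: holoB; [exact: holo_id|exact: holo_cst].
Qed.

(** The coefficients are the Cauchy integrals of f z / z^(n+1), divided by that of 1 / z. The
    difference quotient K of f at p integrates to 0; dividing it by successive powers of z peels off
    one Taylor term at a time and leaves a remainder p^(N+1) times the integral of K / z^(N+1). No
    exchange of a series with an integral is involved. *)
Theorem taylor_square f (r : R) : 0 < r -> holo_on f (inrect (- r) r (- r) r) ->
  exists a : nat -> C, forall p, normc p < r -> exists M, forall N,
    normc (f p - \sum_(n < N.+1) a n * p ^+ n) <= M * (normc p / r) ^+ N.+1.
Proof.
move=> r0 hf.
pose A n := sq (fun z => f z * (z ^+ n.+1)^-1) r.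
pose B n := sq (fun z => (z ^+ n.+1)^-1) r.
pose kappa := sq (fun z => z^-1) r.
have k0 : kappa != 0 by exact: sq_inv_neq0.
have B0 : B 0%N = kappa.
  by apply: bint_ext; [lra|lra|move=> z _; rewrite expr1].
have BS n : B n.+1 = 0 by exact: sq_pow.
have rr : - r <= r by lra.
have bneq0 z : boundary (- r) r (- r) r z -> z != 0.
  by move=> /sq_boundary_neq0 zr; rewrite -normc_gt0; apply: lt_le_trans (zr _).
have hb z : boundary (- r) r (- r) r z -> holo f z by move=> /boundary_inrect /hf.
exists (fun n => A n / kappa) => p pr.
have bneqp z : boundary (- r) r (- r) r z -> z != p.
  move=> bz; apply/eqP => zp; move: pr; rewrite -zp ltNge => /negP; apply.
  exact: sq_boundary_neq0.
pose K z := (f z - f p) / (z - p).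
(* K is bounded near p because f is differentiable there, so the singularity is removable. *)
have K0 : sq K r = 0.
  have [l lP] : holo f p.
    apply: hf; have := Re_le_normc p; have := Im_le_normc p; rewrite !ler_norml.
    by move=> /andP[? ?] /andP[? ?]; split; apply/andP; split; lra.
  have [d d0 lip] := cdiff_lip lP.
  apply: (@bint_removable _ _ _ _ _ p (normc l + 1) d) => //.
  - have := Re_le_normc p; rewrite ler_norml => /andP[? ?]; apply/andP; split; lra.
  - have := Im_le_normc p; rewrite ler_norml => /andP[? ?]; apply/andP; split; lra.
  - by move=> z [/hf hz /eqP zp]; exact: holo_quotient.
  - move=> z /eqP zp /lip; rewrite /K normcM normcV ler_pdivrMr// normc_gt0.
    by rewrite subr_eq0.
pose G N z := K z * (z ^+ N)^-1.
have hK z : boundary (- r) r (- r) r z -> holo K z.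
  by move=> bz; apply: holo_quotient; [exact: bneqp|exact: hb].
have hG N : bex (G N) (- r) r (- r) r.
  apply: bex_ccont => // z bz; apply: holo_cont; apply: holoM; first exact: hK.
  exact/holo_ratX/bneq0.
have hA n : bex (fun z => f z * (z ^+ n.+1)^-1) (- r) r (- r) r.
  apply: bex_ccont => // z bz; apply: holo_cont; apply: holoM; first exact: hb.
  exact/holo_ratX/bneq0.
have hB n : bex (fun z => (z ^+ n.+1)^-1) (- r) r (- r) r.
  by apply: bex_ccont => // z bz; apply/holo_cont/holo_ratX/bneq0.
(* From K (z - p) = f z - f p, divided by z^(N+1) and integrated. *)
have rec N : sq (G N) r = p * sq (G N.+1) r + (A N - f p * B N).
  rewrite [A N - _]addrC -mulNr /sq -(bint_lin _ (hB N) (hA N)).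
  rewrite -bint_lin//; last exact: bex_lin.
  apply: bint_ext => // z bz; rewrite /G /K exprS.
  have zp : z - p != 0 by rewrite subr_eq0; exact: bneqp.
  have z0 := bneq0 _ bz; have zN : z ^+ N != 0 by rewrite expf_neq0.
  by field; rewrite zp z0 zN.
have sum0 N : \sum_(n < N) (A n - f p * B n) * p ^+ n + p ^+ N * sq (G N) r = 0.
  elim: N => [|N IH].
    rewrite big_ord0 add0r mul1r -[RHS]K0; apply: bint_ext => // z _.
    by rewrite /G invr1 mulr1.
  rewrite -[RHS]IH big_ord_recr /= (rec N) exprS; ring.
have [M0 M00 KM] := @boundary_bounded K (- r) r (- r) r rr rr (fun z bz => holo_cont (hK z bz)).
exists (16 * r * M0 / normc kappa) => N.
have -> : f p - \sum_(n < N.+1) A n / kappa * p ^+ n = p ^+ N.+1 * sq (G N.+1) r / kappa.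
  have := sum0 N.+1; rewrite big_ord_recl B0 expr0 mulr1.
  under eq_bigr do rewrite BS mulr0 subr0.
  move=> e; rewrite big_ord_recl expr0 mulr1.
  under eq_bigr do rewrite mulrAC.
  rewrite -mulr_suml.
  have -> : p ^+ N.+1 * sq (G N.+1) r = - (A 0%N - f p * kappa + \sum_(i < N) A (bump 0 i) * p ^+ bump 0 i).
    by apply/eqP; rewrite -addr_eq0 addrC; apply/eqP.
  by rewrite /=; field.
(* On the boundary |z| >= r; the constant 16 r is that of [bint_bound] for sides of length 2 r. *)
have Gb : normc (sq (G N.+1) r) <= 16 * r * M0 / r ^+ N.+1.
  have -> : 16 * r * M0 / r ^+ N.+1 = 4 * ((r - - r) + (r - - r)) * (M0 / r ^+ N.+1).
    by field; rewrite expf_neq0// gt_eqF.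
  apply: bint_bound => // z bz; rewrite /G normcM normcV normcX.
  apply: ler_pM; rewrite ?normc_ge0 ?invr_ge0 ?exprn_ge0 ?normc_ge0//; first exact: KM.
  by rewrite lef_pV2 ?posrE ?exprn_gt0 ?normc_gt0 ?bneq0// lerXn2r ?nnegrE ?normc_ge0 ?(ltW r0)//; exact: sq_boundary_neq0.
rewrite !normcM normcV normcX expr_div_n.
have kn : 0 < normc kappa by rewrite normc_gt0.
have rN : 0 < r ^+ N.+1 by rewrite exprn_gt0.
have pN : 0 <= normc p ^+ N.+1 by rewrite exprn_ge0 ?normc_ge0.
rewrite ler_pdivrMr//.
have -> : 16 * r * M0 / normc kappa * (normc p ^+ N.+1 / r ^+ N.+1) * normc kappa =
   normc p ^+ N.+1 * (16 * r * M0 / r ^+ N.+1).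
  by field; rewrite !gt_eqF.
exact: ler_wpM2l.
Qed.

Lemma geometric_small (M t e : R) : 0 <= t < 1 -> 0 < e ->
  exists N, forall n, (N <= n)%N -> M * t ^+ n < e.
Proof.
move=> /andP[t0 t1] e0; have [M0|M0] := leP M 0.
  by exists 0%N => n _; apply: le_lt_trans e0; rewrite mulr_le0_ge0 ?exprn_ge0.
have : (GRing.exp t : nat -> R^o) @ \oo --> (0 : R^o).
  by apply: cvg_expr; rewrite ger0_norm.
move=> /cvgrPdist_lt /(_ (e / M)); rewrite divr_gt0// => /(_ isT)[N _ H].
exists N => n /H /=; rewrite sub0r normrN ger0_norm ?exprn_ge0//.
by rewrite ltr_pdivlMr// mulrC.
Qed.

Definition psum (a : nat -> C) (z : C) (N : nat) : C := \sum_(n < N) a n * z ^+ n.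

Definition psum_to (a : nat -> C) (z l : C) : Prop := forall e : R, 0 < e ->
  exists N, forall n, (N <= n)%N -> normc (psum a z n - l) < e.

Lemma taylor_disc f (r : R) : 0 < r -> holo_on f (inrect (- r) r (- r) r) ->
  exists a : nat -> C, forall z, normc z < r -> psum_to a z (f z).
Proof.
move=> r0 /(taylor_square r0)[a aP]; exists a => z zr e e0.
have [M MP] := aP z zr.
have [|N NP] := @geometric_small M (normc z / r) e _ e0.
  by rewrite divr_ge0 ?normc_ge0 ?(ltW r0)//= ltr_pdivrMr// mul1r.
exists N.+1 => -[//|n] Nn; rewrite -normcN opprB.
apply: le_lt_trans (MP n) (NP _ _); exact: ltnW.
Qed.

(** Each late term is a difference of two partial sums within 1 of the limit, and the early terms
    are bounded by the sum of their moduli. *)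
Lemma coef_bound (a : nat -> C) (z l : C) : psum_to a z l ->
  exists2 M, 0 < M & forall n, normc (a n) * normc z ^+ n <= M.
Proof.
move=> cl; have [N NP] := cl 1 ltr01.
pose S := \sum_(k < N) normc (a k) * normc z ^+ k.
have S0 : 0 <= S by apply: sumr_ge0 => k _; rewrite mulr_ge0 ?exprn_ge0 ?normc_ge0.
exists (S + 2); first by lra.
move=> n; have [nN|Nn] := ltnP n N.
  rewrite /S (bigD1 (Ordinal nN))//= -addrA lerDl addr_ge0//.
  by apply: sumr_ge0 => k _; rewrite mulr_ge0 ?exprn_ge0 ?normc_ge0.
have -> : normc (a n) * normc z ^+ n = normc ((psum a z n.+1 - l) - (psum a z n - l)).
  by rewrite /psum big_ord_recr /= -normcX -normcM; congr normc; ring.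
have := NP n Nn; have := NP n.+1 (leqW Nn).
have := normcB (psum a z n.+1 - l) (psum a z n - l); lra.
Qed.

Lemma psum_lim_le (a : nat -> C) (z l c : C) (B : R) (m : nat) : psum_to a z l ->
  (forall n, normc (psum a z (m + n) - c) <= B) -> normc (l - c) <= B.
Proof.
move=> cl cB; apply/ler_addgt0Pr => d d0; have [n0 n0P] := cl d d0.
have := n0P (m + n0)%N (leq_addl _ _); have := cB n0.
set P := psum _ _ _ => h1 h2.
have : normc (l - c) <= normc (P - c) + normc (P - l).
  by rewrite (_ : l - c = (P - c) - (P - l)); [exact: normcB|ring].
lra.
Qed.

(** The coefficient bound dominates the tail by a geometric series of ratio |q| / r, at most 1/2,
    whence the factor 2. *)
Lemma psum_tail (a : nat -> C) (M r : R) (m : nat) (q l : C) : 0 < r -> 0 <= M ->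
  (forall n, normc (a n) * r ^+ n <= M) -> normc q <= r / 2 -> psum_to a q l ->
  normc (l - psum a q m) <= 2 * M * (normc q / r) ^+ m.
Proof.
move=> r0 M0 MP qr cl; have q0 := normc_ge0 q.
have t0 : 0 <= normc q / r by rewrite divr_ge0 ?(ltW r0).
(* The factor 1 - 2^(-n) is half the partial sum of the geometric series of ratio 1/2; carrying it
   makes the induction close. *)
have tail n : normc (psum a q (m + n) - psum a q m) <=
    2 * M * (normc q / r) ^+ m * (1 - (1 / 2) ^+ n).
  elim: n => [|n IH].
    by rewrite addn0 expr0 !subrr normc0 mulr0.
  rewrite addnS /psum big_ord_recr /= -!/(psum a q _) addrAC.
  apply: le_trans (normcD _ _) _.
  have : normc (a (m + n)%N * q ^+ (m + n)) <= M * (normc q / r) ^+ m * (1 / 2) ^+ n.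
    rewrite normcM normcX.
    have : normc (a (m + n)%N) <= M / r ^+ (m + n) by rewrite ler_pdivlMr ?exprn_gt0.
    move=> /(ler_wpM2r (exprn_ge0 (m + n) q0)) /le_trans; apply.
    rewrite !exprD (_ : M / (r ^+ m * r ^+ n) * (normc q ^+ m * normc q ^+ n) =
       M * (normc q / r) ^+ m * (normc q / r) ^+ n); last first.
      by rewrite !expr_div_n; field; rewrite !expf_neq0// gt_eqF.
    apply: ler_wpM2l; first by rewrite mulr_ge0 ?exprn_ge0.
    by rewrite lerXn2r ?nnegrE// ler_pdivrMr//; lra.
  rewrite (exprS (1 / 2) n); move: IH; set X := normc (_ - _); set Y := normc (_ * _).
  set T := (1 / 2) ^+ n; set Q := (_ / r) ^+ _ => h1 h2.
  rewrite (_ : 2 * M * Q * (1 - 1 / 2 * T) = 2 * M * Q * (1 - T) + M * Q * T); last by field.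
  exact: lerD.
apply: (psum_lim_le (m := m)) cl _ => n; apply: le_trans (tail n) _.
by apply: ler_piMr; [rewrite !mulr_ge0 ?exprn_ge0|rewrite gerBl exprn_ge0//; lra].
Qed.

(* If the first nonzero coefficient is [a m], then |a m| |q|^m is bounded by   *)
(* the tail, which is O(|q|^(m+1)).                                            *)
Lemma psum_unique (a : nat -> C) (z1 : C) : z1 != 0 -> (exists l, psum_to a z1 l) ->
  (forall e : R, 0 < e -> exists q, [/\ q != 0, normc q < e & psum_to a q 0]) ->
  forall n, a n = 0.
Proof.
move=> z10 [l /coef_bound[M M0 MP]] small.
have r0 : 0 < normc z1 by rewrite normc_gt0.
suff H m : (forall k, (k < m)%N -> a k = 0) -> a m = 0.
  by move=> n; elim/ltn_ind: n => n IH; apply: H.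
move=> am; apply: Normc.eq0_normc; apply/eqP; rewrite eq_le normc_ge0 andbT leNgt.
apply/negP => am0; set N := normc (a m) in am0.
set r := normc z1 in r0 MP.
pose M' := M / r ^+ m.+1.
have M'E : M' = M / r ^+ m.+1 by [].
have M'0 : 0 < M' by rewrite divr_gt0// exprn_gt0.
clearbody M'.
pose e := Num.min (r / 2) (N / (4 * M')).
have e0 : 0 < e by rewrite lt_min !divr_gt0// mulr_gt0.
have [q [q0 qe qs]] := small e e0.
move: qe; rewrite lt_min => /andP[q1 q2].
have qn : 0 < normc q by rewrite normc_gt0.
have := psum_tail m.+1 r0 (ltW M0) MP (ltW q1) qs.
rewrite sub0r normcN /psum big_ord_recr /= big1 ?add0r; last by move=> i _; rewrite am ?mul0r.
rewrite normcM normcX -/N expr_div_n.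
rewrite (_ : 2 * M * _ = 2 * (M / r ^+ m.+1) * normc q ^+ m.+1); last first.
  by field; rewrite expf_neq0// gt_eqF.
rewrite -M'E exprS (mulrA _ (normc q)) ler_pM2r//; last by rewrite exprn_gt0.
have : normc q * (4 * M') < N by rewrite -ltr_pdivlMr// mulr_gt0.
move=> h1 h2; have : normc q * (4 * M') = 2 * (2 * M' * normc q) by ring.
lra.
Qed.

(** * Entire functions *)

Lemma psum_to_uniq (a : nat -> C) (z l l' : C) : psum_to a z l -> psum_to a z l' -> l = l'.
Proof.
move=> h h'; apply/eqP; rewrite -subr_eq0; apply/eqP/Normc.eq0_normc/eqP.
rewrite eq_le normc_ge0 andbT; apply/ler_addgt0Pr => e e0; rewrite add0r.
have e2 : 0 < e / 2 by lra.
have [N NP] := h _ e2; have [N' NP'] := h' _ e2.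
have := NP (maxn N N') (leq_maxl _ _); have := NP' (maxn N N') (leq_maxr _ _).
set P := psum _ _ _ => h1 h2; rewrite (_ : l - l' = (P - l') - (P - l)); last by ring.
by have := normcB (P - l') (P - l); lra.
Qed.

Lemma psum_to_lin (a b : nat -> C) (k z l m : C) : psum_to a z l -> psum_to b z m ->
  psum_to (fun n => k * a n + b n) z (k * l + m).
Proof.
move=> ha hb e e0; have k0 := normc_ge0 k.
have ek : 0 < e / (2 * (normc k + 1)) by rewrite divr_gt0// mulr_gt0// ltr_wpDl.
have e2 : 0 < e / 2 by lra.
have [N NP] := ha _ ek; have [N' NP'] := hb _ e2.
exists (maxn N N') => n; rewrite geq_max => /andP[/NP + /NP'].
have -> : psum (fun n => k * a n + b n) z n = k * psum a z n + psum b z n.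
  rewrite /psum mulr_sumr -big_split; apply: eq_bigr => i _ /=; ring.
set P := psum a z n; set Q := psum b z n => h1 h2.
rewrite (_ : _ - _ = k * (P - l) + (Q - m)); last by ring.
apply: le_lt_trans (normcD _ _) _; rewrite normcM.
have : normc k * normc (P - l) <= normc k * (e / (2 * (normc k + 1))) by apply: ler_wpM2l => //; exact: ltW.
have -> : normc k * (e / (2 * (normc k + 1))) = e / 2 * (normc k / (normc k + 1)).
  by field; lra.
have : e / 2 * (normc k / (normc k + 1)) <= e / 2.
  by apply: ler_piMr; [lra|rewrite ler_pdivrMr; lra].
lra.
Qed.

Lemma psum_to_ext (a b : nat -> C) z l : a =1 b -> psum_to a z l -> psum_to b z l.
Proof. by move=> /funext ->. Qed.

(** The difference series sums to 0 at points arbitrarily close to 0, so [psum_unique] applies. *)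
Lemma psum_agree (a b : nat -> C) (r : R) (f : C -> C) : 0 < r ->
  (forall z, normc z < r -> psum_to a z (f z)) ->
  (forall z, normc z < r -> psum_to b z (f z)) -> a =1 b.
Proof.
move=> r0 ha hb n; apply/eqP; rewrite -subr_eq0; apply/eqP.
have small e : 0 < e -> exists q : C, [/\ q != 0, normc q < e & normc q < r].
  move=> e0; have m0 : 0 < Num.min e r by rewrite lt_min e0.
  exists (Num.min e r / 2)%:C%C; rewrite -normc_gt0 normc_real ger0_norm; last by lra.
  have : Num.min e r / 2 < Num.min e r by lra.
  by rewrite lt_min => /andP[-> ->]; split => //; lra.
have d q : normc q < r -> psum_to (fun n => a n - b n) q 0.
  move=> qr; have := psum_to_lin (-1) (hb q qr) (ha q qr).
  rewrite mulN1r addNr; apply: psum_to_ext => m; ring.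
have [z1 [z10 _ z1r]] := small r r0.
apply: (@psum_unique (fun n => a n - b n) z1) => //; first by exists 0; exact: d.
by move=> e /small[q [q0 qe qr]]; exists q; split => //; exact: d.
Qed.

Definition entire (f : C -> C) := forall z, holo f z.

(** [taylor_disc] gives one coefficient sequence for each square; all of them represent f on the
    unit disc, so they coincide and the first works everywhere. *)
Lemma entire_series f : entire f -> exists a, forall z, psum_to a z (f z).
Proof.
move=> hf; have ex (N : nat) : exists a, forall z, normc z < N.+1%:R -> psum_to a z (f z).
  by apply: taylor_disc => // z _; exact: hf.
have [a aP] := choice ex.
exists (a 0%N) => z; have [N zN] : exists N : nat, normc z < N.+1%:R.
  exists (Num.bound (normc z)); apply: lt_trans (archi_boundP (normc_ge0 z)) _.
  by rewrite ltr_nat.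
apply: psum_to_ext (aP N z zN); apply: (@psum_agree _ _ 1 f) => // w w1.
  by apply: aP; apply: lt_le_trans w1 _; rewrite ler1n.
exact: aP.
Qed.

Lemma cdiff_eq f g z l d : 0 < d -> (forall w, normc (w - z) < d -> f w = g w) ->
  cdiff f z l -> cdiff g z l.
Proof.
move=> d0 fg hf e e0; have [d' d'0 H] := hf e e0.
exists (Num.min d d'); first by rewrite lt_min d0.
move=> w; rewrite lt_min => /andP[w1 w2]; rewrite -!fg ?subrr ?normc0//; exact: H.
Qed.

Lemma holo_eq f g z d : 0 < d -> (forall w, normc (w - z) < d -> f w = g w) ->
  holo f z -> holo g z.
Proof. by move=> d0 fg [l fl]; exists l; exact: (cdiff_eq d0 fg fl). Qed.

(** * Rules of differentiation, and termwise differentiation of power series *)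

Lemma cdiff_uniq f z l l' : cdiff f z l -> cdiff f z l' -> l = l'.
Proof. by move=> /is_derive_cdiff[_ <-] /is_derive_cdiff[_ <-]. Qed.

Lemma cdiffD f g z k l : cdiff f z k -> cdiff g z l -> cdiff (fun w => f w + g w) z (k + l).
Proof. by move=> /is_derive_cdiff hf /is_derive_cdiff hg; apply/is_derive_cdiff; exact: is_deriveD. Qed.

Lemma cdiffB f g z k l : cdiff f z k -> cdiff g z l -> cdiff (fun w => f w - g w) z (k - l).
Proof. by move=> /is_derive_cdiff hf /is_derive_cdiff hg; apply/is_derive_cdiff; exact: is_deriveB. Qed.

Lemma cdiff_cst (c z : C) : cdiff (fun=> c) z 0.
Proof. by apply/is_derive_cdiff; exact: (@is_derive_cst C C^o C^o). Qed.

Lemma cdiff_id (z : C) : cdiff id z 1.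
Proof. by apply/is_derive_cdiff; exact: (@is_derive_id C C^o). Qed.

Lemma cdiffM f g z k l : cdiff f z k -> cdiff g z l ->
  cdiff (fun w => f w * g w) z (f z * l + g z * k).
Proof.
move=> /is_derive_cdiff hf /is_derive_cdiff hg; apply/is_derive_cdiff.
Qed.

Lemma cdiff_eq_der f z l l' : cdiff f z l -> l = l' -> cdiff f z l'.
Proof. by move=> h <-. Qed.

Lemma cdiffX n z : cdiff (fun w => w ^+ n) z (n%:R * z ^+ n.-1).
Proof.
elim: n => [|n IH].
  by under eq_fun do rewrite expr0; rewrite mul0r; exact: cdiff_cst.
under eq_fun do rewrite exprS.
apply: cdiff_eq_der (cdiffM (cdiff_id z) IH) _; rewrite /=.
case: n {IH} => [|n]; first by rewrite /= !expr0; ring.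
by rewrite /= exprS; ring.
Qed.

Lemma cdiff_psum (a : nat -> C) N z :
  cdiff (fun w => psum a w N.+1) z (psum (fun n => n.+1%:R * a n.+1) z N).
Proof.
elim: N => [|N IH].
  rewrite {2}/psum big_ord0; under eq_fun do rewrite /psum big_ord1 expr0.
  exact: cdiff_cst.
have -> : (fun w => psum a w N.+2) = (fun w => psum a w N.+1 + a N.+1 * w ^+ N.+1).
  by apply/funext => w; rewrite {1}/psum big_ord_recr.
apply: cdiff_eq_der (cdiffD IH (cdiffM (cdiff_cst (a N.+1) z) (cdiffX N.+1 z))) _.
rewrite [X in _ = X](_ : _ = psum (fun n => n.+1%:R * a n.+1) z N + N.+1%:R * a N.+1 * z ^+ N).
  by rewrite /=; ring.
by rewrite [LHS]/psum big_ord_recr.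
Qed.

Lemma psum_cdiff0 (b : nat -> C) (F : C -> C) (r : R) : 0 < r ->
  (forall w, normc w < r -> psum_to b w (F w)) -> cdiff F 0 (b 1%N).
Proof.
move=> r0 bF; have r20 : 0 < r / 2 by lra.
have [M M0 MP] : exists2 M, 0 < M & forall n, normc (b n) * (r / 2) ^+ n <= M.
  have rn : normc (r / 2)%:C%C = r / 2 by rewrite normc_real ger0_norm// ltW.
  have h : normc (r / 2)%:C%C < r by rewrite rn; lra.
  by have [M M0 H] := coef_bound (bF _ h); exists M => // n; have := H n; rewrite rn.
set r' := r / 2 in r20 MP.
have r'E : r' = r / 2 by [].
clearbody r'.
have F0 : F 0 = b 0%N.
  apply: (@psum_to_uniq b 0); first by apply: bF; rewrite normc0.
  move=> e e0; exists 1%N => -[//|n] _; rewrite /psum big_ord_recl expr0 mulr1 big1 ?addr0 ?subrr ?normc0//.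
  by move=> i _; rewrite exprS mul0r mulr0.
(* K |w|^2 is the bound of [psum_tail] after two terms, hence at most e |w| once |w| < e / K. *)
move=> e e0; pose K := 2 * M / r' ^+ 2.
have K0 : 0 < K by rewrite divr_gt0 ?exprn_gt0// mulr_gt0.
have KE : K = 2 * M / r' ^+ 2 by [].
clearbody K.
exists (Num.min (r' / 2) (e / K)); first by rewrite lt_min !divr_gt0.
move=> w; rewrite subr0 lt_min => /andP[w1 w2].
have wr : normc w < r by lra.
have := psum_tail 2 r20 (ltW M0) MP (ltW w1) (bF w wr).
rewrite /psum big_ord_recl big_ord1 expr0 mulr1 F0 expr1 opprD addrA => /le_trans; apply.
rewrite expr_div_n (_ : 2 * M * _ = K * normc w * normc w); last first.
  by rewrite KE; field; lra.
rewrite ler_wpM2r ?normc_ge0// mulrC.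
by move: w2; rewrite ltr_pdivlMr// => /ltW.
Qed.

Lemma psumB (a : nat -> C) w z n : psum a w n - psum a z n = \sum_(i < n) a i * (w ^+ i - z ^+ i).
Proof. by rewrite /psum -sumrB; apply: eq_bigr => i _; rewrite mulrBr. Qed.

Lemma normc_subX (w z : C) (r : R) n : normc w <= r -> normc z <= r ->
  normc (w ^+ n.+1 - z ^+ n.+1) <= n.+1%:R * r ^+ n * normc (w - z).
Proof.
move=> wr zr; have r0 := le_trans (normc_ge0 _) wr.
elim: n => [|n IH]; first by rewrite !expr1 expr0 !mul1r.
rewrite (_ : w ^+ n.+2 - z ^+ n.+2 = w * (w ^+ n.+1 - z ^+ n.+1) + (w - z) * z ^+ n.+1); last first.
  by rewrite !exprS; ring.
apply: le_trans (normcD _ _) _; rewrite !normcM normcX.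
have h1 : normc w * normc (w ^+ n.+1 - z ^+ n.+1) <= r * (n.+1%:R * r ^+ n * normc (w - z)).
  by apply: ler_pM; rewrite ?normc_ge0.
have h2 : normc (w - z) * normc z ^+ n.+1 <= normc (w - z) * r ^+ n.+1.
  by rewrite ler_wpM2l ?normc_ge0// lerXn2r ?nnegrE ?normc_ge0.
have -> : n.+2%:R * r ^+ n.+1 * normc (w - z) =
    r * (n.+1%:R * r ^+ n * normc (w - z)) + normc (w - z) * r ^+ n.+1.
  by rewrite [n.+2%:R]mulrS exprS; ring.
exact: lerD.
Qed.

(** Turns the Lipschitz bound on the tail in [psum_derive] into a bound on the derivative of that
    tail. *)
Lemma cdiff_lip_le f z l (c d : R) : 0 < d -> cdiff f z l ->
  (forall w, normc (w - z) < d -> normc (f w - f z) <= c * normc (w - z)) -> normc l <= c.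
Proof.
move=> d0 fl lip; apply/ler_addgt0Pr => e e0; have [d' d'0 H] := fl e e0.
have m0 : 0 < Num.min d d' by rewrite lt_min d0.
pose h : C := (Num.min d d' / 2)%:C%C.
have hn : normc h = Num.min d d' / 2 by rewrite normc_real ger0_norm//; lra.
have hd : normc h < Num.min d d' by rewrite hn; lra.
move: hd; rewrite lt_min => /andP[hd hd'].
have h0 : 0 < normc h by rewrite hn; lra.
have := lip (z + h); have := H (z + h); rewrite [z + h - z]addrC addKr => /(_ hd') h1 /(_ hd) h2.
have : normc l * normc h <= (c + e) * normc h.
  rewrite -normcM mulrDl; move: h1 h2; set X := f (z + h) - f z; set Y := l * h.
  have : normc Y <= normc X + normc (X - Y).
    by rewrite (_ : normc Y = normc (X - (X - Y))); [exact: normcB|congr normc; ring].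
  lra.
by rewrite ler_pM2r.
Qed.

(* The tail of the series of [f] after N terms is Lipschitz near z, with a    *)
(* constant that tends to 0: sum_(n >= N) n 2^-n = (N + 1) 2^(1 - N).         *)
Lemma psum_derive (a : nat -> C) f f' : (forall z, psum_to a z (f z)) ->
  (forall z, cdiff f z (f' z)) ->
  forall z, psum_to (fun n => n.+1%:R * a n.+1) z (f' z).
Proof.
move=> af ff' z; pose r := normc z + 1; have z0 := normc_ge0 z.
have r0 : 0 < r by rewrite /r; lra.
have [M M0 MP] : exists2 M, 0 < M & forall n, normc (a n) * (2 * r) ^+ n <= M.
  have rn : normc (2 * r)%:C%C = 2 * r by rewrite normc_real ger0_norm//; lra.
  by have [M M0 H] := coef_bound (af (2 * r)%:C%C); exists M => // n; have := H n; rewrite rn.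
pose t (N : nat) : R := (N%:R + 1) * 2 * (1 / 2) ^+ N.
have t0 N : 0 <= t N by rewrite /t !mulr_ge0 ?exprn_ge0.
have tS N : t N - t N.+1 = N%:R * (1 / 2) ^+ N.
  by rewrite /t exprS [N.+1%:R]mulrS; field.
have key N : normc (f' z - psum (fun n => n.+1%:R * a n.+1) z N) <= M / r * t N.+1.
  apply: (cdiff_lip_le ltr01 (cdiffB (ff' z) (cdiff_psum a N z))) => w wz.
  have wr : normc w <= r.
    rewrite (_ : w = (w - z) + z); last by rewrite subrK.
    by apply: le_trans (normcD _ _) _; rewrite /r; lra.
  have zr : normc z <= r by rewrite /r; lra.
  have fin n : normc (psum a w (N.+1 + n) - psum a z (N.+1 + n) - (psum a w N.+1 - psum a z N.+1))
      <= M / r * (t N.+1 - t (N.+1 + n)%N) * normc (w - z).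
    elim: n => [|n IH]; first by rewrite addn0 !subrr normc0 mulr0 mul0r.
    rewrite addnS psumB big_ord_recr -psumB /= addrAC; apply: le_trans (normcD _ _) _.
    set k := (N.+1 + n)%N in IH *.
    rewrite (_ : t N.+1 - t k.+1 = (t N.+1 - t k) + (t k - t k.+1)); last by ring.
    rewrite tS [M / r * _]mulrDr mulrDl; apply: lerD => //.
    rewrite normcM (_ : k = (N + n).+1)//; set j := (N + n)%N.
    have h1 := normc_subX j wr zr.
    have h2 : normc (a j.+1) <= M / (2 * r) ^+ j.+1.
      by rewrite ler_pdivlMr ?exprn_gt0 ?mulr_gt0.
    apply: le_trans (ler_pM (normc_ge0 _) (normc_ge0 _) h2 h1) _.
    rewrite le_eqVlt; apply/orP; left; apply/eqP.
    rewrite exprMn [r ^+ j.+1]exprS expr_div_n expr1n.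
    by field; rewrite !expf_neq0// ?pnatr_eq0// gt_eqF.
  apply/ler_addgt0Pr => d d0; have d2 : 0 < d / 2 by lra.
  have [N1 NP1] := af w _ d2; have [N2 NP2] := af z _ d2.
  pose n := maxn N1 N2.
  have := NP1 (N.+1 + n)%N (leq_trans (leq_maxl _ _) (leq_addl _ _)).
  have := NP2 (N.+1 + n)%N (leq_trans (leq_maxr _ _) (leq_addl _ _)).
  have := fin n; set A := psum a w _; set B := psum a z _; set A' := psum a w _; set B' := psum a z _.
  move=> h1 h2 h3.
  have h4 : M / r * (t N.+1 - t (N.+1 + n)%N) * normc (w - z) <= M / r * t N.+1 * normc (w - z).
    rewrite ler_wpM2r ?normc_ge0// ler_wpM2l ?divr_ge0 ?(ltW M0) ?(ltW r0)//.
    by rewrite gerBl.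
  rewrite (_ : f w - A' - (f z - B') = (A - B - (A' - B')) + ((B - f z) - (A - f w))); last by ring.
  have h5 := normcD (A - B - (A' - B')) ((B - f z) - (A - f w)).
  have h6 := normcB (B - f z) (A - f w).
  lra.
have tsmall e : 0 < e -> exists N, forall n, (N <= n)%N -> M / r * t n.+1 < e.
  move=> e0.
  have tb n : t n.+1 <= 4 * (3 / 4) ^+ n.
    have h : n%:R + 2 <= 2 * (3 / 2 : R) ^+ n.
      elim: n => [|n IH]; first by rewrite expr0 add0r mulr1.
      rewrite exprS [n.+1%:R]mulrS; have : 1 <= (3 / 2 : R) ^+ n by rewrite exprn_ege1//; lra.
      lra.
    have p0 : 0 <= (1 / 2 : R) ^+ n by rewrite exprn_ge0.
    have -> : (3 / 4 : R) = 3 / 2 * (1 / 2) by field.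
    have q0 : 0 <= (3 / 2 : R) ^+ n * (1 / 2) ^+ n by rewrite mulr_ge0 ?exprn_ge0.
    rewrite (exprMn n (3 / 2)); move: (ler_wpM2r p0 h); rewrite /t exprS [n.+1%:R]mulrS; lra.
  have [|N NP] := @geometric_small (M / r * 4) (3 / 4) e _ e0; first by apply/andP; split; lra.
  exists N => n /NP; apply: le_lt_trans; rewrite -[leRHS]mulrA ler_wpM2l ?divr_ge0 ?(ltW M0) ?(ltW r0)//.
move=> e e0; have [N NP] := tsmall e e0; exists N => n /NP; apply: le_lt_trans.
by rewrite -normcN opprB.
Qed.

Lemma cdiff_shift f z w l : cdiff (fun h => f (z + h)) w l <-> cdiff f (z + w) l.
Proof.
split=> H e e0; have [d d0 {}H] := H e e0; exists d => // u.
  rewrite (_ : u - (z + w) = (u - z) - w); last by ring.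
  by move=> /H; rewrite addrCA subrr addr0.
rewrite (_ : u - w = (z + u) - (z + w)); last by ring.
exact: H.
Qed.

(** Recentred at z, f' is again the sum of a power series, by [psum_derive]; its derivative at the
    centre is the coefficient 2 a_2. *)
Lemma entire_derive f f' : (forall z, cdiff f z (f' z)) -> entire f'.
Proof.
move=> ff' z.
have ff'z w : cdiff (fun h => f (z + h)) w (f' (z + w)) by apply/cdiff_shift.
have [a aP] : exists a, forall w, psum_to a w (f (z + w)).
  by apply: entire_series => w; exists (f' (z + w)).
have H := psum_derive aP ff'z.
have := psum_cdiff0 ltr01 (fun w _ => H w).
by move=> /cdiff_shift; rewrite addr0 => h; exists (2%:R * a 2%N).
Qed.

(** * Laurent series and M_0 *)

Definition vanish_below (n0 : int) (c : int -> C) := forall n : int, n < n0 -> c n = 0.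

Definition lsum (c : int -> C) (q : C) (n0 : int) (N : nat) : C :=
  \sum_(k < N) c (n0 + k%:Z) * q ^ (n0 + k%:Z).

Lemma lsum_shift c q n0 (d N : nat) : vanish_below (n0 + d%:Z) c ->
  lsum c q n0 (d + N) = lsum c q (n0 + d%:Z) N.
Proof.
move=> c0; rewrite /lsum big_split_ord /= big1 ?add0r; last first.
  by move=> i _; rewrite c0 ?mul0r//; have := ltn_ord i; lia.
by apply: eq_bigr => i _; rewrite PoszD addrA.
Qed.

Definition seq_to (u : nat -> C) (l : C) := forall e : R, 0 < e ->
  exists N, forall n, (N <= n)%N -> normc (u n - l) < e.

Lemma lsum_to_shift c q l n0 (d : nat) : vanish_below (n0 + d%:Z) c ->
  seq_to (lsum c q n0) l <-> seq_to (lsum c q (n0 + d%:Z)) l.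
Proof.
move=> c0; split=> H e e0; have [N NP] := H e e0.
  by exists N => n Nn; rewrite -lsum_shift//; apply: NP; rewrite (leq_trans Nn)// leq_addl.
exists (d + N)%N => n dn; rewrite -(subnKC (leq_trans (leq_addr N d) dn)) lsum_shift//.
by apply: NP; rewrite leq_subRL ?(leq_trans (leq_addr N d) dn).
Qed.

(** [laurent_sum] hides its starting index under an existential; neither convergence nor the sum
    depends on the choice. *)
Lemma lsum_to_base c q l n0 n1 : vanish_below n0 c -> vanish_below n1 c ->
  seq_to (lsum c q n0) l -> seq_to (lsum c q n1) l.
Proof.
wlog : n0 n1 / n0 <= n1 => [H|le01] c0 c1.
  have [le01|/ltW le10] := leP n0 n1; first exact: H.
  move=> S; have [d dE] : exists d : nat, n0 = n1 + d%:Z by exists `|n0 - n1|%N; lia.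
  rewrite dE in S c0; by apply: (iffRL (lsum_to_shift q l c0)).  
have [d dE] : exists d : nat, n1 = n0 + d%:Z by exists `|n1 - n0|%N; lia.
by rewrite dE in c1 *; exact: (iffLR (lsum_to_shift q l c1)).
Qed.

Lemma laurent_sumE c q l : laurent_sum c q l <->
  exists2 n0, vanish_below n0 c & seq_to (lsum c q n0) l.
Proof.
have E n0 : series (fun k : nat => c (n0 + k%:Z) * q ^ (n0 + k%:Z) : C^o) = lsum c q n0.
  by apply/funext => N; rewrite /series /= big_mkord.
split=> [[n0 [c0]]|[n0 c0 H]].
  by rewrite E => /cvg_complex H; exists n0.
by exists n0; split => //; rewrite E; apply/cvg_complex.
Qed.

(** Multiplication by q^K reduces Laurent series to power series. *)
Lemma laurent_sum_psum c q l (K : nat) : q != 0 -> vanish_below (- K%:Z) c ->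
  laurent_sum c q l <-> psum_to (fun j => c (j%:Z - K%:Z)) q (l * q ^+ K).
Proof.
move=> q0 cK; have qK : 0 < normc q ^+ K by rewrite exprn_gt0// normc_gt0.
have E N : psum (fun j => c (j%:Z - K%:Z)) q N = lsum c q (- K%:Z) N * q ^+ K.
  rewrite /psum /lsum mulr_suml; apply: eq_bigr => i _.
  rewrite [- _ + _]addrC -mulrA; congr (_ * _).
  by rewrite !exprnP -expfzDr// subrK.
split=> [/laurent_sumE[n0 c0 /lsum_to_base S]|H].
  have {}S := S _ c0 cK; move=> e e0; have eq0 : 0 < e / normc q ^+ K by rewrite divr_gt0.
  have [N NP] := S _ eq0; exists N => n /NP; rewrite E -mulrBl normcM normcX.
  by rewrite ltr_pdivlMr.
apply/laurent_sumE; exists (- K%:Z) => // e e0.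
have eq0 : 0 < e * normc q ^+ K by rewrite mulr_gt0.
have [N NP] := H _ eq0; exists N => n /NP; rewrite E -mulrBl normcM normcX.
by rewrite ltr_pM2r.
Qed.

Lemma vanish_belowW n0 n1 c : n1 <= n0 -> vanish_below n0 c -> vanish_below n1 c.
Proof. by move=> le c0 n nn; apply: c0; apply: lt_le_trans le. Qed.

Lemma vanish_nat n0 c : vanish_below n0 c -> exists K : nat, vanish_below (- K%:Z) c.
Proof. by move=> c0; exists `|n0|%N; apply: vanish_belowW c0; lia. Qed.

Lemma laurent_sum_uniq c q l l' : q != 0 -> laurent_sum c q l -> laurent_sum c q l' -> l = l'.
Proof.
move=> q0 h h'; have /laurent_sumE[n0 /vanish_nat[K cK] _] := h.
move: h h'; rewrite !(laurent_sum_psum _ q0 cK) => h h'.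
by have /mulIf := psum_to_uniq h h'; apply; rewrite expf_neq0.
Qed.

Lemma laurent_val_sum c q l : q != 0 -> laurent_sum c q l -> laurent_val c q = l.
Proof.
by move=> q0 h; rewrite /laurent_val; case: xgetP => [l' _ /(laurent_sum_uniq q0 h)|/(_ l)].
Qed.

Lemma laurent_sum_lin c c' q l l' k : q != 0 -> laurent_sum c q l -> laurent_sum c' q l' ->
  laurent_sum (fun n => k * c n + c' n) q (k * l + l').
Proof.
move=> q0 h h'; have /laurent_sumE[n0 /vanish_nat[K1 c1] _] := h.
have /laurent_sumE[n0' /vanish_nat[K2 c2] _] := h'.
pose K := maxn K1 K2.
have cK : vanish_below (- K%:Z) c by apply: vanish_belowW c1; rewrite /K; lia.
have cK' : vanish_below (- K%:Z) c' by apply: vanish_belowW c2; rewrite /K; lia.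
have cK2 : vanish_below (- K%:Z) (fun n => k * c n + c' n).
  by move=> n nK; rewrite cK// cK'// mulr0 addr0.
move: h h'; rewrite !(laurent_sum_psum _ q0 cK) !(laurent_sum_psum _ q0 cK') => h h'.
by apply/(laurent_sum_psum _ q0 cK2); rewrite mulrDl -mulrA; exact: psum_to_lin.
Qed.

Lemma zero_extE (P : pred C) (g : {x : C | P x} -> C) x : zero_ext g (val x) = g x.
Proof. by rewrite /zero_ext valK. Qed.

(** The first hypothesis bounds both supports from below, so one power of q clears both series; the
    second feeds [psum_unique]. *)
Lemma laurent_uniq c c' : (exists q l, [/\ q != 0, laurent_sum c q l & laurent_sum c' q l]) ->
  (forall e : R, 0 < e -> exists q l,
     [/\ q != 0, normc q < e, laurent_sum c q l & laurent_sum c' q l]) -> c = c'.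
Proof.
move=> [q1 [l1 [q10 h1 h1']]] small.
have /laurent_sumE[n0 /vanish_nat[K1 c1] _] := h1.
have /laurent_sumE[n0' /vanish_nat[K2 c2] _] := h1'.
pose K := maxn K1 K2.
have cK : vanish_below (- K%:Z) c by apply: vanish_belowW c1; rewrite /K; lia.
have cK' : vanish_below (- K%:Z) c' by apply: vanish_belowW c2; rewrite /K; lia.
have D q l : q != 0 -> laurent_sum c q l -> laurent_sum c' q l ->
    psum_to (fun j => c (j%:Z - K%:Z) - c' (j%:Z - K%:Z)) q 0.
  move=> q0 /(laurent_sum_psum _ q0 cK) h /(laurent_sum_psum _ q0 cK') h'.
  have := psum_to_lin (-1) h' h; rewrite mulN1r addNr; apply: psum_to_ext => j; ring.
have Z : forall j, c (j%:Z - K%:Z) - c' (j%:Z - K%:Z) = 0.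
  apply: (@psum_unique (fun j : nat => c (j%:Z - K%:Z) - c' (j%:Z - K%:Z)) q1) => //.
    by exists 0; apply: D h1'.
  by move=> e /small[q [l [q0 qe h h']]]; exists q; split => //; exact: D h h'.
apply/funext => n; have [nK|nK] := ltP n (- K%:Z); first by rewrite cK// cK'.
have := Z (absz (n + K%:Z)); rewrite gez0_abs; last by lia.
by rewrite addrK => /eqP; rewrite subr_eq0 => /eqP.
Qed.

(** * Elements of M_0 as entire functions divided by powers of q *)

Definition punct (z : C) (z0 : z != 0) : punctured := exist (fun z : C => z != 0) z z0.

Lemma small_punctured (e : R) : 0 < e -> exists q : punctured, normc (val q) < e.
Proof.
move=> e0; have q0 : (e / 2)%:C%C != 0 :> C.
  by rewrite -normc_gt0 normc_real ger0_norm; lra.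
by exists (punct q0); rewrite normc_real ger0_norm; lra.
Qed.

Lemma is_laurent_uniq g c c' : is_laurent g c -> is_laurent g c' -> c = c'.
Proof.
move=> h h'; apply: laurent_uniq.
  have [q _] := small_punctured ltr01.
  by exists (val q), (g q); split; [exact: (valP q)|exact: (h q)|exact: (h' q)].
move=> e /small_punctured[q qe].
by exists (val q), (g q); split => //; exact: (valP q).
Qed.

Lemma lcoefE g c : is_laurent g c -> lcoef g = c.
Proof.
move=> h; apply: (@is_laurent_uniq g) => //.
by rewrite /lcoef; apply: (@getPex _ [set c : int -> C^o | is_laurent g c]); exists c.
Qed.

(** Multiplied by q^K, g agrees near 0 with the numerator of its pole, which is differentiable at 0
    too; the two pieces glue to an entire function. *)
Lemma M0_repr g : M0 g -> exists (K : nat) (H : C -> C), entire H /\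
  forall q : punctured, g q * val q ^+ K = H (val q).
Proof.
move=> [hg [K [h [/near_complex[d d0 hd] /near_complex_punctured[d' d'0 gh]]]]].
(* The value at 0 must come from [h], because [zero_ext] puts 0 there. *)
exists K, (fun z => if z == 0 then h 0 else zero_ext g z * z ^+ K); split; last first.
  by move=> q; rewrite (negbTE (valP q)) zero_extE.
have hX z : holo (fun w => w ^+ K) z by exists (K%:R * z ^+ K.-1); exact: cdiffX.
move=> z; have [->|z0] := eqVneq z 0.
  have m0 : 0 < Num.min d d' by rewrite lt_min d0.
  apply: (holo_eq (f := h) m0); last first.
    by apply/derivable_cdiff/hd; rewrite subrr normc0.
  move=> w; rewrite lt_min => /andP[wd wd']; case: eqVneq => [->//|w0].
  by rewrite gh//; [rewrite subr0 divfK// expf_neq0|apply/eqP].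
have n0 : 0 < normc z by rewrite normc_gt0.
apply: (holo_eq (f := fun w => zero_ext g w * w ^+ K) n0).
  move=> w wz; case: eqVneq => [w0|//]; move: wz; rewrite w0 sub0r normcN ltxx //.
by apply: holoM => //; apply/derivable_cdiff; exact: (hg (punct z0)).
Qed.

Lemma repr_M0 g (K : nat) (H : C -> C) : entire H ->
  (forall q : punctured, g q * val q ^+ K = H (val q)) -> M0 g.
Proof.
move=> eH gH.
have zg z : z != 0 -> zero_ext g z = H z / z ^+ K.
  move=> z0; rewrite -[z]/(val (punct z0)) zero_extE -gH /= mulfK//.
  by rewrite expf_neq0.
split.
  move=> x; apply/derivable_cdiff.
  have n0 : 0 < normc (val x) by rewrite normc_gt0; exact: (valP x).
  apply: (holo_eq (f := fun w => H w * (w ^+ K)^-1) n0); last first.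
    by apply: holoM; [exact: eH|apply: holo_ratX; exact: (valP x)].
  move=> w wx; rewrite zg//; apply/eqP => w0.
  by move: wx; rewrite w0 sub0r normcN ltxx.
exists K, H; split.
  by apply/near_complex; exists 1 => // w _; apply/derivable_cdiff; exact: eH.
by apply/near_complex_punctured; exists 1 => // w /eqP w0 _; rewrite subr0 zg.
Qed.

(** The coefficient of q^n is a_(n+K); matching on [Posz] sets it to 0 when n < -K. *)
Lemma repr_laurent g (K : nat) (H : C -> C) (a : nat -> C) :
  (forall q : punctured, g q * val q ^+ K = H (val q)) -> (forall z, psum_to a z (H z)) ->
  is_laurent g (fun n => if n + K%:Z is Posz m then a m else 0).
Proof.
move=> gH aH q; apply/(laurent_sum_psum (K := K) _ (valP q)).
  by move=> n nK; case E: (n + K%:Z) => [m|//]; lia.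
by rewrite gH; apply: psum_to_ext (aH _) => j; rewrite subrK.
Qed.

Lemma lcoefP g : M0 g -> is_laurent g (lcoef g).
Proof.
move=> /M0_repr[K [H [eH gH]]]; have [a aH] := entire_series eH.
by have h := repr_laurent gH aH; rewrite (lcoefE h).
Qed.

Lemma lcoef_lin g h k : M0 g -> M0 h ->
  lcoef (fun q => k * g q + h q) = fun n => k * lcoef g n + lcoef h n.
Proof.
move=> /lcoefP Mg /lcoefP Mh; apply: lcoefE => q.
by apply: laurent_sum_lin; [exact: (valP q)|exact: Mg|exact: Mh].
Qed.

Lemma M0_lin g h k : M0 g -> M0 h -> M0 (fun q => k * g q + h q).
Proof.
move=> /M0_repr[K [H [eH gH]]] /M0_repr[L [I [eI hI]]].
have eX n : entire (fun w => w ^+ n) by move=> z; exists (n%:R * z ^+ n.-1); exact: cdiffX.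
apply: (@repr_M0 _ (K + L) (fun z => k * z ^+ L * H z + z ^+ K * I z)).
  move=> z; apply: holoD; apply: holoM => //; last exact: eX.
  by apply: holoM; [exact: holo_cst|exact: eX].
by move=> q; rewrite -gH -hI exprD; ring.
Qed.

Lemma M0_cst (c : C) : M0 (fun=> c).
Proof.
apply: (@repr_M0 _ 0 (fun=> c)); first by move=> z; exact: holo_cst.
by move=> q; rewrite mulr1.
Qed.

Lemma M0_submod : submod (M0 : set (punctured -> C^o)).
Proof. by split; [exact: M0_cst|move=> k g h; exact: M0_lin]. Qed.

(** * The operator q d/dq on M_0 *)

Definition qD (g : punctured -> C) (q : punctured) : C :=
  val q * ('D_1 (zero_ext g) (val q : C^o) : C).

(** The product rule for H = g q^K reads q H' = (q g') q^K + K H. The operator thus keeps the same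
    power of q as denominator. *)
Lemma qD_repr g (K : nat) (H : C -> C) (H' : C -> C) : M0 g -> 
  (forall q : punctured, g q * val q ^+ K = H (val q)) -> (forall z, cdiff H z (H' z)) ->
  forall q : punctured, qD g q * val q ^+ K = val q * H' (val q) - K%:R * H (val q).
Proof.
move=> [hg _] gH HH' q; rewrite /qD; set D := derive _ _ _.
have q0 : val q != 0 by exact: (valP q).
have gD : cdiff (zero_ext g) (val q) D.
  by apply/is_derive_cdiff; exact: derivableP (hg q).
have n0 : 0 < normc (val q) by rewrite normc_gt0.
have : cdiff H (val q) (zero_ext g (val q) * (K%:R * val q ^+ K.-1) + val q ^+ K * D).
  apply: (cdiff_eq (f := fun w => zero_ext g w * w ^+ K) n0); last first.
    exact: cdiffM gD (cdiffX K _).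
  move=> w wq; have w0 : w != 0.
    by apply/eqP => w0; move: wq; rewrite w0 sub0r normcN ltxx.
  by rewrite -[w]/(val (punct w0)) zero_extE gH.
move=> /(cdiff_uniq (HH' (val q))) ->; rewrite zero_extE -gH.
case: K {gH} => [|K]; first by rewrite !expr0; ring.
by rewrite /= !exprS; ring.
Qed.

Lemma M0_qD g : M0 g -> M0 (qD g).
Proof.
move=> Mg; have [K [H [eH gH]]] := M0_repr Mg.
have [H' HH'] := choice eH.
apply: (repr_M0 (K := K) (H := fun z => z * H' z - K%:R * H z)); last exact: qD_repr.
move=> z; apply: holoB; apply: holoM; [exact: holo_id|exact: entire_derive HH' z|exact: holo_cst|exact: eH].
Qed.

Lemma lcoef_qD g n : M0 g -> lcoef (qD g) n = n%:~R * lcoef g n.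
Proof.
move=> Mg; have [K [H [eH gH]]] := M0_repr Mg.
have [H' HH'] := choice eH; have [a aH] := entire_series eH.
rewrite (lcoefE (repr_laurent gH aH)).
(* The series of z H' - K H has coefficients (j - K) a_j, and j - K = n after the shift by K. *)
pose b (j : nat) : C := j%:R * a j - K%:R * a j.
have bH z : psum_to b z (z * H' z - K%:R * H z).
  have S : psum_to (fun j => j%:R * a j) z (z * H' z).
    have := psum_derive aH HH' z => S e e0.
    have n0 : 0 < normc z + 1 by rewrite ltr_wpDl ?normc_ge0.
    have ez : 0 < e / (normc z + 1) by rewrite divr_gt0.
    have [N NP] := S _ ez; exists N.+1 => -[//|m] /NP.
    have -> : psum (fun j => j%:R * a j) z m.+1 = z * psum (fun n => n.+1%:R * a n.+1) z m.
      rewrite /psum big_ord_recl mul0r mul0r add0r mulr_sumr; apply: eq_bigr => i _.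
      by rewrite exprS /= (_ : bump 0 i = i.+1)//; ring.
    rewrite -mulrBr normcM; set X := normc (_ - _) => h.
    have : (normc z + 1) * X < e by rewrite mulrC -ltr_pdivlMr.
    have : 0 <= X by exact: normc_ge0.
    lra.
  have := psum_to_lin (- K%:R) (aH z) S; rewrite addrC mulNr.
  by apply: psum_to_ext => j; rewrite /b; ring.
rewrite (lcoefE (repr_laurent (qD_repr Mg gH HH') bH)).
case E : (n + K%:Z) => [m|m]; last by rewrite mulr0.
have -> : n = m%:Z - K%:Z by rewrite -E addrK.
by rewrite /b rmorphB /= -!pmulrn; ring.
Qed.

Lemma qD_lin g h k q : M0 g -> M0 h -> qD (fun q => k * g q + h q) q = k * qD g q + qD h q.
Proof.
move=> Mg Mh; have [hg _] := Mg; have [hh _] := Mh; have [hgh _] := M0_lin k Mg Mh.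
rewrite /qD; set D := derive _ _ _; set Dg := derive _ _ _; set Dh := derive _ _ _.
have dg : cdiff (zero_ext g) (val q) Dg by apply/is_derive_cdiff; exact: derivableP (hg q).
have dh : cdiff (zero_ext h) (val q) Dh by apply/is_derive_cdiff; exact: derivableP (hh q).
have dgh : cdiff (zero_ext (fun q => k * g q + h q)) (val q) D.
  by apply/is_derive_cdiff; exact: derivableP (hgh q).
have := cdiffD (cdiffM (cdiff_cst k _) dg) dh.
have -> : (fun w => k * zero_ext g w + zero_ext h w) = zero_ext (fun q : punctured => k * g q + h q).
  by apply/funext => w; rewrite /zero_ext; case: insubP => // _; rewrite mulr0 addr0.
by move=> /(cdiff_uniq dgh) ->; ring.
Qed.

Lemma qD_cst c q : qD (fun=> c) q = 0.
Proof.
rewrite /qD; set D := derive _ _ _; have [hc _] := M0_cst c.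
have dg : cdiff (zero_ext ((fun=> c) : punctured -> C)) (val q) D by apply/is_derive_cdiff; exact: derivableP (hc q).
suff -> : D = 0 by rewrite mulr0.
apply: cdiff_uniq dg _.
have n0 : 0 < normc (val q) by rewrite normc_gt0; exact: (valP q).
apply: (cdiff_eq (f := fun=> c) n0) (cdiff_cst c _) => w wq.
have w0 : w != 0 by apply/eqP => w0; move: wq; rewrite w0 sub0r normcN ltxx.
by rewrite -[w]/(val (punct w0)) zero_extE.
Qed.

(** * Jacobi forms of index 0 *)

Lemma normc_cexp (z : C) : normc (cexp z) = expR (complex.Re z).
Proof.
by case: z => x y /=; rewrite !exprMn -mulrDr trigo.cos2Dsin2 mulr1 sqrtr_sqr ger0_norm// expR_ge0.
Qed.

Lemma cexpD (z w : C) : cexp (z + w) = cexp z * cexp w.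
Proof.
case: z w => [x y] [x' y']; apply/eqP; rewrite eq_complex /=.
by rewrite exp.expRD trigo.sinD trigo.cosD; apply/andP; split; apply/eqP; ring.
Qed.

Lemma nomeD (z w : C) : nome (z + w) = nome z * nome w.
Proof. by rewrite /nome mulrDr cexpD. Qed.

Lemma normc_nome (z : C) : normc (nome z) = expR (- (2 * pi * complex.Im z)).
Proof. by rewrite /nome normc_cexp; case: z => x y /=; rewrite mul0r sub0r. Qed.

Lemma nome_neq0 (z : C) : nome z != 0.
Proof. by rewrite -normc_gt0 normc_nome expR_gt0. Qed.

Lemma nome_small (e : R) : 0 < e -> exists Y : R, forall z, Y < complex.Im z -> normc (nome z) < e.
Proof.
move=> e0; have p0 : 0 < 2 * pi :> R by rewrite mulr_gt0// pi_gt0.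
exists (- ln e / (2 * pi)) => z; rewrite ltr_pdivrMr// => zY.
by rewrite normc_nome -[ltRHS]lnK ?posrE// ltr_expR; lra.
Qed.

(* With h(q) = sum_n a_n q^n near 0 and p = e^(2 pi i tau), the equation       *)
(* h(p q) = p^k h(q) gives a_n (p^n - p^k) = 0.                                *)
Lemma jacobi_const s J (tau : upper) z z' : jacobi_form s J -> J (z, tau) = J (z', tau).
Proof.
move=> jJ; pose t : C := val tau; have t0 : 0 < complex.Im t by exact: (valP tau).
(* Large Im z is enough: adding a natural multiple of tau, whose imaginary part is positive, moves
   any point there without changing J. *)
suff [c [Y0 cP]] : exists c Y, forall z, Y < complex.Im z -> J (z, tau) = c.
  suff H w : J (w, tau) = c by rewrite !H.
  have [N NP] : exists N : nat, Y0 < complex.Im (w + N%:R * t).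
    exists (Num.bound ((`|Y0| + `|complex.Im w|) / complex.Im t)).
    set N := Num.bound _.
    have : (`|Y0| + `|complex.Im w|) / complex.Im t < N%:R.
      by apply: archi_boundP; rewrite divr_ge0 ?addr_ge0// ltW.
    rewrite ltr_pdivrMr// => h.
    have -> : complex.Im (w + N%:R * t) = complex.Im w + N%:R * complex.Im t.
      rewrite cImD (_ : N%:R * t = N%:R%:C%C * t); last by rewrite rmorph_nat.
      by rewrite cImM /= mul0r addr0.
    have := ler_norm Y0; have := ler_norm (- complex.Im w); rewrite normrN; lra.
  have := jac_per jJ N%:Z 0 w tau; rewrite -/t addr0 => <-.
  by rewrite -pmulrn; exact: cP.
have [phi [[k [h [/near_complex[d d0 hd] /near_complex_punctured[d' d'0 gh]]]] [Y YP]]] :=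
  jac_polar jJ tau.
(* The square of half-side d / 4 lies in the disc of radius d, where h is differentiable. *)
pose r := d / 4; have r0 : 0 < r by rewrite /r; lra.
have [a aP] : exists a, forall w, normc w < r -> psum_to a w (h w).
  apply: taylor_disc => // w [/andP[w1 w2] /andP[w3 w4]]; apply/derivable_cdiff/hd.
  rewrite subr0; apply: le_lt_trans (normc_le_ReIm w) _.
  have : `|complex.Re w| <= r by rewrite ler_norml w1.
  have : `|complex.Im w| <= r by rewrite ler_norml w3.
  rewrite /r; lra.
pose p := nome t; have p0 : 0 < normc p by rewrite normc_gt0 nome_neq0.
have p1 : normc p < 1.
  by rewrite normc_nome expR_lt1 oppr_lt0 !mulr_gt0// pi_gt0.
have m0 : 0 < Num.min r d' by rewrite lt_min r0.
have [Y1 Y1P] := nome_small m0.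
pose Y0 := Num.max Y Y1.
have Jh w : Y0 < complex.Im w -> normc (nome w) < r /\ J (w, tau) * nome w ^+ k = h (nome w).
  rewrite gt_max => /andP[wY /Y1P]; rewrite lt_min => /andP[wr wd']; split => //.
  rewrite YP// gh ?subr0 ?divfK ?expf_neq0 ?nome_neq0//.
  exact/eqP/nome_neq0.
pose b n := a n * p ^+ n - p ^+ k * a n.
have bP w : Y0 < complex.Im w -> psum_to b (nome w) 0.
  move=> wY; have [wr wJ] := Jh w wY.
  have wtY : Y0 < complex.Im (w + t) by rewrite cImD; lra.
  have [wtr wtJ] := Jh _ wtY.
  have A1 : psum_to (fun n => a n * p ^+ n) (nome w) (h (nome (w + t))).
    have := aP _ wtr; rewrite nomeD -/p => A e /A[N NP]; exists N => n /NP.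
    rewrite (_ : psum _ (_ * _) n = psum (fun n => a n * p ^+ n) (nome w) n)//.
    by apply: eq_bigr => i _; rewrite exprMn; ring.
  have := psum_to_lin (- p ^+ k) (aP _ wr) A1.
  have JE : J (w + t, tau) = J (w, tau).
    by have := jac_per jJ 1 0 w tau; rewrite addr0 mul1r.
  rewrite -wtJ -wJ JE nomeD -/p (_ : - p ^+ k * _ + _ = 0); last by rewrite exprMn; ring.
  by apply: psum_to_ext => n; rewrite /b; ring.
have b0 : forall n, b n = 0.
  pose w1 : C := Complex 0 (Y0 + 1).
  have w1Y : Y0 < complex.Im w1 by rewrite /=; lra.
  apply: (@psum_unique b (nome w1) (nome_neq0 _)); first by exists 0; exact: bP.
  move=> e /nome_small[Y2 Y2P]; pose w2 : C := Complex 0 (Num.max Y0 Y2 + 1).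
  have : Num.max Y0 Y2 < complex.Im w2 by rewrite /=; lra.
  rewrite gt_max => /andP[h1 h2]; exists (nome w2).
  by split; [exact: nome_neq0|exact: Y2P|exact: bP].
(* Since 0 < |p| < 1 the powers of |p| are distinct, so p^n - p^k vanishes only for n = k. *)
have a0 n : n != k -> a n = 0.
  move=> nk; have /eqP : a n * (p ^+ n - p ^+ k) = 0 by rewrite -[RHS](b0 n) /b; ring.
  rewrite mulf_eq0 subr_eq0 => /orP[/eqP//|/eqP /(congr1 (@Normc.normc _))].
  rewrite !normcX => /(ieexprIn p0 (negbT (lt_eqF p1))) nk'; by rewrite nk' eqxx in nk.
exists (a k), Y0 => w wY; have [wr wJ] := Jh w wY.
have qk : nome w ^+ k != 0 by rewrite expf_neq0// nome_neq0.
apply: (mulIf qk); rewrite wJ; apply: psum_to_uniq (aP _ wr) _ => e e0.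
exists k.+1 => n kn; rewrite /psum (bigD1 (Ordinal kn))//= big1 ?addr0 ?subrr ?normc0//.
by move=> i /eqP ik; rewrite a0 ?mul0r//; apply/eqP => ki; apply: ik; apply/val_inj.
Qed.

(** * Jacobi forms of index 0 as functions of tau, and their q-expansions *)

Lemma zero_ext_lin (P : pred C) (g h : {x : C | P x} -> C) (k : C) :
  zero_ext (fun x => k * g x + h x) = fun z => k * zero_ext g z + zero_ext h z.
Proof.
by apply/funext => z; rewrite /zero_ext; case: insub => // ; rewrite mulr0 addr0.
Qed.

Lemma Hol_submod : submod (Hol : set (upper -> C^o)).
Proof.
split=> [x|c g h hg hh x]; apply/derivable_cdiff.
  rewrite (_ : zero_ext _ = fun=> 0); first exact: holo_cst.
  by apply/funext => z; rewrite /zero_ext; case: insub.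
rewrite [zero_ext _](_ : _ = fun z => c * zero_ext g z + zero_ext h z); last first.
  exact: zero_ext_lin.
have /derivable_cdiff h1 := hg x; have /derivable_cdiff h2 := hh x.
by apply: holoD => //; apply: holoM => //; exact: holo_cst.
Qed.

(** Converse to [jacobi_const]: for a function of tau alone, periodicity and the conditions on poles
    are trivial, and only holomorphy and modularity remain. *)
Lemma jacobi_intro s (J : C * upper -> C) (j : upper -> C) : (forall z t, J (z, t) = j t) ->
  Hol j -> (forall (a b c d : int), a * d - b * c = 1 -> forall tau tau' : upper,
    val tau' = (a%:~R * val tau + b%:~R) / (c%:~R * val tau + d%:~R) ->
    j tau' = (c%:~R * val tau + d%:~R) ^ s * j tau) -> jacobi_form s J.
Proof.
move=> Jj hj jmod; split.
- move=> tau z; exists 0%N, (fun=> j tau); split.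
    by apply/near_complex; exists 1 => // w _; apply/derivable_cdiff; exact: holo_cst.
  by apply/near_complex_punctured; exists 1 => // w _ _; rewrite Jj expr0 divr1.
- by move=> z; rewrite (_ : (fun tau => J (z, tau)) = j)//; apply/funext => t; rewrite Jj.
- by move=> a b c d abcd z tau tau' tt; rewrite !Jj; exact: jmod tt.
- by move=> l m z tau; rewrite !Jj.
- move=> tau; exists (fun=> j tau); split; last by exists 0 => z _; rewrite Jj.
  exists 0%N, (fun=> j tau); split.
    by apply/near_complex; exists 1 => // w _; apply/derivable_cdiff; exact: holo_cst.
  by apply/near_complex_punctured; exists 1 => // w _ _; rewrite expr0 divr1.
Qed.

Lemma J0_const s J z t : J0 s J -> J (z, t) = J (0, t).
Proof. exact: jacobi_const. Qed.

(** As all members are independent of z, closure under linear combinations follows from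
    [jacobi_intro], without adding poles of different orders. *)
Lemma J0_submod s : submod (J0 s : set (C * upper -> C^o)).
Proof.
have [H0 HZ] := Hol_submod.
split=> [|c J K hJ hK].
  by apply: (@jacobi_intro _ _ (fun=> 0)) => // *; rewrite mulr0.
apply: (@jacobi_intro _ _ (fun t => c * J (0, t) + K (0, t))).
- by move=> z t; rewrite -(J0_const z t hJ) -(J0_const z t hK).
- by apply: HZ; [exact: (jac_hol hJ)|exact: (jac_hol hK)].
- move=> a b c' d abcd tau tau' tt.
  have := jac_mod hJ abcd 0 tt; have := jac_mod hK abcd 0 tt; rewrite mul0r => -> ->.
  ring.
Qed.

(** The q-expansion of a form independent of z: only the term q^0 occurs. *)
Definition const_coef (J : C * upper -> C) : int -> upper -> C :=
  fun n t => if n == 0 then J (0, t) else 0.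

Lemma laurent_sum_const (l q : C) : q != 0 -> laurent_sum (fun n => if n == 0 then l else 0) q l.
Proof.
move=> q0; apply/(laurent_sum_psum (K := 0) _ q0).
  by move=> n n0; case: eqP => // e; move: n0; rewrite e oppr0 ltxx.
move=> e e0; exists 1%N => -[//|n] _; rewrite /psum big_ord_recl /= !expr0 !mulr1 big1 ?addr0 ?subrr ?normc0//.
by move=> i _; rewrite mul0r.
Qed.

Lemma is_qexp_const s J : J0 s J -> is_qexp J (const_coef J).
Proof.
move=> hJ; split.
  by exists 0 => n t n0; rewrite /const_coef; case: eqP => // e; move: n0; rewrite e ltxx.
move=> z t; rewrite (J0_const z t hJ) /const_coef.
exact/laurent_sum_const/nome_neq0.
Qed.

Lemma is_qexp_uniq J alpha beta : is_qexp J alpha -> is_qexp J beta -> alpha = beta.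
Proof.
move=> [_ ha] [_ hb]; apply/funext => n; apply/funext => t.
suff /(congr1 (@^~ n)) : alpha^~ t = beta^~ t by [].
apply: laurent_uniq.
  by exists (nome 0), (J (0, t)); split => //; exact: nome_neq0.
move=> e /nome_small[Y YP]; pose w : C := Complex 0 (Y + 1).
exists (nome w), (J (w, t)); split => //; first exact: nome_neq0.
by apply: YP; rewrite /=; lra.
Qed.

Lemma qcoefP s J : J0 s J -> is_qexp J (qcoef J).
Proof.
move=> /is_qexp_const h; rewrite /qcoef.
by apply: (@getPex _ [set alpha : int -> upper -> C^o | is_qexp J alpha]); exists (const_coef J).
Qed.

Lemma qcoef_val s J q t : J0 s J -> q != 0 -> laurent_val ((qcoef J)^~ t) q = J (0, t).
Proof.
move=> hJ q0; have -> : qcoef J = const_coef J.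
  exact: is_qexp_uniq (qcoefP hJ) (is_qexp_const hJ).
by apply: laurent_val_sum => //; exact: laurent_sum_const.
Qed.

Lemma derive_jacobi s J (p : C * upper) : J0 s J ->
  ('D_1 (fun w : C^o => J (w, p.2) : C^o) (p.1 : C^o) : C) = 0.
Proof.
move=> hJ.
have : cdiff (fun w => J (w, p.2)) p.1 0.
  rewrite (_ : (fun w => _) = fun=> J (0, p.2)); first exact: cdiff_cst.
  by apply/funext => w; rewrite (J0_const w p.2 hJ).
by move=> /is_derive_cdiff[_ ->].
Qed.

(** * The Hori maps in coordinates *)

(** What the coordinate formula uses: right multiplication by scalar multiples of the unit, and the
    sign involution. These laws pass easily to [laurent_u] and [tau_ext], since convolving with a
    multiple of the unit leaves a single term. *)
Record right_unital (B : dgalg) : Prop := RightUnital {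
  ru_sub : forall k, submod (gr B k);
  ru_mulZ1 : forall k a (c : C), gr B k a -> dgmul a (c *: dg1 B) = c *: a;
  ru_par : forall k a, gr B k a -> dgpar a = ((-1 : C) ^ k) *: a;
  ru_mul11 : forall a c : C, dgmul (a *: dg1 B) (c *: dg1 B) = (a * c) *: dg1 B;
  ru_par1 : forall a : C, dgpar (a *: dg1 B) = a *: dg1 B }.

Lemma submodZ (M : lmodType C) (V : set M) (c : C) x : submod V -> V x -> V (c *: x).
Proof. by move=> [V0 VD] Vx; rewrite -[_ *: _]addr0; exact: VD. Qed.

Lemma submodD (M : lmodType C) (V : set M) x y : submod V -> V x -> V y -> V (x + y).
Proof. by move=> [V0 VD] Vx Vy; rewrite -[x]scale1r; exact: VD. Qed.

Lemma submod_sum (M : lmodType C) (V : set M) n (x : 'I_n -> M) : submod V ->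
  (forall i, V (x i)) -> V (\sum_(i < n) x i).
Proof.
move=> sV; elim: n x => [|n IH] x Vx; first by rewrite big_ord0; case: sV.
by rewrite big_ord_recr /=; apply: submodD => //; exact: IH.
Qed.

Lemma fsum1 (M : lmodType C) (F : int -> M) (a : int) : (forall i, i <> a -> F i = 0) ->
  \sum_(i \in [set: int]) F i = F a.
Proof.
move=> F0; rewrite -(fsbig_widen [set a])//; first by rewrite fsbig_set1.
by move=> i [_ /= ia]; exact: F0.
Qed.

Lemma fsum2 (M : lmodType C) (F : int -> M) (a b : int) : a <> b ->
  (forall i, i <> a -> i <> b -> F i = 0) ->
  \sum_(i \in [set: int]) F i = F a + F b.
Proof.
move=> ab F0; rewrite -(fsbig_widen [set a; b])//; last first.
  by move=> i [_ /= iab]; apply: F0 => e; apply: iab; [left|right].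
rewrite fsbigU//=; last by move=> i [->].
by rewrite !fsbig_set1.
Qed.

(** Scalar multiples of the unit have degree 0, so they commute without sign and the left unit law
    passes to the right. *)
Lemma dgca_right_unital (A : dgalg) : is_dgca A -> right_unital A.
Proof.
move=> dA; have sub0 k : gr A k 0 by case: (dg_sub dA k).
have mul0 k c : gr A k c -> dgmul 0 c = 0.
  move=> Ac; have := dg_mulDl dA 1 (sub0 0) (sub0 0) Ac.
  rewrite !scale1r addr0 => e; apply: (addrI (dgmul 0 c)); by rewrite -e addr0.
have one := dg_one dA.
have Z1 (c : C) : gr A 0 (c *: dg1 A) by apply: submodZ => //; exact: dg_sub.
have mulZ1 k a (c : C) : gr A k a -> dgmul a (c *: dg1 A) = c *: a.
  move=> Aa; rewrite (dg_mulC dA Aa (Z1 c)) mulr0 expr0z scale1r -[c *: _]addr0.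
  by rewrite (dg_mulDl dA c one (sub0 0) Aa) (mul0 _ _ Aa) addr0 (dg_mul1 dA Aa).
split => //; first exact: dg_sub.
- by move=> k a; exact: dg_par.
- by move=> a c; rewrite (mulZ1 0) // scalerA mulrC.
- by move=> a; rewrite (dg_par dA (Z1 a)) expr0z scale1r.
Qed.

(** Powers of u have even degree and do not affect signs. *)
Lemma expN1z_even (k n : int) : (-1 : C) ^ (k - 2 * n) = (-1) ^ k.
Proof.
have N10 : (-1 : C) != 0 by rewrite oppr_eq0 oner_eq0.
rewrite expfzDr// -mulrN -exprz_exp.
by rewrite (_ : (-1 : C) ^ 2 = 1) ?exp1rz ?mulr1// -[2]/(2%N%:Z) -exprnP sqrrN expr1n.
Qed.

Lemma laurent_u_right_unital (A : dgalg) : right_unital A -> right_unital (laurent_u A).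
Proof.
move=> rA; have sub0 k : gr A k 0 by case: (ru_sub rA k).
have ZE (c : C) : c *: dg1 (laurent_u A) = mono 0 (c *: dg1 A) :> (int -> A).
  by apply/funext => n; rewrite /= /mono -[LHS]/(c *: (if n == 0 then _ else _)); case: ifP; rewrite ?scaler0.
have m0 k a : gr A k a -> dgmul a 0 = 0.
  by move=> Aa; rewrite -[0 in LHS](scale0r (dg1 A)) (ru_mulZ1 rA _ Aa) scale0r.
have convE (a : int -> A) (c : C) n : (forall i, dgmul (a i) 0 = 0) ->
    Defs.conv a (mono 0 (c *: dg1 A)) n = dgmul (a n) (c *: dg1 A).
  move=> a0; rewrite /Defs.conv (@fsum1 _ _ n); first by rewrite /mono subrr eqxx.
  by move=> i ni; rewrite /mono subr_eq0; case: eqP => // e; case: ni.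
split => /=.
- move=> k; split; first by split; [move=> n; exact: sub0|exists 0].
  move=> c x y [xk [N xN]] [yk [N' yN]]; split.
    by move=> n; have [_] := ru_sub rA (k - 2 * n); apply.
  exists (Order.min N N') => n; rewrite lt_min => /andP[nN nN'].
  by rewrite -[LHS]/(c *: x n + y n) xN// yN// scaler0 addr0.
- move=> k a c [ak _]; apply/funext => n; rewrite ZE convE; last by move=> i; exact: m0 (ak i).
  exact: ru_mulZ1 (ak n).
- move=> k a [ak _]; apply/funext => n; rewrite (ru_par rA (ak n)).
  by rewrite expN1z_even.
- move=> a c; apply/funext => n; rewrite !ZE convE; last first.
    move=> i; rewrite /mono; case: ifP => _; last exact: m0 (sub0 0).
    by rewrite -[0 in LHS](scale0r (dg1 A)) (ru_mul11 rA) mulr0 scale0r.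
  rewrite /mono; case: ifP => _; first exact: ru_mul11.
  by rewrite (ru_mulZ1 rA _ (sub0 0)) scaler0.
- move=> a; apply/funext => n; rewrite ZE /mono; case: ifP => _; first exact: ru_par1.
  by rewrite (ru_par rA (sub0 0)) scaler0.
Qed.

(** * Powers of xi + t for t of square zero, and the two Hori maps *)

Section HoriFormula.
Variables (B : dgalg) (f : tdual -> B) (rB : right_unital B).

(* [u a b] is a + e_1R e_1L b for scalars a and b. *)
Let u (a b : C) : B_LR f := ((a *: dg1 B, 0), (0, b *: dg1 B)).

Let sub0 k : gr B k 0.
Proof. by case: (ru_sub rB k). Qed.

Let mul_0 k a : gr B k a -> dgmul a 0 = 0.
Proof. by move=> Ba; rewrite -[0 in LHS](scale0r (dg1 B)) (ru_mulZ1 rB _ Ba) scale0r. Qed.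

Let mul00 : dgmul 0 0 = 0 :> B.
Proof. exact: mul_0 (sub0 0). Qed.

Let mul0Z (c : C) : dgmul 0 (c *: dg1 B) = 0.
Proof. by rewrite (ru_mulZ1 rB _ (sub0 0)) scaler0. Qed.

Let mulZ0 (c : C) : dgmul (c *: dg1 B) 0 = 0.
Proof. by rewrite -[0 in LHS](scale0r (dg1 B)) (ru_mul11 rB) mulr0 scale0r. Qed.

Let par0 : dgpar 0 = 0 :> B.
Proof. by rewrite (ru_par rB (sub0 0)) scaler0. Qed.

Let pair_eq (a b c d a' b' c' d' : B) : a = a' -> b = b' -> c = c' -> d = d' ->
  ((a, b), (c, d)) = ((a', b'), (c', d')) :> B_LR f.
Proof. by move=> -> -> -> ->. Qed.

Let u_mul a b c d : dgmul (u a b) (u c d) = u (a * c) (a * d + b * c).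
Proof.
apply: pair_eq; rewrite /= ?(ru_par1 rB) ?par0 ?oppr0 ?mul00 ?mul0Z ?mulZ0 ?(ru_mul11 rB) ?addr0//.
by rewrite add0r scalerDl.
Qed.

Let u_add a b c d : u a b + u c d = u (a + c) (b + d).
Proof. by apply: pair_eq; rewrite /= ?addr0 ?scalerDl. Qed.

Let u0 : u 0 0 = 0.
Proof. by apply: pair_eq; rewrite /= ?scale0r. Qed.

Let e1L_e1R : dgmul (e1L f) (e1R f) = u 0 (-1).
Proof.
have one : dg1 B = 1 *: dg1 B by rewrite scale1r.
apply: pair_eq; rewrite /= ?par0 ?oppr0 one ?(ru_par1 rB) ?mul00 ?mul0Z ?mulZ0 ?addr0 ?scale0r//.
by rewrite add0r -scaleNr (ru_mul11 rB) mulr1 scalerA mulr1.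
Qed.

(** The coefficient of xi^j in xi^m + m t xi^(m-1), for t = s e_1R e_1L. *)
Let P (s : C) (m j : int) : B_LR f := u (j == m)%:R ((j == m - 1)%:R * m%:~R * s).

(** Multiplying by xi + t raises m by 1 in [P s m], and multiplying by xi^(-1) - t xi^(-2) lowers it
    by 1, because t^2 = 0; induction covers both signs of m. *)
Let powE (s : C) m : xi_plus_pow (u 0 s) m = P s m.
Proof.
have P0 : mono 0 (dg1 (B_LR f)) = P s 0.
  apply/funext => j; rewrite /P /mono mulr0 mul0r; case: eqP => _; last exact/esym/u0.
  by apply: pair_eq; rewrite /= ?scale1r ?scale0r.
have LE : mono 1 (dg1 (B_LR f)) + mono 0 (u 0 s) = fun j : int => u (j == 1)%:R ((j == 0)%:R * s).
  apply/funext => j; rewrite -[LHS]/(mono 1 (dg1 (B_LR f)) j + mono 0 (u 0 s) j) /mono.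
  have -> : dg1 (B_LR f) = u 1 0 by apply: pair_eq; rewrite /= ?scale1r ?scale0r.
  have [->|j1] := eqVneq j 1; first by rewrite addr0 mul0r.
  by case: eqP => _; rewrite add0r ?mul1r ?mul0r ?u0.
have NE : mono (-1) (dg1 (B_LR f)) - mono (-2) (u 0 s) =
    fun j : int => u (j == -1)%:R ((j == -2)%:R * - s).
  apply/funext => j; rewrite -[LHS]/(mono (-1) (dg1 (B_LR f)) j - mono (-2) (u 0 s) j) /mono.
  have -> : dg1 (B_LR f) = u 1 0 by apply: pair_eq; rewrite /= ?scale1r ?scale0r.
  have [->|j1] := eqVneq j (-1); first by rewrite subr0 mul0r.
  case: eqP => _; last by rewrite subr0 mul0r u0.
  by rewrite add0r mul1r; apply: pair_eq; rewrite /= ?scale0r ?oppr0 ?scaleNr.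
(* Only the exponents 1 and 0 of the factor xi + t contribute to the convolution. *)
have up m' : Defs.conv (fun j : int => u (j == 1)%:R ((j == 0)%:R * s)) (P s m') = P s (m' + 1).
  apply/funext => n; rewrite /Defs.conv (@fsum2 _ _ 1 0)//; last first.
    by move=> i /eqP/negbTE -> /eqP/negbTE ->; rewrite mul0r /P u_mul !mul0r addr0 u0.
  rewrite /P !u_mul u_add /= subr0 !mul0r !mul1r !addr0 add0r.
  have -> : (n - 1 == m') = (n == m' + 1) by apply/eqP/eqP => [<-|->]; lia.
  have -> : (n - 1 == m' - 1) = (n == m') by apply/eqP/eqP => [|->//]; lia.
  rewrite addrK; congr u.
  by rewrite intrD; case: eqP => _ /=; ring.
have down m' : Defs.conv (fun j : int => u (j == -1)%:R ((j == -2)%:R * - s)) (P s m') = P s (m' - 1).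
  apply/funext => n; rewrite /Defs.conv (@fsum2 _ _ (-1) (-2))//; last first.
    by move=> i /eqP/negbTE -> /eqP/negbTE ->; rewrite mul0r /P u_mul !mul0r addr0 u0.
  rewrite /P !u_mul u_add /= !opprK !mul0r !mul1r !addr0 add0r.
  have -> : (n + 1 == m') = (n == m' - 1) by apply/eqP/eqP => [<-|->]; lia.
  have -> : (n + 1 == m' - 1) = (n == m' - 1 - 1) by apply/eqP/eqP => [|->]; lia.
  have -> : (n + 2 == m') = (n == m' - 1 - 1) by apply/eqP/eqP => [<-|->]; lia.
  congr u.
  by rewrite rmorphB; case: eqP => _ /=; ring.
rewrite /xi_plus_pow LE NE P0; case: m => n.
  by elim: n => [//|n IH]; rewrite iterS IH up; congr P; lia.
by rewrite NegzE; elim: n => [|n IH]; [rewrite /= down|rewrite iterS IH down; congr P; lia].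
Qed.

(** The map alpha + e beta to beta + e' d alpha / d xi, coefficient by coefficient. *)
Definition Tshift (x : int -> B * B) : int -> (B * B)%type :=
  fun m => ((x m).2, ((m + 1)%:~R : C) *: (x (m + 1)).1).

Let par_par k a : gr B k a -> dgpar (dgpar a) = a.
Proof.
move=> Ba; have Bp : gr B k (dgpar a) by rewrite (ru_par rB Ba); apply: submodZ => //; exact: ru_sub.
by rewrite (ru_par rB Bp) (ru_par rB Ba) scalerA -exprzMl ?mulN1r ?opprK ?exp1rz ?scale1r// unitrN1.
Qed.

Let gr_par k a : gr B k a -> gr B k (dgpar a).
Proof. by move=> Ba; rewrite (ru_par rB Ba); apply: submodZ => //; exact: ru_sub. Qed.

Let gr_opp k a : gr B k a -> gr B k (- a).
Proof. by move=> Ba; rewrite -scaleN1r; apply: submodZ => //; exact: ru_sub. Qed.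

(** Moving the two odd generators past y.1 produces two signs that cancel, and the contribution of
    e_1L y.2 to the product with e_1R e_1L vanishes because e_1L^2 = 0. *)
Let inclL_mul k l (y : B_L f) c d : gr B k y.1 -> gr B l y.2 ->
  dgmul (inclL y) (u c d) = ((c *: y.1, c *: y.2), (0, d *: y.1)) :> B_LR f.
Proof.
case: y => a b /= Ba Bb.
apply: pair_eq; rewrite /= ?(ru_mulZ1 rB _ Ba) ?(ru_mulZ1 rB _ Bb) ?mul0Z ?par0 ?mul00
  ?(mul_0 (gr_par Ba)) ?(mul_0 (gr_opp (gr_par Bb))) ?(par_par Ba) ?(ru_mulZ1 rB _ Ba) ?addr0 ?add0r//.
Qed.

Let inclR_mul k l (y : B_R f) c d : gr B k y.1 -> gr B l y.2 ->
  dgmul (inclR y) (u c d) = ((c *: y.1, 0), (c *: y.2, d *: y.1)) :> B_LR f.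
Proof.
case: y => a b /= Ba Bb.
apply: pair_eq; rewrite /= ?(ru_mulZ1 rB _ Ba) ?(ru_mulZ1 rB _ Bb) ?mul0Z ?par0 ?oppr0 ?mul00
  ?(mul_0 (gr_par Ba)) ?(mul_0 (gr_par Bb)) ?(par_par Ba) ?(ru_mulZ1 rB _ Ba) ?addr0 ?add0r//.
Qed.

(** By [powE] the coefficient of xi^j collects only the terms m = j and m = j + 1. The sign in e_1L
    e_1R = - e_1R e_1L cancels against the one in [coefL]. *)
Lemma T_LRE k x : gr (G_L f) k x -> T_LR x = Tshift x.
Proof.
move=> [xk _]; apply/funext => j; rewrite /T_LR /pi_R /nu /subst_xi e1L_e1R.
rewrite (@fsum2 _ _ j (j + 1)); [|lia|]; last first.
  move=> m /eqP mj /eqP mj1; rewrite powE /P.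
  have -> : (j == m) = false by rewrite eq_sym; exact: negbTE.
  have -> : (j == m - 1) = false by rewrite -subr_eq opprK eq_sym; exact: negbTE.
  have [h1 h2] := xk m; rewrite /iota_R (inclL_mul _ _ h1 h2) !mul0r !scale0r.
  by apply: pair_eq.
have [h1 h2] := xk j; have [h3 h4] := xk (j + 1).
rewrite !powE /P /iota_R (inclL_mul _ _ h1 h2) (inclL_mul _ _ h3 h4).
rewrite addrK !eqxx.
have -> : (j == j - 1) = false by apply/eqP; lia.
have -> : (j == j + 1) = false by apply/eqP; lia.
rewrite /coefL /Tshift /= !mul0r !scale0r scale1r mul1r addr0 add0r mulrN1 scaleNr opprK.
by [].
Qed.

(** The same two terms survive; [nu_inv] uses the opposite of e_1L e_1R, that is e_1R e_1L, and
    [coefR] carries no sign, so the result agrees with [T_LRE]. *)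
Lemma T_RLE k x : gr (G_R f) k x -> T_RL x = Tshift x.
Proof.
move=> [xk _]; apply/funext => j; rewrite /T_RL /pi_L /nu_inv /subst_xi e1L_e1R.
have -> : - u 0 (-1) = u 0 1 by apply: pair_eq; rewrite /= ?scale0r ?oppr0// scaleN1r opprK scale1r.
rewrite (@fsum2 _ _ j (j + 1)); [|lia|]; last first.
  move=> m /eqP mj /eqP mj1; rewrite powE /P.
  have -> : (j == m) = false by rewrite eq_sym; exact: negbTE.
  have -> : (j == m - 1) = false by rewrite -subr_eq opprK eq_sym; exact: negbTE.
  have [h1 h2] := xk m; rewrite /iota_L (inclR_mul _ _ h1 h2) !mul0r !scale0r.
  by apply: pair_eq.
have [h1 h2] := xk j; have [h3 h4] := xk (j + 1).
rewrite !powE /P /iota_L (inclR_mul _ _ h1 h2) (inclR_mul _ _ h3 h4).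
rewrite addrK !eqxx.
have -> : (j == j - 1) = false by apply/eqP; lia.
have -> : (j == j + 1) = false by apply/eqP; lia.
rewrite /coefR /Tshift /= !mul0r !scale0r scale1r mul1r mulr1.
by rewrite -[LHS]/((x j).2 + 0, 0 + (j + 1)%:~R *: (x (j + 1)).1) addr0 add0r.
Qed.

End HoriFormula.

(** * Maps on tensor products *)

Lemma fun_sumE (X : Type) (M : lmodType C) n (F : 'I_n -> X -> M) x :
  (\sum_(i < n) F i) x = \sum_(i < n) F i x.
Proof.
elim: n F => [|n IH] F; first by rewrite !big_ord0.
by rewrite big_ord_recr [RHS]big_ord_recr -(IH (fun i => F (widen_ord (leqnSn n) i))).
Qed.

Section TensorFacts.
Variables (X : Type) (M N : lmodType C) (F : set (X -> C)).

Lemma tens_intro (V : set M) n (f : 'I_n -> X -> C) (v : 'I_n -> M) :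
  (forall i, F (f i)) -> (forall i, V (v i)) ->
  tens F V (fun x => \sum_(i < n) f i x *: v i).
Proof. by move=> Ff Vv; exists (Expansion f v). Qed.

Lemma tens_elim (V : set M) Phi : tens F V Phi ->
  exists n (f : 'I_n -> X -> C) (v : 'I_n -> M), [/\ forall i, F (f i), forall i, V (v i) &
    Phi = fun x => \sum_(i < n) f i x *: v i].
Proof. by move=> [[n f v] [[/= Ff ->] Vv]]; exists n, f, v. Qed.

Lemma tens1 (V : set M) f v : F f -> V v -> tens F V (fun x => f x *: v).
Proof.
move=> Ff Vv; have := @tens_intro V 1 (fun=> f) (fun=> v) (fun=> Ff) (fun=> Vv).
by under eq_fun do rewrite big_ord1.
Qed.

(** Linear combinations are obtained by concatenating expansions. *)
Lemma tens_submod (V : set M) : submod V -> submod (tens F V : set (X -> M)).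
Proof.
move=> sV; split.
  have := @tens_intro V 0 (fun=> fun=> 0) (fun=> 0) (fun i => False_ind _ (notF (ltn_ord i))) (fun i => False_ind _ (notF (ltn_ord i))).
  by under eq_fun do rewrite big_ord0.
move=> c _ _ /tens_elim[n [f [v [Ff Vv ->]]]] /tens_elim[m [g [w [Fg Vw ->]]]].
pose h (i : 'I_(n + m)) : X -> C :=
  match fintype.split i with inl j => f j | inr j => g j end.
pose u (i : 'I_(n + m)) : M :=
  match fintype.split i with inl j => c *: v j | inr j => w j end.
have lS j : fintype.split (lshift m j) = inl j := unsplitK (inl j).
have rS j : fintype.split (rshift n j) = inr j := unsplitK (inr j).
have := @tens_intro V _ h u; rewrite (_ : (fun x => _) = c *: (fun x => \sum_(i < n) f i x *: v i) +
    (fun x => \sum_(i < m) g i x *: w i)).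
  apply; first by move=> i; rewrite /h; case: fintype.split.
  by move=> i; rewrite /u; case: fintype.split => // j; exact: submodZ.
apply/funext => x; rewrite big_split_ord /=.
rewrite -[RHS]/(c *: (\sum_(i < n) f i x *: v i) + (\sum_(i < m) g i x *: w i)).
rewrite scaler_sumr; congr (_ + _); apply: eq_bigr => i _; rewrite /h /u ?lS ?rS//.
by rewrite !scalerA mulrC.
Qed.

Lemma tens_val (V : set M) Phi x : submod V -> tens F V Phi -> V (Phi x).
Proof.
move=> sV /tens_elim[n [f [v [_ Vv ->]]]]; apply: submod_sum => // i; exact: submodZ.
Qed.

Definition bilin (b : (X -> C) -> M -> N) : Prop :=
  (forall v (c : C) (g h : X -> C), F g -> F h ->
    b (fun x => c * g x + h x) v = c *: b g v + b h v) /\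
  (forall g (c : C) v w, F g -> b g (c *: v + w) = c *: b g v + b g w).

Variable b : (X -> C) -> M -> N.

Lemma bilin_zero : submod (F : set (X -> C^o)) -> (forall g v, F g -> b g v = 0) -> bilin b.
Proof.
move=> [_ sF] b0; split=> [v c g h Fg Fh|g c v w Fg].
  by rewrite !b0// ?scaler0 ?addr0//; exact: sF.
by rewrite !b0// scaler0 addr0.
Qed.

Lemma tlift_sum n (f : 'I_n -> X -> C) (v : 'I_n -> M) :
  submod (F : set (X -> C^o)) -> bilin b -> (forall i, F (f i)) ->
  tlift F b (fun x => \sum_(i < n) f i x *: v i) = \sum_(i < n) b (f i) (v i).
Proof. by move=> sF [bl br] Ff; exact: tliftE. Qed.

Lemma tlift1 f v : submod (F : set (X -> C^o)) -> bilin b -> F f ->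
  tlift F b (fun x => f x *: v) = b f v.
Proof.
move=> sF bb Ff; have := @tlift_sum 1 (fun=> f) (fun=> v) sF bb (fun=> Ff).
by rewrite big_ord1; under eq_fun do rewrite big_ord1.
Qed.

(** [tlift] may be evaluated on any expansion, in particular on the concatenation of those of its
    two arguments. *)
Lemma tlift_lin (V : set M) c Phi Psi : submod (F : set (X -> C^o)) -> bilin b ->
  tens F V Phi -> tens F V Psi ->
  tlift F b (c *: Phi + Psi) = c *: tlift F b Phi + tlift F b Psi.
Proof.
move=> sF bb /tens_elim[n [f [v [Ff Vv ->]]]] /tens_elim[m [g [w [Fg Vw ->]]]].
rewrite !tlift_sum//.
pose h (i : 'I_(n + m)) : X -> C :=
  match fintype.split i with inl j => f j | inr j => g j end.
pose u (i : 'I_(n + m)) : M :=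
  match fintype.split i with inl j => c *: v j | inr j => w j end.
have lS j : fintype.split (lshift m j) = inl j := unsplitK (inl j).
have rS j : fintype.split (rshift n j) = inr j := unsplitK (inr j).
rewrite (_ : _ + _ = (fun x => \sum_(i < n + m) h i x *: u i)); last first.
  apply/funext => x; rewrite big_split_ord /=.
  rewrite -[LHS]/(c *: (\sum_(i < n) f i x *: v i) + (\sum_(i < m) g i x *: w i)).
  rewrite scaler_sumr; congr (_ + _); apply: eq_bigr => i _; rewrite /h /u ?lS ?rS//.
  by rewrite !scalerA mulrC.
rewrite tlift_sum//; last by move=> i; rewrite /h; case: fintype.split.
have [_ br] := bb; have b0 f' : F f' -> b f' 0 = 0.
  move=> Ff'; have := br f' 1 0 0 Ff'; rewrite !scale1r addr0 => e.
  by apply: (addrI (b f' 0)); rewrite -e addr0.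
rewrite big_split_ord /= scaler_sumr; congr (_ + _); apply: eq_bigr => i _; rewrite /h /u ?lS ?rS//.
by rewrite -[c *: v i]addr0 br// b0// addr0.
Qed.

End TensorFacts.
Arguments bilin {X M N}.

Lemma mono_lin (M : lmodType C) n (c : C) (x y : M) :
  mono n (c *: x + y) = c *: mono n x + mono n y.
Proof.
apply/funext => m; transitivity (c *: mono n x m + mono n y m); last by [].
by rewrite /mono; case: ifP => // _; rewrite scaler0 addr0.
Qed.

(** * The maps of the diagram evaluated on expansions *)

Section MapFacts.
Variable A0 : dgalg.
Local Notation A := (laurent_u A0).

Lemma bilin_d_dz s : bilin (J0 s) (fun (J : C * upper -> C) (a : A0) (p : C * upper) =>
    ('D_1 (fun w : C^o => J (w, p.2) : C^o) (p.1 : C^o) : C) *: a).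
Proof.
apply: bilin_zero; first exact: J0_submod.
by move=> J a hJ; apply/funext => p; rewrite (derive_jacobi p hJ) scale0r.
Qed.

Lemma d_dz0 s k Phi : J0_of A0 s k Phi -> d_dz s Phi = 0.
Proof.
move=> /tens_elim[n [f [v [Ff Vv ->]]]].
rewrite /d_dz tlift_sum//; [|exact: J0_submod|exact: bilin_d_dz].
apply: big1 => i _; apply/funext => p; by rewrite (derive_jacobi p (Ff i)) scale0r.
Qed.

Lemma jac_D0 s k Phi : J0_of A0 s k Phi -> jac_D s Phi = 0.
Proof. by move=> /d_dz0; rewrite /jac_D => ->; rewrite scaler0. Qed.

Lemma bilin_qexp s : bilin (J0 s) (fun (J : C * upper -> C) (a : A0) (q : punctured) (t : upper) =>
    laurent_val ((qcoef J)^~ t) (val q) *: a : A0).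
Proof.
have E J (q : punctured) t : J0 s J -> laurent_val ((qcoef J)^~ t) (val q) = J (0, t).
  by move=> hJ; exact: (qcoef_val t hJ (valP q)).
have [_ sJ] := J0_submod s.
split=> [v c g h hg hh|g c v w hg]; apply/funext => q; apply/funext => t.
  transitivity ((c * g (0, t) + h (0, t)) *: v).
    by congr (_ *: _); apply: E; exact: sJ.
  transitivity (c *: (g (0, t) *: v) + h (0, t) *: v); first by rewrite scalerDl scalerA.
  by congr (c *: (_ *: _) + _ *: _); apply/esym; exact: E.
transitivity (g (0, t) *: (c *: v + w)); first by congr (_ *: _); exact: E.
transitivity (c *: (g (0, t) *: v) + g (0, t) *: w).
  by rewrite scalerDr !scalerA mulrC.
by congr (c *: (_ *: _) + _ *: _); apply/esym; exact: E.
Qed.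

(** Each form in an expansion of Phi has only a q^0 term, its value at z = 0, so the q-expansion is
    constant in q. *)
Lemma qexpE s k Phi : J0_of A0 s k Phi -> qexp s Phi = fun=> (fun t => Phi (0, t)).
Proof.
move=> /tens_elim[n [f [v [Ff Vv ->]]]].
rewrite /qexp tlift_sum//; [|exact: J0_submod|exact: bilin_qexp].
apply/funext => q; apply/funext => t; rewrite fun_sumE.
rewrite [LHS](fun_sumE (M := A0) (fun i t => laurent_val ((qcoef (f i))^~ t) (val q) *: v i)).
by apply: eq_bigr => i _; congr (_ *: _); exact: (qcoef_val t (Ff i) (valP q)).
Qed.

Lemma J0_of_slice s k Phi : J0_of A0 s k Phi -> gr (tau_ext A0) k (fun t => Phi (0, t)).
Proof.
move=> /tens_elim[n [f [v [Ff Vv ->]]]].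
by apply: (tens_intro (f := fun i t => f i (0, t))) => // i; exact: (jac_hol (Ff i)).
Qed.

Lemma M0_of_cst (B : dgalg) k b : gr B k b -> M0_of B k (fun=> b).
Proof.
move=> Bb; rewrite /M0_of (_ : (fun=> b) = fun q : punctured => (1 : C) *: b).
  exact: (tens1 (F := M0) (M0_cst 1) Bb).
by apply/funext => q; rewrite scale1r.
Qed.

Lemma bilin_q_d_dq (B : dgalg) : bilin M0 (fun (g : punctured -> C) (b : B) (q : punctured) =>
    (val q * ('D_1 (zero_ext g) (val q : C^o) : C)) *: b).
Proof.
split=> [v c g h hg hh|g c v w hg]; apply/funext => q.
  rewrite -[RHS]/(c *: (qD g q *: v) + qD h q *: v) scalerA -scalerDl.
  by rewrite -[LHS]/(qD (fun x => c * g x + h x) q *: v) qD_lin.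
by rewrite -[RHS]/(c *: (qD g q *: v) + qD g q *: w) scalerDr !scalerA mulrC.
Qed.

Lemma q_d_dq_cst (B : dgalg) (b : B) : q_d_dq (fun=> b) = 0.
Proof.
rewrite (_ : (fun=> b) = fun q : punctured => (1 : C) *: b); last first.
  by apply/funext => q; rewrite scale1r.
rewrite /q_d_dq (tlift1 b M0_submod (bilin_q_d_dq B) (M0_cst 1)); apply/funext => q.
by rewrite -[LHS]/(qD (fun=> 1) q *: b) qD_cst scale0r.
Qed.

Lemma q_d_dq_sum (B : dgalg) n (f : 'I_n -> punctured -> C) (v : 'I_n -> B) :
  (forall i, M0 (f i)) ->
  q_d_dq (fun q => \sum_(i < n) f i q *: v i) = fun q => \sum_(i < n) qD (f i) q *: v i.
Proof.
move=> Ff; rewrite /q_d_dq tlift_sum//; [|exact: M0_submod|exact: bilin_q_d_dq].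
by apply/funext => q; rewrite fun_sumE.
Qed.

Lemma bilin_mu i : bilin M0 (fun (g : punctured -> C) (b : tau_ext A0) (m : int) (t : upper) =>
    mono (i - m) (lcoef g (i - m) *: b t) : A).
Proof.
split=> [v c g h hg hh|g c v w hg]; apply/funext => m; apply/funext => t.
  rewrite lcoef_lin//.
  transitivity (c *: mono (i - m) (lcoef g (i - m) *: v t) + mono (i - m) (lcoef h (i - m) *: v t)); last by [].
  by rewrite -mono_lin; congr (mono _ _); rewrite scalerDl scalerA.
transitivity (c *: mono (i - m) (lcoef g (i - m) *: v t) + mono (i - m) (lcoef g (i - m) *: w t)); last by [].
rewrite -mono_lin; congr (mono _ _).
transitivity (lcoef g (i - m) *: (c *: v t + w t)); first by [].
by rewrite scalerDr !scalerA mulrC.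
Qed.

Lemma mu_sum i n (f : 'I_n -> punctured -> C) (v : 'I_n -> tau_ext A0) :
  (forall j, M0 (f j)) ->
  mu i (fun q => \sum_(j < n) f j q *: v j) =
  fun m t => mono (i - m) (\sum_(j < n) lcoef (f j) (i - m) *: v j t).
Proof.
move=> Ff; rewrite /mu tlift_sum//; [|exact: M0_submod|exact: bilin_mu].
apply/funext => m; apply/funext => t; rewrite fun_sumE.
rewrite [LHS](fun_sumE (M := A) (fun j t => mono (i - m) (lcoef (f j) (i - m) *: v j t))).
apply/funext => l.
rewrite [LHS](fun_sumE (M := A0) (fun j => mono (i - m) (lcoef (f j) (i - m) *: v j t))).
by rewrite /mono; case: ifP => // _; rewrite big1.
Qed.

End MapFacts.

(** * The diagram *)

Lemma tens_map (X : Type) (M N : lmodType C) (F : set (X -> C)) (V : set M) (W : set N)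
    (L : M -> N) Phi : (forall (c : C) x y, L (c *: x + y) = c *: L x + L y) ->
  (forall x, V x -> W (L x)) -> tens F V Phi -> tens F W (fun x => L (Phi x)).
Proof.
move=> LZ VW /tens_elim[n [f [v [Ff Vv ->]]]].
have L0 : L 0 = 0.
  by apply: (addrI (L 0)); rewrite addr0 -[X in X + _]scale1r -LZ scale1r addr0.
have -> : (fun x => L (\sum_(i < n) f i x *: v i)) = fun x => \sum_(i < n) f i x *: L (v i).
  apply/funext => x; elim: n f v {Ff Vv} => [|n IH] f v; first by rewrite !big_ord0.
  by rewrite !big_ord_recl LZ; congr (_ + _); exact: (IH (fun i => f (lift ord0 i)) (fun i => v (lift ord0 i))).
by apply: tens_intro => // i; exact: VW.
Qed.

Lemma laurent_xi_submod (B : dgalg) k : (forall l, submod (gr B l)) -> submod (laurent_xi B k).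
Proof.
move=> sB; split; first by split; [move=> m; case: (sB (k - 2 * m))|exists 0].
move=> c x y [xk [N xN]] [yk [N' yN]]; split.
  by move=> m; have [_] := sB (k - 2 * m); apply.
exists (Order.max N N') => m; rewrite gt_max => /andP[mN mN'].
by rewrite -[LHS]/(c *: x m + y m) xN// yN// scaler0 addr0.
Qed.

(* Convertible to both [gr (G_L f)] and [gr (G_R f)]. *)
Definition ext_series (B : dgalg) : gsp (int -> B * B)%type := fun k =>
  [set c | (forall m : int, gr B (k - 2 * m) (c m).1 /\ gr B (k - 2 * m - 1) (c m).2) /\
           exists N : int, forall m, N < m -> c m = 0].
Arguments ext_series : clear implicits.

Lemma ext_seriesP (B : dgalg) k x : ext_series B k x <->
  laurent_xi B k (fun m => (x m).1) /\ laurent_xi B (k - 1) (fun m => (x m).2).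
Proof.
split=> [[xk [N xN]]|[[x1 [N xN]] [x2 [N' xN']]]].
  split; split.
  - by move=> m; have [] := xk m.
  - by exists N => m /xN ->.
  - by move=> m; have [_] := xk m; rewrite addrAC.
  - by exists N => m /xN ->.
split; first by move=> m; split; [exact: x1|rewrite addrAC; exact: x2].
exists (Order.max N N') => m; rewrite gt_max => /andP[mN mN'].
by case: (x m) (xN _ mN) (xN' _ mN') => a b /= -> ->.
Qed.

Lemma ext_series_submod (B : dgalg) k : (forall l, submod (gr B l)) -> submod (ext_series B k).
Proof.
move=> sB; have [h0 hZ] := laurent_xi_submod k sB; have [h0' hZ'] := laurent_xi_submod (k - 1) sB.
split; first exact/ext_seriesP.
move=> c x y /ext_seriesP[x1 x2] /ext_seriesP[y1 y2]; apply/ext_seriesP; split.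
  exact: hZ x1 y1.
exact: hZ' x2 y2.
Qed.

Lemma Tshift_lin (B : dgalg) (c : C) (x y : int -> B * B) :
  Tshift (c *: x + y) = c *: Tshift x + Tshift y.
Proof.
apply/funext => m.
transitivity (c *: Tshift x m + Tshift y m); last by [].
rewrite /Tshift.
transitivity ((c *: (x m).2 + (y m).2, ((m + 1)%:~R : C) *: (c *: (x (m + 1)).1 + (y (m + 1)).1))).
  by [].
transitivity ((c *: (x m).2 + (y m).2, c *: (((m + 1)%:~R : C) *: (x (m + 1)).1) + ((m + 1)%:~R : C) *: (y (m + 1)).1)).
  by rewrite scalerDr !scalerA mulrC.
by [].
Qed.

Lemma d_dxi_lin (B : dgalg) (c : C) (x y : int -> B) :
  d_dxi (c *: x + y) = c *: d_dxi x + d_dxi y.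
Proof.
apply/funext => m.
transitivity (c *: d_dxi x m + d_dxi y m); last by [].
rewrite /d_dxi.
transitivity (((m + 1)%:~R : C) *: (c *: x (m + 1) + y (m + 1))); first by [].
by rewrite scalerDr !scalerA mulrC.
Qed.

Lemma d_dxi_gr (B : dgalg) k x : (forall l, submod (gr B l)) ->
  laurent_xi B k x -> laurent_xi B (k - 2) (d_dxi x).
Proof.
move=> sB [xk [N xN]]; split.
  move=> m; apply: submodZ => //; have := xk (m + 1).
  by rewrite (_ : k - 2 * (m + 1) = k - 2 - 2 * m)//; ring.
exists N => m Nm; rewrite /d_dxi xN ?scaler0//; lia.
Qed.

Lemma Tshift_nat_iso (B : dgalg) (x : (int -> B) * (int -> B)) :
  Tshift (nat_iso x) = nat_iso (x.2, d_dxi x.1).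
Proof. by []. Qed.

Lemma nat_iso_inv (B : dgalg) (x : int -> B * B) :
  nat_iso (fun m => (x m).1, fun m => (x m).2) = x.
Proof. by apply/funext => m; rewrite /nat_iso /=; case: (x m). Qed.

Lemma Tshift_gr (B : dgalg) k x : (forall l, submod (gr B l)) ->
  ext_series B k x -> ext_series B (k - 1) (Tshift x).
Proof.
move=> sB /ext_seriesP[x1 x2]; apply/ext_seriesP; split; first exact: x2.
by have := d_dxi_gr sB x1; rewrite (_ : k - 1 - 1 = k - 2)//; ring.
Qed.

Lemma mono_scaleN (M : lmodType C) n (c : C) (a b : M) m :
  c *: a = - b -> c *: mono n a m = - mono n b m.
Proof. by move=> e; rewrite /mono; case: ifP => _; rewrite ?e// scaler0 oppr0. Qed.

Section Final.
Variables (A0 : dgalg) (rA : right_unital A0).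
Local Notation A := (laurent_u A0).
Local Notation At := (tau_ext (laurent_u A0)).

Let sA k : submod (gr A0 k).
Proof. exact: ru_sub. Qed.

Let sU k : submod (gr A k).
Proof. by apply: ru_sub; exact: laurent_u_right_unital. Qed.

Let sTA k : submod (gr (tau_ext A0) k).
Proof. exact: (tens_submod (M := A0) Hol (sA k)). Qed.

Let sT k : submod (gr At k).
Proof. exact: (tens_submod (M := A) Hol (sU k)). Qed.

Let sM k : submod (M0_of (tau_ext A0) k).
Proof. exact: (tens_submod (M := tau_ext A0) M0 (sTA k)). Qed.

Let sJ s k : submod (J0_of A0 s k).
Proof. exact: (tens_submod (M := A0) (J0 s) (sA k)). Qed.

Lemma tau_ext_right_unital : right_unital At.
Proof.
have rU := laurent_u_right_unital rA.
split; first exact: sT.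
- move=> k a c ak; apply/funext => t.
  exact: (ru_mulZ1 rU c (tens_val t (sU k) ak)).
- by move=> k a ak; apply/funext => t; exact: (ru_par rU (tens_val t (sU k) ak)).
- by move=> a c; apply/funext => t; exact: (ru_mul11 rU).
- by move=> a; apply/funext => t; exact: (ru_par1 rU).
Qed.

(** The image lies in the algebraic tensor product with Hol: g (x) (h (x) a) goes to h times one
    series in xi. The coefficient of xi^m carries u^(i-m), of total degree 2 i with xi^m, hence the
    degree k + 2 i. *)
Lemma mu_tens i k x : M0_of (tau_ext A0) k x ->
  tens Hol (laurent_xi A (k + 2 * i)) (fun t m => mu i x m t).
Proof.
move=> /tens_elim[n [f [v [Ff Vv ->]]]]; rewrite mu_sum//.
have sH : submod (tens Hol (laurent_xi A (k + 2 * i)) : set (upper -> int -> A)).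
  exact: (tens_submod (M := int -> A) Hol (laurent_xi_submod _ sU)).
have mono_sum l (F : 'I_n -> A0) : mono l (\sum_(j < n) F j) = \sum_(j < n) (mono l (F j) : A).
  apply/funext => l'; rewrite (fun_sumE (M := A0)) /mono; case: ifP => // _.
  by rewrite big1.
pose G j : upper -> int -> A := fun t m => mono (i - m) (lcoef (f j) (i - m) *: v j t).
have -> : (fun t m => mono (i - m) (\sum_(j < n) lcoef (f j) (i - m) *: v j t)) = \sum_(j < n) G j.
  apply/funext => t; apply/funext => m; rewrite mono_sum.
  rewrite (fun_sumE (M := int -> A)).
  by rewrite (fun_sumE (M := A)).
apply: (submod_sum (M := upper -> int -> A)) => // j.
have [p [h [a [Hh Va vE]]]] := tens_elim (Vv j).
(* The expansion at the single point q = 1 already provides a lower bound [n0] of the support, which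
   becomes the upper bound i - n0 for exponents of xi. *)
have /lcoefP/(_ (punct (oner_neq0 C)))[n0 [c0 _]] := Ff j.
have -> : G j = fun t => \sum_(r < p) h r t *: ((fun m => mono (i - m) (lcoef (f j) (i - m) *: a r)) : int -> A).
  apply/funext => t; apply/funext => m; rewrite (fun_sumE (M := A)) /G vE.
  transitivity (\sum_(r < p) h r t *: (mono (i - m) (lcoef (f j) (i - m) *: a r) : A)); last by [].
  rewrite scaler_sumr.
  apply/funext => l; rewrite (fun_sumE (M := A0)).
  transitivity (\sum_(r < p) h r t *: mono (i - m) (lcoef (f j) (i - m) *: a r) l); last by [].
  rewrite /mono; case: ifP => _; last by rewrite big1// => r _; rewrite scaler0.
  by apply: eq_bigr => r _; rewrite !scalerA mulrC.
apply: tens_intro => // r; split.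
  move=> m; split; last first.
    exists (i - m) => l lm; rewrite /mono; case: eqP => // e; by rewrite e ltxx in lm.
  move=> l; rewrite /mono; case: eqP => [->|_]; last by have [] := sA (k + 2 * i - 2 * m - 2 * l).
  apply: submodZ => //; have := Va r.
  by rewrite (_ : k + 2 * i - 2 * m - 2 * (i - m) = k)//; ring.
exists (i - n0) => m mn; rewrite c0; last by lia.
by rewrite scale0r; apply/funext => l; rewrite /mono; case: ifP.
Qed.

(** Passes from finite sums of functions of tau times series in xi to series whose coefficients are
    such sums. *)
Lemma tens_coefs k (Psi : upper -> int -> A) : tens Hol (laurent_xi A k) Psi ->
  laurent_xi At k (fun m t => Psi t m).
Proof.
move=> /tens_elim[n [f [v [Ff Vv ->]]]].
have -> : (fun (m : int) (t : upper) => (\sum_(i < n) f i t *: v i) m) =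
    \sum_(i < n) ((fun m t => f i t *: v i m) : int -> At).
  apply/funext => m; apply/funext => t.
  by rewrite (fun_sumE (M := A)) (fun_sumE (M := At)) (fun_sumE (M := A)).
apply: (submod_sum (M := int -> At)); first exact: laurent_xi_submod.
move=> i; have [vk [N vN]] := Vv i; split.
  by move=> m; exact: (tens1 (M := A) (Ff i) (vk m)).
by exists N => m /vN e; apply/funext => t; rewrite e scaler0.
Qed.

Lemma mu_gr i k x : M0_of (tau_ext A0) k x -> laurent_xi At (k + 2 * i) (mu i x).
Proof. by move=> /(mu_tens i) /tens_coefs. Qed.

Lemma mu_lin i k (c : C) x y : M0_of (tau_ext A0) k x -> M0_of (tau_ext A0) k y ->
  mu i (c *: x + y) = c *: mu i x + mu i y.
Proof. by move=> hx hy; exact: (tlift_lin c M0_submod (bilin_mu A0 i) hx hy). Qed.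

Lemma mu0 i : mu i 0 = 0 :> (int -> At).
Proof.
have h0 : M0_of (tau_ext A0) 0 0 by have [] := sM 0.
by have := mu_lin i (-1) h0 h0; rewrite scaleN1r addNr => ->; rewrite scaleN1r addNr.
Qed.

(** If [mu i z] vanishes, every Laurent coefficient of z = sum f_j v_j vanishes. The module has no
    topology in which to sum these relations, so [tens_kernel] is applied to the coefficient
    sequences of the f_j, as functions on the integers, with the bilinear map that sums a sequence
    at q and scales a vector by the result. *)
Lemma mu_inj i k x y : M0_of (tau_ext A0) k x -> M0_of (tau_ext A0) k y ->
  mu i x = mu i y -> x = y.
Proof.
move=> hx hy e; have [_ hZ] := sM k.
suff H z : M0_of (tau_ext A0) k z -> mu i z = 0 -> z = 0.
  have : mu i (-1 *: y + x) = 0 by rewrite (mu_lin i _ hy hx) scaleN1r e addNr.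
  move=> /(H _ (hZ _ _ _ hy hx)); rewrite scaleN1r addrC => /eqP.
  by rewrite subr_eq0 => /eqP.
move=> /tens_elim[n [f [v [Ff Vv ->]]]]; rewrite mu_sum// => z0.
(* Read off the coefficient of u^l xi^(i-l). *)
have {}z0 l : \sum_(j < n) lcoef (f j) l *: v j = 0.
  apply/funext => t; have := congr1 (fun F : int -> At => F (i - l) t l) z0.
  rewrite /mono (_ : i - (i - l) = l); last by rewrite opprB addrC subrK.
  by rewrite eqxx (fun_sumE (M := A0)).
apply/funext => q.
pose Fl : set (int -> C) := [set c | exists2 g, M0 g & c = lcoef g].
have Fl_submod : submod (Fl : set (int -> C^o)).
  split; first exists (fun=> 0); first exact: M0_cst.
    apply/esym/lcoefE => p; have := laurent_sum_const 0 (valP p).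
    by rewrite (_ : (fun n0 : int => if n0 == 0 then 0 else 0) = fun=> 0)//; apply/funext => m; case: ifP.
  move=> c _ _ [g Mg ->] [h Mh ->]; exists (fun p => c * g p + h p); first exact: M0_lin.
  by rewrite lcoef_lin.
have lv g : M0 g -> laurent_val (lcoef g) (val q) = g q.
  by move=> Mg; apply: laurent_val_sum; [exact: (valP q)|exact: lcoefP].
pose b (c : int -> C) (w : tau_ext A0) : tau_ext A0 := laurent_val c (val q) *: w.
have bl w (c : C) c1 c2 : Fl c1 -> Fl c2 -> b (fun l => c * c1 l + c2 l) w = c *: b c1 w + b c2 w.
  move=> [g Mg c1E] [h Mh c2E].
  have e1 : b c1 w = g q *: w by rewrite c1E; congr (_ *: _); exact: lv.
  have e2 : b c2 w = h q *: w by rewrite c2E; congr (_ *: _); exact: lv.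
  have cE : (fun l => c * c1 l + c2 l) = lcoef (fun p => c * g p + h p).
    by rewrite c1E c2E lcoef_lin.
  have -> : b (fun l => c * c1 l + c2 l) w = (c * g q + h q) *: w.
    by rewrite cE; congr (_ *: _); apply: lv; exact: M0_lin.
  by rewrite e1 e2 scalerDl scalerA.
have br c (d : C) w w' : Fl c -> b c (d *: w + w') = d *: b c w + b c w'.
  by move=> _; rewrite /b scalerDr !scalerA mulrC.
have Fc j : Fl (lcoef (f j)) by exists (f j).
transitivity (\sum_(j < n) b (lcoef (f j)) (v j)).
  by apply: eq_bigr => j _; congr (_ *: _); apply/esym/lv.
exact: (tens_kernel Fl_submod bl br Fc z0).
Qed.

Lemma q_d_dq_gr k x : M0_of (tau_ext A0) k x -> M0_of (tau_ext A0) k (q_d_dq x).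
Proof.
move=> /tens_elim[n [f [v [Ff Vv ->]]]]; rewrite q_d_dq_sum//.
by apply: tens_intro => // j; exact: M0_qD.
Qed.

Lemma q_d_dq_lin k (c : C) x y : M0_of (tau_ext A0) k x -> M0_of (tau_ext A0) k y ->
  q_d_dq (c *: x + y) = c *: q_d_dq x + q_d_dq y.
Proof. by move=> hx hy; exact: (tlift_lin c M0_submod (bilin_q_d_dq _) hx hy). Qed.

(** On both sides the coefficient of xi^m involves only n = -1 - m, and the factor m + 1 from d/d xi
    equals -n, as produced by -q d/dq. *)
Lemma d_dxi_mu k x : M0_of (tau_ext A0) k x -> d_dxi (mu 0 x) = mu (-1) (- q_d_dq x).
Proof.
move=> hx; have hq := q_d_dq_gr hx; have h0 : M0_of (tau_ext A0) k 0 by have [] := sM k.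
have -> : mu (-1) (- q_d_dq x) = - mu (-1) (q_d_dq x).
  by have := mu_lin (-1) (-1) hq h0; rewrite addr0 scaleN1r mu0 addr0 scaleN1r.
move: hx {hq h0} => /tens_elim[n [f [v [Ff Vv ->]]]]; rewrite q_d_dq_sum// !mu_sum//; last first.
  by move=> j; exact: M0_qD.
apply/funext => m; apply/funext => t; apply/funext => l; rewrite /d_dxi.
transitivity (((m + 1)%:~R : C) *: mono (0 - (m + 1)) (\sum_(j < n) lcoef (f j) (0 - (m + 1)) *: v j t) l).
  by [].
transitivity (- mono (-1 - m) (\sum_(j < n) lcoef (qD (f j)) (-1 - m) *: v j t) l); last by [].
have -> : 0 - (m + 1) = -1 - m by ring.
apply: mono_scaleN; rewrite scaler_sumr -sumrN; apply: eq_bigr => j _; rewrite lcoef_qD// scalerA -scaleNr.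
by congr (_ *: _); rewrite -mulNr -intrN; congr (_%:~R * _); ring.
Qed.

Let J00 s k : J0_of A0 s k 0.
Proof. by have [] := sJ s k. Qed.

Lemma qexp0 s : qexp s (0 : C * upper -> A0) = 0.
Proof. by rewrite (qexpE (J00 s 0)). Qed.

Lemma qexp_gr s k x : J0_of A0 s k x -> M0_of (tau_ext A0) k (qexp s x).
Proof. by move=> hx; rewrite (qexpE hx); apply: M0_of_cst; exact: J0_of_slice hx. Qed.

Lemma qexp_lin s k (c : C) x y : J0_of A0 s k x -> J0_of A0 s k y ->
  qexp s (c *: x + y) = c *: qexp s x + qexp s y.
Proof.
by move=> hx hy; have [_ hZ] := sJ s k; rewrite (qexpE hx) (qexpE hy) (qexpE (hZ c _ _ hx hy)).
Qed.

(** Both sides are 0: the form is constant in z and its q-expansion is constant in q. *)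
Lemma row_M_qexp s k x : J0_of A0 s k x -> - q_d_dq (qexp s x) = qexp (s + 1) (jac_D s x).
Proof. by move=> hx; rewrite (jac_D0 hx) qexp0 (qexpE hx) q_d_dq_cst oppr0. Qed.

(** The two gerbes have the same underlying graded space [ext_series] and both Hori maps are
    [Tshift] on it, so this covers both directions. *)
Lemma hori_diagram_Tshift s1 s2 T : (forall k x, ext_series At k x -> T x = Tshift x) ->
  hori_diagram s1 s2 (ext_series At) (ext_series At) T.
Proof.
move=> TE.
have isoS : giso (@src_xi A0) (ext_series At) (@nat_iso At).
  split=> [k|k].
    by split=> // x [x1 x2]; apply/ext_seriesP.
  split=> [x [x1 x2]|x y _ _ e|x /ext_seriesP[x1 x2]]; first exact/ext_seriesP.
    case: x y e => [a b] [a' b'] e; congr pair; apply/funext => m.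
      by have := congr1 (fun F : int -> At * At => (F m).1) e.
    by have := congr1 (fun F : int -> At * At => (F m).2) e.
  by exists (fun m => (x m).1, fun m => (x m).2) => //; rewrite nat_iso_inv.
(* The target of the third row is the source shifted by [-1], so the left isomorphism also yields
   the right one. *)
have tgtE k : @tgt_xi A0 k = @src_xi A0 (k - 1).
  by rewrite /tgt_xi /src_xi /dsum /gshift (_ : k - 1 - 1 = k - 2)//; ring.
have mu_src k x : @src_M A0 k x -> @src_xi A0 k (dmap (@mu A0 0) (@mu A0 0) x).
  move=> [x1 x2]; split; first by have := mu_gr 0 x1; rewrite mulr0 addr0.
  by have := mu_gr 0 x2; rewrite mulr0 addr0.
split; split.
- move=> k; split.
    move=> x [x1 x2]; split; first exact: x2.
    by rewrite /row_J /= (jac_D0 x1).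
  move=> c x y [x1 x2] [y1 y2]; rewrite /row_J; have [_ hZ] := sJ s1 k.
  rewrite (jac_D0 x1) (jac_D0 y1) (jac_D0 (hZ c _ _ x1 y1)).
  by congr pair; rewrite /= scaler0 addr0.
- move=> k; split.
    move=> x [x1 x2]; split; first exact: x2.
    by rewrite /row_M /= -scaleN1r; apply: submodZ => //; exact: q_d_dq_gr.
  move=> c x y [x1 x2] [y1 y2]; rewrite /row_M /= (q_d_dq_lin c x1 y1).
  by congr pair; rewrite /= opprD scalerN.
- move=> k; split.
    by move=> x [x1 x2]; split; [exact: x2|exact: d_dxi_gr x1].
  by move=> c x y _ _; rewrite /row_xi /= d_dxi_lin.
- move=> k; split; first by move=> x hx; rewrite (TE _ _ hx); exact: Tshift_gr.
  move=> c x y hx hy; have [_ hZ] := ext_series_submod k sT.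
  by rewrite (TE _ _ hx) (TE _ _ hy) (TE _ _ (hZ c _ _ hx hy)) Tshift_lin.
- move=> k; split; first by move=> x [x1 x2]; split; exact: qexp_gr.
  by move=> c x y [x1 x2] [y1 y2]; rewrite /dmap /= (qexp_lin c x1 y1) (qexp_lin c x2 y2).
- move=> k; split; first exact: mu_src.
  by move=> c x y [x1 x2] [y1 y2]; rewrite /dmap /= (mu_lin 0 c x1 y1) (mu_lin 0 c x2 y2).
- move=> k [a b] [a' b'] /set_mem[x1 x2] /set_mem[y1 y2] [e1 e2].
  by congr pair; [exact: mu_inj x1 y1 e1|exact: mu_inj x2 y2 e2].
- exact: isoS.
- move=> k; split; first by move=> x [x1 x2]; split; exact: qexp_gr.
  by move=> c x y [x1 x2] [y1 y2]; rewrite /dmap /= (qexp_lin c x1 y1) (qexp_lin c x2 y2).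
- move=> k; split.
    move=> x [x1 x2]; split; first by have := mu_gr 0 x1; rewrite mulr0 addr0.
    by have := mu_gr (-1) x2; rewrite mulrN1.
  by move=> c x y [x1 x2] [y1 y2]; rewrite /dmap /= (mu_lin 0 c x1 y1) (mu_lin (-1) c x2 y2).
- move=> k [a b] [a' b'] /set_mem[x1 x2] /set_mem[y1 y2] [e1 e2].
  by congr pair; [exact: mu_inj x1 y1 e1|exact: mu_inj x2 y2 e2].
- by case: isoS => [h1 h2]; split=> k; rewrite tgtE; [exact: h1|exact: h2].
- by move=> k x [x1 x2]; rewrite /row_M /row_J /dmap /= (row_M_qexp x1).
- by move=> k x [x1 x2]; rewrite /row_xi /row_M /dmap /= (d_dxi_mu x1).
- by move=> k x [x1 x2]; rewrite (TE k)//; exact/ext_seriesP.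
Qed.

(** Applying [Tshift] twice gives d/d xi on both components; [d_dxi_mu] and [row_M_qexp], used once
    for each, carry it back to Jacobi forms. *)
Lemma hori_composite_Tshift s1 s2 T T' : (forall k x, ext_series At k x -> T x = Tshift x) ->
  (forall k x, ext_series At k x -> T' x = Tshift x) ->
  hori_composite s1 s2 (ext_series At) T T'.
Proof.
move=> TE TE'.
have TT k x : ext_series At k x -> T' (T x) = Tshift (Tshift x).
  by move=> hx; rewrite (TE _ _ hx) (TE' _ _ (Tshift_gr sT hx)).
have [_ [_ _ _ isoS] _ _] := @hori_diagram_Tshift s1 s2 T TE.
split.
- move=> k; split.
    by move=> x [x1 x2]; rewrite /dmap (jac_D0 x1) (jac_D0 x2); split; exact: J00.
  move=> c x y [x1 x2] [y1 y2]; have [_ hZ] := sJ s1 k; have [_ hZ'] := sJ s2 (k - 1).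
  rewrite /dmap (jac_D0 x1) (jac_D0 y1) (jac_D0 (hZ c _ _ x1 y1)).
  rewrite (jac_D0 x2) (jac_D0 y2) (jac_D0 (hZ' c _ _ x2 y2)).
  by congr pair; rewrite /= scaler0 addr0.
- move=> k; split.
    move=> x hx; rewrite (TT _ _ hx); have := Tshift_gr sT (Tshift_gr sT hx).
    by rewrite /gshift (_ : k - 1 - 1 = k - 2)//; ring.
  move=> c x y hx hy; have [_ hZ] := ext_series_submod k sT.
  by rewrite (TT _ _ hx) (TT _ _ hy) (TT _ _ (hZ c _ _ hx hy)) !Tshift_lin.
- move=> k; split.
    move=> x [x1 x2]; split; first by have := mu_gr (-1) x1; rewrite mulrN1.
    have := mu_gr (-1) x2; rewrite mulrN1 /gshift.
    by rewrite (_ : k - 1 - 2 = k - 2 - 1)//; ring.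
  by move=> c x y [x1 x2] [y1 y2]; rewrite /dmap /= (mu_lin (-1) c x1 y1) (mu_lin (-1) c x2 y2).
- by case: isoS => [h1 h2]; split=> k; [exact: h1|exact: h2].
- move=> k x [x1 x2]; have q1 := qexp_gr x1; have q2 := qexp_gr x2.
  rewrite (TT k); last first.
    apply/ext_seriesP; split; first by have := mu_gr 0 q1; rewrite mulr0 addr0.
    by have := mu_gr 0 q2; rewrite mulr0 addr0.
  rewrite !Tshift_nat_iso /dmap /= (d_dxi_mu q1) (d_dxi_mu q2).
  by rewrite (row_M_qexp x1) (row_M_qexp x2).
Qed.

(** [Tshift] acts at each tau separately, hence commutes with [tau_coefs]; the second row lands in
    the algebraic tensor product by [mu_tens]. *)
Lemma hori_restrict_Tshift S T : (forall k x, ext_series A k x -> S x = Tshift x) ->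
  (forall k x, ext_series At k x -> T x = Tshift x) ->
  hori_restrict (fun k => tens Hol (ext_series A k)) (fun k => tens Hol (ext_series A k)) S
    (ext_series At) T.
Proof.
move=> SE TE.
have sE k : submod (ext_series A k) by exact: ext_series_submod.
have SPhi k Phi : tens Hol (ext_series A k) Phi -> (fun t => S (Phi t)) = fun t => Tshift (Phi t).
  by move=> hP; apply/funext => t; exact: SE (tens_val t (sE k) hP).
have tau_gr k Phi : tens Hol (ext_series A k) Phi -> ext_series At k (@tau_coefs A Phi).
  move=> hP; apply/ext_seriesP; split.
    apply: (@tens_coefs k (fun t m => (Phi t m).1)).
    apply: (tens_map (L := fun x : int -> A * A => (fun m => (x m).1) : int -> A)) hP => //.
    by move=> x /ext_seriesP[].
  apply: (@tens_coefs (k - 1) (fun t m => (Phi t m).2)).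
  apply: (tens_map (L := fun x : int -> A * A => (fun m => (x m).2) : int -> A)) hP => //.
  by move=> x /ext_seriesP[].
(* The two components have different expansions; each is embedded with a zero partner and the
   results are added. *)
have pairs k (u v : upper -> int -> A) : tens Hol (laurent_xi A k) u ->
    tens Hol (laurent_xi A (k - 1)) v -> tens Hol (ext_series A k) (fun t m => (u t m, v t m)).
  move=> hu hv.
  have h1 : tens Hol (ext_series A k) (fun t m => (u t m, 0)).
    apply: (tens_map (L := fun x : int -> A => (fun m => (x m, 0)) : int -> A * A)) hu.
      move=> c x y; apply/funext => m; congr pair; by rewrite /= scaler0 addr0.
    by move=> x hx; apply/ext_seriesP; split => //; have [] := laurent_xi_submod (k - 1) sU.
  have h2 : tens Hol (ext_series A k) (fun t m => (0, v t m)).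
    apply: (tens_map (L := fun x : int -> A => (fun m => (0, x m)) : int -> A * A)) hv.
      move=> c x y; apply/funext => m; congr pair; by rewrite /= scaler0 addr0.
    by move=> x hx; apply/ext_seriesP; split => //; have [] := laurent_xi_submod k sU.
  have := submodD (tens_submod (M := int -> A * A) Hol (sE k)) h1 h2.
  rewrite (_ : _ + _ = (fun t m => (u t m, v t m)))//.
  by apply/funext => t; apply/funext => m; congr pair; rewrite /= ?addr0 ?add0r.
split.
- move=> k; split.
    move=> Phi hP; rewrite (SPhi _ _ hP).
    apply: (tens_map (L := @Tshift A)) hP; first exact: Tshift_lin.
    by move=> x; exact: Tshift_gr.
  move=> c x y hx hy; have [_ hZ] := tens_submod (M := int -> A * A) Hol (sE k).
  rewrite (SPhi _ _ hx) (SPhi _ _ hy) (SPhi _ _ (hZ c _ _ hx hy)).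
  by apply/funext => t; exact: Tshift_lin.
- by move=> k; split; first exact: tau_gr.
- move=> k x y _ _ e; apply/funext => t; apply/funext => m.
  have e1 := congr1 (fun F : int -> At * At => (F m).1 t) e.
  have e2 := congr1 (fun F : int -> At * At => (F m).2 t) e.
  by rewrite [LHS]surjective_pairing [RHS]surjective_pairing; congr pair.
- move=> k Phi hP; rewrite (SPhi _ _ hP) (TE _ _ (tau_gr _ _ hP)).
  by [].
- move=> k; split.
    move=> x [x1 x2]; exists (fun t m => (mu 0 x.1 m t, mu 0 x.2 m t)) => //.
    apply: pairs; first by have := mu_tens 0 x1; rewrite mulr0 addr0.
    by have := mu_tens 0 x2; rewrite mulr0 addr0.
  move=> x [x1 x2]; exists (fun t m => (mu 0 x.1 m t, mu (-1) x.2 m t)) => //.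
  apply: pairs; first by have := mu_tens 0 x1; rewrite mulr0 addr0.
  have := mu_tens (-1) x2; rewrite mulrN1.
  by rewrite (_ : k - 1 - 1 = k - 2)//; ring.
Qed.

End Final.

Theorem mainTheorem3 (A0 : dgalg) (f : tdual -> A0) :
  is_dgca A0 -> nonneg_graded A0 -> dgca_morphism f ->
  let fA := conf_A f in
  let ft := conf_At f in
  (forall (s : int) (J : C * upper -> C), J0 s J -> is_qexp J (qcoef J)) /\
  (forall g : punctured -> C, M0 g -> is_laurent g (lcoef g)) /\
  (forall s1 s2 : int,
    [/\ hori_diagram s1 s2 (gr (G_L ft)) (gr (G_R ft)) (@T_LR _ ft),
        hori_diagram s1 s2 (gr (G_R ft)) (gr (G_L ft)) (@T_RL _ ft),
        hori_composite s1 s2 (gr (G_L ft)) (@T_LR _ ft) (@T_RL _ ft)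
      & hori_composite s1 s2 (gr (G_R ft)) (@T_RL _ ft) (@T_LR _ ft)]) /\
  hori_restrict (gr (tau_ext (G_L fA))) (gr (tau_ext (G_R fA))) (@T_LR _ fA)
    (gr (G_L ft)) (@T_LR _ ft) /\
  hori_restrict (gr (tau_ext (G_R fA))) (gr (tau_ext (G_L fA))) (@T_RL _ fA)
    (gr (G_R ft)) (@T_RL _ ft).
Proof.
move=> /dgca_right_unital rA _ _ fA ft.
(* The formula for the Hori maps is needed over A for the algebraic tensor products and over A(tau)
   for the diagrams. *)
have rU := laurent_u_right_unital rA; have rT := tau_ext_right_unital rA.
have LR k x : ext_series _ k x -> T_LR (f := ft) x = Tshift x := @T_LRE _ ft rT k x.
have RL k x : ext_series _ k x -> T_RL (f := ft) x = Tshift x := @T_RLE _ ft rT k x.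
have LRA k x : ext_series _ k x -> T_LR (f := fA) x = Tshift x := @T_LRE _ fA rU k x.
have RLA k x : ext_series _ k x -> T_RL (f := fA) x = Tshift x := @T_RLE _ fA rU k x.
split; first by move=> s J; exact: qcoefP.
split; first exact: lcoefP.
split.
  move=> s1 s2; split; [exact: hori_diagram_Tshift|exact: hori_diagram_Tshift|
    exact: hori_composite_Tshift|exact: hori_composite_Tshift].
by split; exact: hori_restrict_Tshift.
Qed.
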